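(* Let $\Bbbk$ be an algebraically closed field of characteristic $0$. Let $n\in\mathbb{N}$, $n\ge3$, and let $G=\mathbb{S}_n$ be the symmetric group. Let $0\ne U\in{}^G_G\mathcal{YD}$. If $\mathfrak{B}(U)$ is finite-dimensional, then $U$ is irreducible in ${}^G_G\mathcal{YD}$.
   Context: ${}^G_G\mathcal{YD}$ is the category of (left) Yetter-Drinfeld modules over the group algebra $\Bbbk G$: $G$-graded vector spaces $U=\bigoplus_{s\in G}U_s$ (with coaction $\delta(u)=s\otimes u$ for $u\in U_s$) which are $G$-modules such that $h\cdot U_s=U_{hsh^{-1}}$ for all $h,s\in G$. It is braided with $c(x\otimes y)=s\cdot y\otimes x$ for $x$ of degree $s$. For $U\in{}^G_G\mathcal{YD}$ the tensor algebra $T(U)$ is a braided Hopf algebra in which the elements of $U$ are primitive, and the Nichols algebra is $\mathfrak{B}(U)=T(U)/I_U$, where $I_U$ is the largest coideal of $T(U)$ contained in $\bigoplus_{n\ge2}U^{\otimes n}$. *)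

(* Defs.v *)
From HB Require Import structures.
From mathcomp Require Import all_boot all_order all_algebra all_fingroup.
From mathcomp Require Import ring_quotient generic_quotient.
From mathcomp Require Import boolp.
From mathcomp Require Import finmap monalg.

Set Implicit Arguments.
Unset Strict Implicit.
Unset Printing Implicit Defensive.

Import GRing.Theory.
Local Open Scope ring_scope.
Local Open Scope quotient_scope.

Section Span.
Context (k : fieldType) (V : lmodType k).
Implicit Types (P : V -> Prop) (x y : V).

Definition spanP P x : Prop :=
  exists s : seq (k * V),
    (forall p, p \in s -> P p.2) /\ x = \sum_(p <- s) p.1 *: p.2.

Definition span P : {pred V} := fun x => `[< spanP P x >].

Lemma spanE P x : x \in span P <-> spanP P x.
Proof. by split=> /asboolP. Qed.

Fact span_submod P : GRing.subsemimod_closed (span P).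
Proof.
split; first split.
- by apply/spanE; exists [::]; rewrite big_nil.
- move=> x y /spanE[s [sP ->]] /spanE[t [tP ->]]; apply/spanE.
  exists (s ++ t); split; last by rewrite big_cat.
  by move=> p; rewrite mem_cat => /orP[/sP|/tP].
- move=> c x /spanE[s [sP ->]]; apply/spanE.
  exists [seq (c * p.1, p.2) | p <- s]; split.
    by move=> _ /mapP[p /sP Pp ->].
  by rewrite big_map scaler_sumr; apply: eq_bigr => p _; rewrite scalerA.
Qed.

HB.instance Definition _ P :=
  GRing.isSubmodClosed.Build k V (span P) (span_submod P).

Lemma mem_span P x : P x -> x \in span P.
Proof.
move=> Px; apply/spanE; exists [:: (1, x)]; split.
  by move=> p; rewrite inE => /eqP->.
by rewrite big_seq1 scale1r.
Qed.

Lemma span_min P (S : {pred V}) :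
  submod_closed S -> (forall x, P x -> x \in S) -> {subset span P <= S}.
Proof.
case=> S0 SL PS x /spanE[s [sP ->]]; rewrite big_seq.
elim/big_ind: _ => // [y z Sy Sz|p /sP/PS Sp].
  by rewrite -[y]scale1r SL.
by rewrite -[_ *: _]addr0 SL.
Qed.

End Span.

(* the quotient of V by the subspace spanned by P *)
Definition lquot (k : fieldType) (V : lmodType k) (P : V -> Prop) : Type :=
  Quotient.quot (span P).

HB.instance Definition _ (k : fieldType) (V : lmodType k) (P : V -> Prop) :=
  GRing.Zmodule.on (lquot P).
HB.instance Definition _ (k : fieldType) (V : lmodType k) (P : V -> Prop) :=
  EqQuotient.on (lquot P).

HB.lock Definition qproj (k : fieldType) (V : lmodType k) (P : V -> Prop)
  (x : V) : lquot P := \pi_(lquot P) x.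

HB.lock Definition qrepr (k : fieldType) (V : lmodType k) (P : V -> Prop)
  (x : lquot P) : V := repr x.

HB.lock Definition qscale (k : fieldType) (V : lmodType k) (P : V -> Prop)
  (c : k) (x : lquot P) : lquot P := qproj P (c *: qrepr x).

Section QuotientModule.
Context (k : fieldType) (V : lmodType k) (P : V -> Prop).
Local Notation Q := (lquot P).

Lemma qproj_eq x y : (qproj P x = qproj P y) <-> x - y \in span P.
Proof.
rewrite qproj.unlock Quotient.idealrBE.
by split=> [e|/eqP//]; apply/eqP; exact: e.
Qed.

Lemma qreprK : cancel (@qrepr k V P) (qproj P).
Proof. by move=> x; rewrite qproj.unlock qrepr.unlock; apply: reprK. Qed.

Fact qproj_zmod : zmod_morphism (qproj P).
Proof. by move=> x y; rewrite qproj.unlock !piE. Qed.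
HB.instance Definition _ :=
  GRing.isZmodMorphism.Build V Q (qproj P) qproj_zmod.

Lemma qproj_scale c x : qscale c (qproj P x) = qproj P (c *: x).
Proof.
rewrite qscale.unlock; apply/qproj_eq; rewrite -scalerBr rpredZ //.
exact/qproj_eq/qreprK.
Qed.

Fact qscaleA a b (x : Q) : qscale a (qscale b x) = qscale (a * b) x.
Proof. by rewrite -[x]qreprK !qproj_scale scalerA. Qed.
Fact qscale1 : left_id 1 (@qscale k V P).
Proof. by move=> x; rewrite -[x]qreprK qproj_scale scale1r. Qed.
Fact qscaleDr : right_distributive (@qscale k V P) +%R.
Proof.
move=> c x y; rewrite -[x]qreprK -[y]qreprK -raddfD !qproj_scale.
by rewrite scalerDr raddfD.
Qed.
Fact qscaleDl (x : Q) : {morph (@qscale k V P)^~ x : a b / a + b}.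
Proof.
by move=> a b; rewrite /= -[x]qreprK !qproj_scale scalerDl raddfD.
Qed.
HB.instance Definition _ :=
  GRing.Zmodule_isLmodule.Build k Q qscaleA qscale1 qscaleDr qscaleDl.

Fact qproj_scalable : scalable (qproj P).
Proof. by move=> c x; rewrite -qproj_scale. Qed.
HB.instance Definition _ :=
  GRing.isScalable.Build k V Q *:%R (qproj P) qproj_scalable.

End QuotientModule.

(* a linear map vanishing on P factors through lquot P *)
HB.lock Definition qlift (k : fieldType) (V W : lmodType k) (P : V -> Prop)
  (f : V -> W) (x : lquot P) : W := f (qrepr x).

Section QuotientLift.
Context (k : fieldType) (V W : lmodType k) (P : V -> Prop).
Context (f : {linear V -> W}) (fP : forall x, P x -> f x = 0).

Lemma qlift_proj x : qlift f (qproj P x) = f x.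
Proof.
rewrite qlift.unlock; apply/eqP; rewrite -subr_eq0 -raddfB /=.
have: qrepr (qproj P x) - x \in span P by apply/qproj_eq/qreprK.
case/spanE=> s [sP ->]; rewrite raddf_sum big_seq big1 //= => p /sP Pp.
by rewrite linearZ /= fP // scaler0.
Qed.

Lemma qlift_linear : linear (@qlift k V W P f).
Proof.
move=> c x y; rewrite -[x]qreprK -[y]qreprK -linearP !qlift_proj.
by rewrite linearP.
Qed.

End QuotientLift.

HB.lock Definition mlift (k : fieldType) (K : choiceType) (W : lmodType k)
    (h : K -> W) (g : {malg k[K]}) : W :=
  \sum_(x <- msupp g) g@_x *: h x.

Section FreeModule.
Context (k : fieldType) (K : choiceType) (W : lmodType k) (h : K -> W).

Lemma mliftE g : mlift h g = \sum_(x <- msupp g) g@_x *: h x.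
Proof. by rewrite mlift.unlock. Qed.

Lemma mliftEw (d : {fset K}) g : (msupp g `<=` d)%fset ->
  mlift h g = \sum_(x <- d) g@_x *: h x.
Proof.
move=> le; rewrite mliftE (big_fset_incl _ le) => //= x xd /mcoeff_outdom ->.
by rewrite scale0r.
Qed.

Lemma mliftU c x : mlift h << c *g x >> = c *: h x.
Proof. by rewrite (mliftEw msuppU_le) big_seq_fset1 mcoeffUU. Qed.

Fact mlift_linear : linear (@mlift k K W h).
Proof.
move=> c g1 g2.
have le1 : (msupp g1 `<=` msupp g1 `|` msupp g2)%fset by rewrite fsubsetUl.
have le2 : (msupp g2 `<=` msupp g1 `|` msupp g2)%fset by rewrite fsubsetUr.
rewrite (mliftEw le1) (mliftEw le2) (mliftEw (d := (msupp g1 `|` msupp g2)%fset)).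
  rewrite scaler_sumr -big_split /=; apply: eq_bigr => x _.
  by rewrite mcoeffD mcoeffZ scalerDl scalerA.
apply: fsubset_trans (msuppD_le _ _) _.
by rewrite fsetSU // msuppZ_le.
Qed.
HB.instance Definition _ :=
  GRing.isLinear.Build k {malg k[K]} W *:%R (mlift h) mlift_linear.

End FreeModule.

Lemma malg_span (k : fieldType) (K : choiceType) (g : {malg k[K]}) :
  g = \sum_(x <- msupp g) g@_x *: << x >>.
Proof.
rewrite {1}[g]monalgE; apply: eq_bigr => x _; apply/malgP=> y.
by rewrite mcoeffZ !mcoeffU mulrnAr mulr1.
Qed.

(* The tensor product is the free module on V * W modulo bilinearity. *)
Definition bilin (k : fieldType) (V W Z : lmodType k) (f : V -> W -> Z) : Prop :=
  (forall y, linear (f^~ y)) /\ (forall x, linear (f x)).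

Inductive tens_rel (k : fieldType) (V W : lmodType k) :
    {malg k[(V * W)%type]} -> Prop :=
  | TensRelL c x x' y :
      tens_rel (<< (c *: x + x', y) >> - (c *: << (x, y) >> + << (x', y) >>))
  | TensRelR x c y y' :
      tens_rel (<< (x, c *: y + y') >> - (c *: << (x, y) >> + << (x, y') >>)).

Definition tensor (k : fieldType) (V W : lmodType k) : Type :=
  lquot (@tens_rel k V W).
HB.instance Definition _ (k : fieldType) (V W : lmodType k) :=
  GRing.Lmodule.on (tensor V W).

HB.lock Definition tens (k : fieldType) (V W : lmodType k) (x : V) (y : W) :
  tensor V W := qproj (@tens_rel k V W) << (x, y) >>.

HB.lock Definition tens_lift (k : fieldType) (V W Z : lmodType k)
    (f : V -> W -> Z) (fB : bilin f) : tensor V W -> Z :=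
  qlift (mlift (fun p : V * W => f p.1 p.2)).

Section Tensor.
Context (k : fieldType) (V W : lmodType k).
Local Notation tensor := (tensor V W).
Local Notation tens := (@tens k V W).

Fact tens_bilin : bilin tens.
Proof.
split=> [y c x x'|x c y y']; rewrite tens.unlock -linearP; apply/qproj_eq/mem_span.
  exact: TensRelL.
exact: TensRelR.
Qed.
HB.instance Definition _ x :=
  GRing.isLinear.Build k W tensor *:%R (tens x) (tens_bilin.2 x).

Lemma tensDl x x' y : tens (x + x') y = tens x y + tens x' y.
Proof. by have := tens_bilin.1 y 1 x x'; rewrite /= !scale1r. Qed.
Lemma tens0l y : tens 0 y = 0.
Proof. by apply: (addIr (tens 0 y)); rewrite -tensDl !add0r. Qed.
Lemma tensZl c x y : tens (c *: x) y = c *: tens x y.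
Proof. by have := tens_bilin.1 y c x 0; rewrite /= tens0l !addr0. Qed.
Lemma tens_suml I (r : seq I) (F : I -> V) y :
  tens (\sum_(i <- r) F i) y = \sum_(i <- r) tens (F i) y.
Proof.
elim: r => [|i r IHr]; first by rewrite !big_nil tens0l.
by rewrite !big_cons tensDl IHr.
Qed.

Lemma tens_span (t : tensor) :
  exists s : seq (V * W), t = \sum_(p <- s) tens p.1 p.2.
Proof.
rewrite -[t]qreprK [qrepr t]malg_span raddf_sum /=.
set g := qrepr t; exists [seq (g@_p *: p.1, p.2) | p <- msupp g].
rewrite big_map; apply: eq_bigr => -[x y] _ /=.
by rewrite linearZ tensZl tens.unlock.
Qed.

Lemma tens_ext (Z : lmodType k) (f g : {linear tensor -> Z}) :
  (forall x y, f (tens x y) = g (tens x y)) -> f =1 g.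
Proof.
move=> fg t; have [s ->] := tens_span t.
by rewrite !raddf_sum; apply: eq_bigr => p _; apply: fg.
Qed.

Section Lift.
Context (Z : lmodType k) (f : V -> W -> Z).

Context (fB : bilin f).

Fact tens_lift_rel (r : {malg k[(V * W)%type]}) :
  tens_rel (W := W) r -> mlift (fun p : V * W => f p.1 p.2) r = 0.
Proof.
case: r / => [c x x' y|x c y y']; rewrite raddfB /= linearP /= !mliftU /= !scale1r.
  by rewrite [f _ y](fB.1 y) subrr.
by rewrite (fB.2 x) subrr.
Qed.

Fact tens_lift_linear : linear (tens_lift fB).
Proof. by rewrite tens_lift.unlock; apply: qlift_linear tens_lift_rel. Qed.
HB.instance Definition _ :=
  GRing.isLinear.Build k tensor Z *:%R (tens_lift fB) tens_lift_linear.

Lemma tens_liftE x y : tens_lift fB (tens x y) = f x y.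
Proof.
by rewrite tens_lift.unlock tens.unlock (qlift_proj tens_lift_rel) /= mliftU scale1r.
Qed.

End Lift.

End Tensor.

Section TensorMap.
Context (k : fieldType) (V V' W W' : lmodType k).
Context (f : {linear V -> V'}) (g : {linear W -> W'}).

Fact tens_map_bilin : bilin (fun x y => tens (f x) (g y)).
Proof.
split=> [y c x x'|x c y y'] /=; first by rewrite linearP tensDl tensZl.
by rewrite !linearP.
Qed.

Definition tens_map : tensor V W -> tensor V' W' := tens_lift tens_map_bilin.
HB.instance Definition _ := GRing.Linear.on tens_map.

Lemma tens_mapE x y : tens_map (tens x y) = tens (f x) (g y).
Proof. exact: tens_liftE. Qed.

End TensorMap.

Section MalgAlgebra.
Context (k : fieldType) (K : monomType).
Implicit Types g : {malg k[K]}.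

Lemma malg_scaleAr c g1 g2 : c *: (g1 * g2) = g1 * (c *: g2).
Proof.
apply/malgP=> x; rewrite mcoeffZ mcoeffMl.
rewrite (mcoeffMlw _ (fsubset_refl (msupp g1)) (msuppZ_le c g2)).
rewrite mulr_sumr; apply: eq_bigr => x1 _.
rewrite mulr_sumr; apply: eq_bigr => x2 _.
by rewrite mcoeffZ mulrnAr mulrCA.
Qed.

Lemma mliftM (A : algType k) (h : K -> A) :
    (forall x y : K, h (mmul x y) = h x * h y) ->
  {morph mlift h : x y / x * y}.
Proof.
move=> hM g1 g2; rewrite malgME raddf_sum [mlift h g1]mliftE mulr_suml.
apply: eq_bigr => x _; rewrite raddf_sum mliftE mulr_sumr.
apply: eq_bigr => y _; rewrite /= mliftU hM.
by rewrite -scalerAr -scalerAl !scalerA mulrC.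
Qed.

End MalgAlgebra.

(* The tensor algebra of V is the free associative algebra on the set V modulo
   the two-sided ideal generated by [c v + w] - (c [v] + [w]). *)
Inductive talg_rel (k : fieldType) (V : lmodType k) :
    {malg k[{fmonom V}]} -> Prop :=
  TalgRel (a b : {malg k[{fmonom V}]}) c v w :
    talg_rel (a * (<< fmu (c *: v + w) >> - (c *: << fmu v >> + << fmu w >>)) * b).

Definition talg (k : fieldType) (V : lmodType k) : Type := lquot (@talg_rel k V).
HB.instance Definition _ (k : fieldType) (V : lmodType k) :=
  GRing.Lmodule.on (talg V).

HB.lock Definition tproj (k : fieldType) (V : lmodType k)
  (x : {malg k[{fmonom V}]}) : talg V := qproj (@talg_rel k V) x.
HB.lock Definition trepr (k : fieldType) (V : lmodType k)
  (x : talg V) : {malg k[{fmonom V}]} := qrepr x.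
HB.lock Definition talg_mul (k : fieldType) (V : lmodType k)
  (x y : talg V) : talg V := tproj (trepr x * trepr y).
HB.lock Definition tin (k : fieldType) (V : lmodType k)
  (v : V) : talg V := tproj << fmu v >>.
HB.lock Definition talg_lift (k : fieldType) (V : lmodType k) (A : algType k)
    (f : {linear V -> A}) : talg V -> A :=
  qlift (mlift (fun m : {fmonom V} => \prod_(v <- m) f v)).

Section TensorAlgebra.
Context (k : fieldType) (V : lmodType k).

Local Notation F := {malg k[{fmonom V}]}.
Local Notation talg := (talg V).
Local Notation talg_rel := (@talg_rel k V).
Local Notation tproj := (@tproj k V).
Local Notation trepr := (@trepr k V).
Local Notation talg_mul := (@talg_mul k V).
Local Notation tin := (@tin k V).

Lemma treprK : cancel trepr tproj.
Proof. by move=> x; rewrite tproj.unlock trepr.unlock; apply: qreprK. Qed.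

Lemma tproj_eq x y : (tproj x = tproj y) <-> x - y \in span talg_rel.
Proof. by rewrite tproj.unlock; apply: qproj_eq. Qed.

Fact tproj_linear : linear tproj.
Proof.
by rewrite tproj.unlock => c x y; apply: (linearP (qproj talg_rel)).
Qed.
HB.instance Definition _ :=
  GRing.isLinear.Build k F talg *:%R tproj tproj_linear.

Fact talg_idealM (a x b : F) :
  x \in span talg_rel -> a * x * b \in span talg_rel.
Proof.
move=> /spanE[s [sP ->]]; apply/spanE.
exists [seq (p.1, a * p.2 * b) | p <- s]; split=> [p|].
  by case/mapP=> q /sP[a' b' c v w] -> /=; rewrite -!mulrA !mulrA -mulrA.
rewrite big_map mulr_sumr mulr_suml; apply: eq_bigr => p _.
by rewrite -malg_scaleAr -scalerAl.
Qed.

Fact tproj_mul x y : talg_mul (tproj x) (tproj y) = tproj (x * y).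
Proof.
have rP z : trepr (tproj z) - z \in span talg_rel by apply/tproj_eq/treprK.
rewrite talg_mul.unlock; apply/tproj_eq; set x' := trepr _; set y' := trepr _.
have -> : x' * y' - x * y = 1 * (x' - x) * y' + x * (y' - y) * 1.
  by rewrite mul1r mulr1 mulrBl mulrBr addrA subrK.
apply: rpredD; apply: talg_idealM; exact: rP.
Qed.

Fact talg_mulA : associative talg_mul.
Proof.
by move=> x y z; rewrite -[x]treprK -[y]treprK -[z]treprK !tproj_mul mulrA.
Qed.
Fact talg_mul1 : left_id (tproj 1) talg_mul.
Proof. by move=> x; rewrite -[x]treprK tproj_mul mul1r. Qed.
Fact talg_1mul : right_id (tproj 1) talg_mul.
Proof. by move=> x; rewrite -[x]treprK tproj_mul mulr1. Qed.
Fact talg_mulDl : left_distributive talg_mul +%R.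
Proof.
move=> x y z; rewrite -[x]treprK -[y]treprK -[z]treprK.
by rewrite -raddfD !tproj_mul mulrDl raddfD.
Qed.
Fact talg_mulDr : right_distributive talg_mul +%R.
Proof.
move=> x y z; rewrite -[x]treprK -[y]treprK -[z]treprK.
by rewrite -raddfD !tproj_mul mulrDr raddfD.
Qed.
Fact talg_nz : tproj 1 != 0.
Proof.
rewrite -(raddf0 tproj); apply/eqP=> /tproj_eq; rewrite subr0.
have sub1 : submod_closed [pred x : F | x@_(mone) == 0].
  split=> [|c x y]; rewrite !inE ?mcoeff0 // => /eqP x0 /eqP y0.
  by rewrite mcoeffD mcoeffZ x0 y0 mulr0 addr0.
have relS x : talg_rel x -> x \in [pred x : F | x@_mone == 0].
  case=> a b c v w; rewrite inE !rmorphM /= rmorphB rmorphD /=.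
  by rewrite mcoeffZ !mcoeffU !fm1_eq1 !mulr0n mulr0 addr0 subrr mulr0 mul0r.
by move/(span_min sub1 relS); rewrite inE mcoeff1 eqxx oner_eq0.
Qed.

HB.instance Definition _ := GRing.Zmodule_isNzRing.Build talg
  talg_mulA talg_mul1 talg_1mul talg_mulDl talg_mulDr talg_nz.

Fact tprojM (x y : F) : tproj x * tproj y = tproj (x * y).
Proof. exact: tproj_mul. Qed.
Fact tprojZ c (x : F) : c *: tproj x = tproj (c *: x).
Proof. by rewrite -linearZ. Qed.

Fact talg_scaleAl (c : k) (x y : talg) : c *: (x * y) = (c *: x) * y.
Proof.
rewrite -[x]treprK -[y]treprK.
by rewrite [in RHS]tprojZ !tprojM tprojZ scalerAl.
Qed.
HB.instance Definition _ :=
  GRing.Lmodule_isLalgebra.Build k talg talg_scaleAl.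

Fact talg_scaleAr (c : k) (x y : talg) : c *: (x * y) = x * (c *: y).
Proof.
rewrite -[x]treprK -[y]treprK.
by rewrite [in RHS]tprojZ !tprojM tprojZ malg_scaleAr.
Qed.
HB.instance Definition _ := GRing.Lalgebra_isAlgebra.Build k talg talg_scaleAr.

Fact tin_linear : linear tin.
Proof.
move=> c v w; rewrite tin.unlock -linearP; apply/tproj_eq/mem_span.
by rewrite -[_ - _]mul1r -[_ * _]mulr1; apply: TalgRel.
Qed.
HB.instance Definition _ := GRing.isLinear.Build k V talg *:%R tin tin_linear.

Lemma talg_word (m : {fmonom V}) : tproj << m >> = \prod_(v <- m) tin v.
Proof.
rewrite -[m]fmK; elim: (m : seq V) => [|v s IHs] /=.
  by rewrite big_nil -fmoneE.
rewrite big_cons -IHs tin.unlock tprojM; congr (tproj _).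
by rewrite malgM_def fgmulUU mulr1 /mmul /= fmmulE fmU.
Qed.

Lemma talg_ind (P : talg -> Prop) :
    P 1 -> (forall x y, P x -> P y -> P (x + y)) ->
    (forall c x, P x -> P (c *: x)) -> (forall v x, P x -> P (tin v * x)) ->
  forall x, P x.
Proof.
move=> P1 PD PZ PV x; rewrite -[x]treprK [trepr x]malg_span raddf_sum /=.
elim/big_ind: _ => //; first by rewrite -(scale0r 1); apply: PZ.
move=> m _; rewrite linearZ /= talg_word; apply: PZ.
by elim: (m : seq V) => [|v s IHs]; rewrite ?big_nil // big_cons; apply: PV.
Qed.

Section Lift.
Context (A : algType k) (f : {linear V -> A}).

Fact talg_lift_word_mul (x y : {fmonom V}) :
  \prod_(v <- mmul x y) f v = \prod_(v <- x) f v * \prod_(v <- y) f v.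
Proof. by rewrite fmM big_cat. Qed.

Fact talg_lift_rel (r : F) :
  talg_rel r ->
  mlift (fun m : {fmonom V} => \prod_(v <- m) f v) r = 0.
Proof.
case=> a b c v w; rewrite !(mliftM talg_lift_word_mul).
rewrite raddfB /= linearP /= !mliftU !scale1r !fmU !big_seq1 linearP subrr.
by rewrite mulr0 mul0r.
Qed.

Fact talg_lift_linear : linear (talg_lift f).
Proof. by rewrite talg_lift.unlock; apply: qlift_linear talg_lift_rel. Qed.
HB.instance Definition _ := GRing.isLinear.Build k talg A *:%R (talg_lift f)
  talg_lift_linear.

Fact talg_lift_proj x : talg_lift f (tproj x) =
  mlift (fun m : {fmonom V} => \prod_(v <- m) f v) x.
Proof.
by rewrite talg_lift.unlock tproj.unlock (qlift_proj talg_lift_rel).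
Qed.

Fact talg_lift_monoid : monoid_morphism (talg_lift f).
Proof.
split=> [|x y].
  by rewrite [LHS]talg_lift_proj mliftU fm1 big_nil scale1r.
rewrite -[x]treprK -[y]treprK tprojM !talg_lift_proj.
exact: mliftM talg_lift_word_mul _ _.
Qed.
HB.instance Definition _ :=
  GRing.isMonoidMorphism.Build talg A (talg_lift f) talg_lift_monoid.

Lemma talg_liftE v : talg_lift f (tin v) = f v.
Proof.
by rewrite tin.unlock talg_lift_proj mliftU fmU big_seq1 scale1r.
Qed.

End Lift.

Lemma talg_ext (A : algType k) (f g : {lrmorphism talg -> A}) :
  (forall v, f (tin v) = g (tin v)) -> f =1 g.
Proof.
move=> fg; apply: talg_ind => [|x y fx fy|c x fx|v x fx].
- by rewrite !rmorph1.
- by rewrite !raddfD /= fx fy.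
- by rewrite !linearZ /= fx.
- by rewrite !rmorphM /= fg fx.
Qed.

End TensorAlgebra.

(* A G-grading U = \bigoplus_s U_s is given by the projections yd_cpt s : U -> U
   onto its components, so that U_s = {u | yd_cpt s u = u}. *)
HB.mixin Record isYetterDrinfeld (k : fieldType) (G : finGroupType) U
    of GRing.Lmodule k U := {
  yd_act : G -> U -> U;
  yd_act_linear : forall g, linear (yd_act g);
  yd_act1 : forall u, yd_act 1%g u = u;
  yd_actM : forall g h u, yd_act (g * h)%g u = yd_act g (yd_act h u);
  yd_cpt : G -> U -> U;
  yd_cpt_linear : forall s, linear (yd_cpt s);
  yd_cpt_cpt : forall s t u, yd_cpt s (yd_cpt t u) = if s == t then yd_cpt t u else 0;
  yd_cpt_sum : forall u, \sum_s yd_cpt s u = u;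
  yd_act_homog : forall h s u,
    yd_cpt s u = u <-> yd_cpt (h * s * h^-1)%g (yd_act h u) = yd_act h u
}.

#[short(type="ydModType")]
HB.structure Definition YetterDrinfeld (k : fieldType) (G : finGroupType) :=
  {U of GRing.Lmodule k U & isYetterDrinfeld k G U}.

Section YetterDrinfeldTheory.
Context (k : fieldType) (G : finGroupType) (U : ydModType k G).

HB.instance Definition _ (g : G) :=
  GRing.isLinear.Build k U U *:%R (yd_act g) (yd_act_linear g).
HB.instance Definition _ (s : G) :=
  GRing.isLinear.Build k U U *:%R (yd_cpt s) (yd_cpt_linear s).

Lemma yd_cpt_act (h s : G) (u : U) :
  yd_cpt (h * s * h^-1)%g (yd_act h u) = yd_act h (yd_cpt s u).
Proof.
have conjE t : yd_act h (yd_cpt t u) =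
    yd_cpt (h * t * h^-1)%g (yd_act h (yd_cpt t u)).
  by apply/esym/(proj1 (yd_act_homog h t _)); rewrite yd_cpt_cpt eqxx.
rewrite -{1}[u]yd_cpt_sum !raddf_sum (bigD1 s) //= -conjE big1 ?addr0 // => t ts.
rewrite conjE yd_cpt_cpt ifN //; apply: contra_neq ts.
by move=> /mulIg/mulgI.
Qed.

End YetterDrinfeldTheory.

Section Braiding.
Context (k : fieldType) (G : finGroupType) (U W : ydModType k G).

Fact braiding_bilin :
  bilin (fun (x : U) (y : W) => \sum_(s : G) tens (yd_act s y) (yd_cpt s x)).
Proof.
split=> [y c x x'|x c y y'] /=; rewrite scaler_sumr -big_split /=;
  apply: eq_bigr => s _; first by rewrite !linearP.
by rewrite linearP tensDl tensZl.
Qed.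

Definition braiding : tensor U W -> tensor W U := tens_lift braiding_bilin.
HB.instance Definition _ := GRing.Linear.on braiding.

Lemma braidingE x y :
  braiding (tens x y) = \sum_(s : G) tens (yd_act s y) (yd_cpt s x).
Proof. exact: tens_liftE. Qed.

Lemma braiding_homog (s : G) x y :
  yd_cpt s x = x -> braiding (tens x y) = tens (yd_act s y) x.
Proof.
move=> xs; rewrite braidingE (bigD1 s) //= xs big1 ?addr0 // => t ts.
by rewrite -xs yd_cpt_cpt (negPf ts) linear0.
Qed.

End Braiding.

(* A \otimes kG, as functions G -> A with the convolution product *)
Section GroupAlgebra.
Context (k : fieldType) (G : finGroupType) (A : algType k).

Definition gralg : Type := {ffun G -> A}.
HB.instance Definition _ := GRing.Lmodule.on gralg.
Implicit Types a b c : gralg.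

Definition gr_mul a b : gralg :=
  [ffun t => \sum_s a s * b (s^-1 * t)%g].
Definition gr_one : gralg := [ffun t => (t == 1%g)%:R].

Fact gr_mulA : associative gr_mul.
Proof.
move=> a b c; apply/ffunP=> t; rewrite !ffunE.
under eq_bigr do rewrite ffunE mulr_sumr.
under [RHS]eq_bigr do rewrite ffunE mulr_suml.
rewrite [RHS]exchange_big; apply: eq_bigr => s _ /=.
rewrite [RHS](reindex_inj (mulgI s)); apply: eq_bigr => r _ /=.
by rewrite mulKg invMg -!mulrA mulgA.
Qed.
Fact gr_mul1 : left_id gr_one gr_mul.
Proof.
move=> a; apply/ffunP=> t; rewrite ffunE (bigD1 1%g) //= ffunE eqxx mul1r.
rewrite invg1 mul1g big1 ?addr0 // => s s1.
by rewrite ffunE (negPf s1) mul0r.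
Qed.
Fact gr_1mul : right_id gr_one gr_mul.
Proof.
move=> a; apply/ffunP=> t; rewrite ffunE (bigD1 t) //= ffunE mulVg eqxx mulr1.
rewrite big1 ?addr0 // => s st.
by rewrite ffunE -eq_mulVg1 (negPf st) mulr0.
Qed.
Fact gr_mulDl : left_distributive gr_mul +%R.
Proof.
move=> a b c; apply/ffunP=> t; rewrite !ffunE -big_split.
by apply: eq_bigr => s _; rewrite ffunE mulrDl.
Qed.
Fact gr_mulDr : right_distributive gr_mul +%R.
Proof.
move=> a b c; apply/ffunP=> t; rewrite !ffunE -big_split.
by apply: eq_bigr => s _; rewrite ffunE mulrDr.
Qed.
Fact gr_nz : gr_one != 0.
Proof.
by apply/eqP=> /ffunP/(_ 1%g)/eqP; rewrite !ffunE eqxx oner_eq0.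
Qed.
HB.instance Definition _ := GRing.Zmodule_isNzRing.Build gralg
  gr_mulA gr_mul1 gr_1mul gr_mulDl gr_mulDr gr_nz.

Fact gr_scaleAl (x : k) a b : x *: (a * b) = (x *: a) * b.
Proof.
apply/ffunP=> t; rewrite !ffunE scaler_sumr.
by apply: eq_bigr => s _; rewrite ffunE scalerAl.
Qed.
HB.instance Definition _ := GRing.Lmodule_isLalgebra.Build k gralg gr_scaleAl.
Fact gr_scaleAr (x : k) a b : x *: (a * b) = a * (x *: b).
Proof.
apply/ffunP=> t; rewrite !ffunE scaler_sumr.
by apply: eq_bigr => s _; rewrite ffunE scalerAr.
Qed.
HB.instance Definition _ := GRing.Lalgebra_isAlgebra.Build k gralg gr_scaleAr.

Lemma gr_mulE a b t : (a * b) t = \sum_s a s * b (s^-1 * t)%g.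
Proof. by rewrite ffunE. Qed.
Lemma gr_oneE t : (1 : gralg) t = (t == 1%g)%:R.
Proof. by rewrite ffunE. Qed.

End GroupAlgebra.

HB.lock Definition tin_coact (k : fieldType) (G : finGroupType)
  (U : ydModType k G) (u : U) : gralg G (talg U) :=
  [ffun s : G => tin (yd_cpt s u)].

Section TensorAlgebraYD.
Context (k : fieldType) (G : finGroupType) (U : ydModType k G).
Local Notation T := (talg U).
Local Notation tin_coact := (@tin_coact k G U).

Lemma tin_coactE u s : tin_coact u s = tin (yd_cpt s u).
Proof. by rewrite tin_coact.unlock ffunE. Qed.

Fact tin_coact_linear : linear tin_coact.
Proof. by move=> c u v; apply/ffunP=> s; rewrite !ffunE !tin_coactE !linearP. Qed.
HB.instance Definition _ :=
  GRing.isLinear.Build k U (gralg G T) *:%R tin_coact tin_coact_linear.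

End TensorAlgebraYD.

HB.lock Definition talg_act (k : fieldType) (G : finGroupType)
    (U : ydModType k G) (g : G) : talg U -> talg U :=
  talg_lift (@tin k U \o yd_act g).

(* the coaction T(U) -> T(U) \otimes kG, as an algebra map *)
HB.lock Definition talg_coact (k : fieldType) (G : finGroupType)
    (U : ydModType k G) : talg U -> gralg G (talg U) :=
  talg_lift (@tin_coact k G U).

HB.lock Definition talg_cpt (k : fieldType) (G : finGroupType)
    (U : ydModType k G) (s : G) (x : talg U) : talg U := talg_coact x s.

Section TensorAlgebraYDTheory.
Context (k : fieldType) (G : finGroupType) (U : ydModType k G).
Local Notation T := (talg U).
Local Notation talg_act := (@talg_act k G U).
Local Notation talg_coact := (@talg_coact k G U).
Local Notation talg_cpt := (@talg_cpt k G U).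

Lemma talg_cptE s x : talg_cpt s x = talg_coact x s.
Proof. by rewrite talg_cpt.unlock. Qed.

Lemma talg_coactD x y : talg_coact (x + y) = talg_coact x + talg_coact y.
Proof. by rewrite talg_coact.unlock raddfD. Qed.
Lemma talg_coactZ c x : talg_coact (c *: x) = c *: talg_coact x.
Proof. by rewrite talg_coact.unlock linearZ. Qed.
Lemma talg_coact1 : talg_coact 1 = 1.
Proof. by rewrite talg_coact.unlock rmorph1. Qed.
Lemma talg_coactM x y : talg_coact (x * y) = talg_coact x * talg_coact y.
Proof. by rewrite talg_coact.unlock rmorphM. Qed.

Lemma talg_cptD s x y : talg_cpt s (x + y) = talg_cpt s x + talg_cpt s y.
Proof. by rewrite !talg_cptE talg_coactD ffunE. Qed.
Lemma talg_cptZ s c x : talg_cpt s (c *: x) = c *: talg_cpt s x.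
Proof. by rewrite !talg_cptE talg_coactZ ffunE. Qed.

Fact talg_cpt_linear s : linear (talg_cpt s).
Proof. by move=> c x y; rewrite talg_cptD talg_cptZ. Qed.
HB.instance Definition _ s :=
  GRing.isLinear.Build k T T *:%R (talg_cpt s) (talg_cpt_linear s).

Lemma talg_actD g x y : talg_act g (x + y) = talg_act g x + talg_act g y.
Proof. by rewrite talg_act.unlock raddfD. Qed.
Lemma talg_actZ g c x : talg_act g (c *: x) = c *: talg_act g x.
Proof. by rewrite talg_act.unlock linearZ. Qed.
Lemma talg_act_mul g x y : talg_act g (x * y) = talg_act g x * talg_act g y.
Proof. by rewrite talg_act.unlock rmorphM. Qed.
Lemma talg_act_one g : talg_act g 1 = 1.
Proof. by rewrite talg_act.unlock rmorph1. Qed.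

Fact talg_act_linear g : linear (talg_act g).
Proof. by move=> c x y; rewrite talg_actD talg_actZ. Qed.
HB.instance Definition _ g :=
  GRing.isLinear.Build k T T *:%R (talg_act g) (talg_act_linear g).

Lemma talg_act_tin g u : talg_act g (tin u) = tin (yd_act g u).
Proof. by rewrite talg_act.unlock talg_liftE. Qed.

Lemma talg_cpt_tin s u : talg_cpt s (tin u) = tin (yd_cpt s u).
Proof. by rewrite talg_cptE talg_coact.unlock talg_liftE tin_coactE. Qed.

Lemma talg_cpt1 s : talg_cpt s 1 = (s == 1%g)%:R.
Proof. by rewrite talg_cptE talg_coact1 gr_oneE. Qed.

Lemma talg_cptM t x y :
  talg_cpt t (x * y) = \sum_s talg_cpt s x * talg_cpt (s^-1 * t)%g y.
Proof.
rewrite talg_cptE talg_coactM gr_mulE.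
by apply: eq_bigr => s _; rewrite !talg_cptE.
Qed.

Lemma talg_act1 x : talg_act 1%g x = x.
Proof.
elim/talg_ind: x => [|x y IHx IHy|c x IHx|u x IHx].
- by rewrite talg_act_one.
- by rewrite talg_actD IHx IHy.
- by rewrite talg_actZ IHx.
- by rewrite talg_act_mul IHx talg_act_tin yd_act1.
Qed.

Lemma talg_actM g h x : talg_act (g * h)%g x = talg_act g (talg_act h x).
Proof.
elim/talg_ind: x => [|x y IHx IHy|c x IHx|u x IHx].
- by rewrite !talg_act_one.
- by rewrite !talg_actD IHx IHy.
- by rewrite !talg_actZ IHx.
- by rewrite !talg_act_mul IHx !talg_act_tin yd_actM.
Qed.

Lemma talg_cpt_cpt s t x :
  talg_cpt s (talg_cpt t x) = if s == t then talg_cpt t x else 0.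
Proof.
elim/talg_ind: x s t => [|x y IHx IHy|c x IHx|u x IHx] s t.
- rewrite !talg_cpt1; have [->|t1] := eqVneq t 1%g.
    by rewrite talg_cpt1; case: eqP.
  by rewrite linear0 if_same.
- rewrite !talg_cptD.
  rewrite IHx IHy.
  case: eqP => _; first by [].
  by rewrite addr0.
- by rewrite !talg_cptZ IHx; case: eqP; rewrite ?scaler0.
- rewrite talg_cptM linear_sum /=.
  under eq_bigr => r _.
    rewrite talg_cptM (bigD1 r) //= talg_cpt_tin talg_cpt_tin yd_cpt_cpt eqxx.
    rewrite IHx big1; last first.
      by move=> q qr; rewrite talg_cpt_tin yd_cpt_cpt (negPf qr) linear0 mul0r.
    rewrite addr0 (inj_eq (mulgI _)).
  over.
  case: eqP => // _; first by apply: eq_bigr => r _; rewrite talg_cpt_tin.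
  by rewrite big1 // => r _; rewrite mulr0.
Qed.

Lemma talg_cpt_sum x : \sum_s talg_cpt s x = x.
Proof.
elim/talg_ind: x => [|x y IHx IHy|c x IHx|u x IHx].
- rewrite (bigD1 1%g) //= talg_cpt1 eqxx big1 ?addr0 // => s s1.
  by rewrite talg_cpt1 (negPf s1).
- by rewrite -[in RHS]IHx -[in RHS]IHy -big_split; apply: eq_bigr => s _; rewrite talg_cptD.
- by rewrite -[in RHS]IHx scaler_sumr; apply: eq_bigr => s _; rewrite talg_cptZ.
- under eq_bigr => t _.
    by rewrite talg_cptM; under eq_bigr do rewrite talg_cpt_tin; over.
  have -> : tin u = \sum_s tin (yd_cpt s u) by rewrite -raddf_sum yd_cpt_sum.
  rewrite exchange_big mulr_suml; apply: eq_bigr => s _ /=.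
  by rewrite -mulr_sumr -[in RHS]IHx [in RHS](reindex_inj (mulgI s^-1%g)).
Qed.

Lemma talg_cpt_act h s x :
  talg_cpt (h * s * h^-1)%g (talg_act h x) = talg_act h (talg_cpt s x).
Proof.
elim/talg_ind: x s => [|x y IHx IHy|c x IHx|u x IHx] s.
- rewrite talg_act_one !talg_cpt1.
  rewrite -mulgA -{1}[h]invgK -conjgE conjg_eq1.
  by case: eqP => _; rewrite ?mulr1n ?mulr0n ?talg_act_one ?linear0.
- by rewrite !(talg_actD, talg_cptD) IHx IHy.
- by rewrite !(talg_actZ, talg_cptZ) IHx.
- rewrite talg_act_mul !talg_cptM linear_sum /=.
  rewrite (reindex_inj (mulgI h)) (reindex_inj (mulIg h^-1%g)) /=.
  apply: eq_bigr => r _; rewrite talg_act_mul -IHx !talg_cpt_tin !talg_act_tin.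
  rewrite talg_cpt_tin !mulgA yd_cpt_act; congr (_ * talg_cpt _ _).
  by rewrite !invMg invgK !mulgA mulgKV.
Qed.

End TensorAlgebraYDTheory.

Section TensorAlgebraYDInstance.
Context (k : fieldType) (G : finGroupType) (U : ydModType k G).
Local Notation T := (talg U).

Fact talg_act_homog h s (x : T) :
  talg_cpt s x = x <-> talg_cpt (h * s * h^-1)%g (talg_act h x) = talg_act h x.
Proof.
rewrite talg_cpt_act; split=> [-> //|/(congr1 (talg_act h^-1%g))].
by rewrite -!talg_actM mulVg !talg_act1.
Qed.

HB.instance Definition _ := isYetterDrinfeld.Build k G T
  (@talg_act_linear k G U) (@talg_act1 k G U) (@talg_actM k G U)
  (@talg_cpt_linear k G U) (@talg_cpt_cpt k G U) (@talg_cpt_sum k G U)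
  talg_act_homog.

Lemma talg_yd_act g (x : T) : yd_act g x = talg_act g x. Proof. by []. Qed.
Lemma talg_yd_cpt s (x : T) : yd_cpt s x = talg_cpt s x. Proof. by []. Qed.

End TensorAlgebraYDInstance.

(* T(U) \otimes T(U) with the product (m \otimes m)(id \otimes c \otimes id) *)
Section BraidedTensorSquare.
Context (k : fieldType) (G : finGroupType) (U : ydModType k G).
Local Notation T := (talg U).

Definition bsq : Type := tensor T T.
HB.instance Definition _ := GRing.Lmodule.on bsq.
Implicit Types (x y : T) (z w t : bsq).

Definition lmul x (y : T) : T := x * y.
Fact lmul_linear x : linear (lmul x).
Proof. by move=> c y y'; rewrite /lmul mulrDr scalerAr. Qed.
HB.instance Definition _ x :=
  GRing.isLinear.Build k T T *:%R (lmul x) (lmul_linear x).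

Definition rmul y (x : T) : T := x * y.
Fact rmul_linear y : linear (rmul y).
Proof. by move=> c x x'; rewrite /rmul mulrDl scalerAl. Qed.
HB.instance Definition _ y :=
  GRing.isLinear.Build k T T *:%R (rmul y) (rmul_linear y).

(* the product of x \otimes y and x' \otimes y' *)
Definition bmul4 x y x' y' : bsq :=
  tens_map (lmul x) (rmul y') (braiding (tens y x')).

Lemma bmul4E x y x' y' :
  bmul4 x y x' y' = \sum_(s : G) tens (x * yd_act s x') (yd_cpt s y * y').
Proof.
rewrite /bmul4 braidingE raddf_sum; apply: eq_bigr => s _.
exact: tens_mapE.
Qed.

Fact bmul4_bilinr x y : bilin (bmul4 x y).
Proof.
split=> [y' c a b|x' c a b] /=; rewrite !bmul4E scaler_sumr -big_split /=;
  apply: eq_bigr => s _.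
  by rewrite linearP mulrDr -scalerAr tensDl tensZl.
by rewrite mulrDr -scalerAr linearP.
Qed.

Definition bmul_tens x y : bsq -> bsq := tens_lift (bmul4_bilinr x y).
HB.instance Definition _ x y := GRing.Linear.on (bmul_tens x y).

Fact bmul_tens_bilin w : bilin (fun x y => bmul_tens x y w).
Proof.
have [s ->] := tens_span w.
split=> [y c a b|x c a b] /=; rewrite !raddf_sum -big_split;
  apply: eq_bigr => -[x' y'] _ /=; rewrite /bmul_tens !tens_liftE !bmul4E;
  rewrite scaler_sumr -big_split; apply: eq_bigr => r _ /=.
  by rewrite mulrDl -scalerAl tensDl tensZl.
by rewrite linearP mulrDl -scalerAl linearP.
Qed.

End BraidedTensorSquare.

HB.lock Definition bmul (k : fieldType) (G : finGroupType) (U : ydModType k G)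
  (z w : bsq U) : bsq U := tens_lift (bmul_tens_bilin w) z.

Section BraidedTensorSquareAlgebra.
Context (k : fieldType) (G : finGroupType) (U : ydModType k G).
Local Notation T := (talg U).
Local Notation bsq := (bsq U).
Local Notation bmul := (@bmul k G U).
Implicit Types (x y : T) (z w t : bsq).

Lemma bsq_span (z : bsq) :
  exists r : seq (T * T), z = \sum_(p <- r) (tens p.1 p.2 : bsq).
Proof. exact: tens_span. Qed.

Lemma bmulE x y x' y' : bmul (tens x y) (tens x' y') =
  \sum_(s : G) tens (x * yd_act s x') (yd_cpt s y * y').
Proof. by rewrite bmul.unlock !tens_liftE /bmul_tens tens_liftE bmul4E. Qed.

Fact bmulDl : left_distributive bmul +%R.
Proof. by move=> z z' w; rewrite bmul.unlock raddfD. Qed.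

Fact bmul_linear z : linear (bmul z).
Proof.
have [s ->] := bsq_span z; move=> c w w'; rewrite bmul.unlock !raddf_sum.
rewrite -big_split; apply: eq_bigr => p _ /=.
by rewrite !tens_liftE linearP.
Qed.
HB.instance Definition _ z :=
  GRing.isLinear.Build k bsq bsq *:%R (bmul z) (bmul_linear z).

Fact bmulDr : right_distributive bmul +%R.
Proof. by move=> z w w'; rewrite raddfD. Qed.

Lemma bmul_suml I (r : seq I) (F : I -> bsq) w :
  bmul (\sum_(i <- r) F i) w = \sum_(i <- r) bmul (F i) w.
Proof.
elim: r => [|i r IHr]; last by rewrite !big_cons bmulDl IHr.
by rewrite !big_nil bmul.unlock raddf0.
Qed.
Lemma bmul_sumr I (r : seq I) (F : I -> bsq) z :
  bmul z (\sum_(i <- r) F i) = \sum_(i <- r) bmul z (F i).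
Proof. exact: raddf_sum. Qed.

Definition bone : bsq := tens (1 : T) (1 : T).

Fact bmul1 : left_id bone bmul.
Proof.
move=> z; have [r ->] := bsq_span z; rewrite bmul_sumr; apply: eq_bigr.
move=> [x y] _ /=; rewrite /bone bmulE (bigD1 1%g) //= big1 => [|s s1].
  by rewrite yd_act1 [yd_cpt _ _]talg_cpt1 eqxx !mul1r addr0.
by rewrite [yd_cpt _ _]talg_cpt1 (negPf s1) mul0r linear0.
Qed.

Fact b1mul : right_id bone bmul.
Proof.
move=> z; have [r ->] := bsq_span z; rewrite bmul_suml; apply: eq_bigr.
move=> [x y] _ /=; rewrite /bone bmulE -{2}[y]yd_cpt_sum.
rewrite [RHS](raddf_sum (tens x)) (eq_bigr (fun s => tens x (yd_cpt s y) : bsq)) // => s _.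
by rewrite [yd_act _ _]talg_act_one !mulr1.
Qed.

Fact bmulA : associative bmul.
Proof.
move=> z z' z''; have [r ->] := bsq_span z; have [r' ->] := bsq_span z'.
have [r'' ->] := bsq_span z''.
rewrite !bmul_suml; apply: eq_bigr => -[x1 y1] _ /=.
rewrite !(bmul_sumr r') (bmul_suml r'); apply: eq_bigr => -[x2 y2] _ /=.
rewrite !bmul_sumr; apply: eq_bigr => -[x3 y3] _ /=.
rewrite !bmulE bmul_sumr bmul_suml /=.
under eq_bigr do rewrite bmulE.
under [RHS]eq_bigr do rewrite bmulE.
rewrite exchange_big; apply: eq_bigr => s _ /=.
rewrite [RHS](reindex_inj (mulgI s)); apply: eq_bigr => r0 _ /=.
rewrite !talg_yd_act !talg_yd_cpt talg_act_mul talg_cptM talg_actM.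
rewrite (bigD1 s) //= mulKg talg_cpt_cpt eqxx big1 ?addr0.
  by rewrite !mulrA.
by move=> q qs; rewrite talg_cpt_cpt (negPf qs) mul0r.
Qed.

Definition talg_counit : T -> k^o := talg_lift (\0 : {linear U -> k^o}).
HB.instance Definition _ := GRing.LRMorphism.on talg_counit.

Fact counit2_bilin : bilin (fun x y => talg_counit x * talg_counit y : k^o).
Proof.
split=> [y c a b|x c a b] /=; rewrite linearP.
  by rewrite mulrDl -scalerAl.
by rewrite mulrDr -scalerAr.
Qed.

Fact bone_neq0 : bone != 0.
Proof.
apply/eqP => /(congr1 (tens_lift counit2_bilin)).
rewrite raddf0 /bone tens_liftE !rmorph1 mulr1 => /eqP.
by rewrite oner_eq0.
Qed.

HB.instance Definition _ := GRing.Zmodule_isNzRing.Build bsq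
  bmulA bmul1 b1mul bmulDl bmulDr bone_neq0.

Fact bsq_scaleAl (c : k) (z w : bsq) : c *: (z * w) = (c *: z) * w.
Proof. by rewrite /GRing.mul /= bmul.unlock linearZ. Qed.
HB.instance Definition _ := GRing.Lmodule_isLalgebra.Build k bsq bsq_scaleAl.
Fact bsq_scaleAr (c : k) (z w : bsq) : c *: (z * w) = z * (c *: w).
Proof. exact: esym (linearZZ (bmul z) c w). Qed.
HB.instance Definition _ := GRing.Lalgebra_isAlgebra.Build k bsq bsq_scaleAr.

(* The coproduct is the algebra map for which the elements of U are primitive. *)
Definition tprim (u : U) : bsq := tens (tin u) (1 : T) + tens (1 : T) (tin u).
Fact tprim_linear : linear tprim.
Proof.
move=> c u v; rewrite /tprim !linearP tensDl tensZl scalerDr.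
by rewrite -!addrA; congr (_ + _); rewrite addrCA.
Qed.
HB.instance Definition _ := GRing.isLinear.Build k U bsq *:%R tprim tprim_linear.

Definition talg_comul : T -> bsq := talg_lift tprim.
HB.instance Definition _ := GRing.LRMorphism.on talg_comul.

Lemma talg_comul_tin u :
  talg_comul (tin u) = tens (tin u) (1 : T) + tens (1 : T) (tin u).
Proof. by rewrite /talg_comul talg_liftE. Qed.

Lemma talg_counit_tin u : talg_counit (tin u) = 0.
Proof. by rewrite /talg_counit talg_liftE. Qed.

End BraidedTensorSquareAlgebra.

Section Nichols.
Context (k : fieldType) (G : finGroupType) (U : ydModType k G).
Local Notation T := (talg U).
Implicit Types (I : {pred T}).

Definition coideal I : Prop :=
  [/\ submod_closed I,
      forall x, x \in I -> talg_counit x = 0 &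
      forall x, x \in I -> talg_comul x \in
        span (fun t : bsq U =>
          exists a b : T, (a \in I \/ b \in I) /\ t = tens a b)].

(* U^{\otimes n} inside T(U) *)
Definition tpow (n : nat) : {pred T} :=
  span (fun x => exists u : n.-tuple U, x = \prod_(v <- u) tin v).

Definition tpow_ge2 : {pred T} :=
  span (fun x => exists2 n, (2 <= n)%N & x \in tpow n).

Definition nichols_gen (x : T) : Prop :=
  exists I, [/\ coideal I, {subset I <= tpow_ge2} & x \in I].

(* The largest coideal contained in tpow_ge2, as the sum of all of them; see
   nichols_ideal_coideal, nichols_ideal_ge2 and nichols_ideal_max. *)
Definition nichols_ideal : {pred T} := span nichols_gen.

Lemma nichols_ideal_max I :
  coideal I -> {subset I <= tpow_ge2} -> {subset I <= nichols_ideal}.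
Proof. by move=> coI I2 x Ix; apply: mem_span; exists I. Qed.

Lemma nichols_ideal_ge2 : {subset nichols_ideal <= tpow_ge2}.
Proof.
apply: span_min => [|x [I [_ I2 /I2]] //].
split=> [|c x y x2 y2]; first exact: rpred0.
by rewrite rpredD ?rpredZ.
Qed.

Lemma nichols_ideal_coideal : coideal nichols_ideal.
Proof.
split=> [|x /spanE[s [sP ->]]|x /spanE[s [sP ->]]].
- split=> [|c x y xI yI]; first exact: rpred0.
  by rewrite rpredD ?rpredZ.
- rewrite raddf_sum big_seq big1 //= => p /sP[I [[_ I0 _] _ /I0 p0]].
  by rewrite linearZ /= p0 scaler0.
- rewrite raddf_sum big_seq /=; apply: rpred_sum => p /sP[I [coI I2 pI]].
  rewrite linearZ rpredZ //=; have [_ _ /(_ _ pI)] := coI.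
  apply: span_min => [|_ [a [b [abI ->]]]].
    split=> [|c z w zI wI]; first exact: rpred0.
    by rewrite rpredD ?rpredZ.
  apply: mem_span; exists a, b; split=> //.
  by case: abI => [/(nichols_ideal_max coI I2)|/(nichols_ideal_max coI I2)]; [left|right].
Qed.

(* B(U) = T(U) / nichols_ideal, as a vector space *)
Definition nichols : Type := lquot nichols_gen.
HB.instance Definition _ := GRing.Lmodule.on nichols.

End Nichols.

Definition findim (k : fieldType) (V : lmodType k) : Prop :=
  exists n (b : 'I_n -> V), forall v, exists c : 'I_n -> k,
    v = \sum_(i < n) c i *: b i.

Section Irreducible.
Context (k : fieldType) (G : finGroupType) (U : ydModType k G).

Definition yd_submod (W : {pred U}) : Prop :=
  [/\ submod_closed W,
      forall (g : G) u, u \in W -> yd_act g u \in W &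
      forall (s : G) u, u \in W -> yd_cpt s u \in W].

Definition yd_irreducible : Prop :=
  (exists u : U, u != 0) /\
  (forall W : {pred U}, yd_submod W ->
    (forall u, u \in W -> u = 0) \/ (forall u, u \in W)).

End Irreducible.

(* Main.v *)
(* Everything is detected by the skew derivations d_f of T(U), f a linear form on
   U: they preserve the defining ideal of the Nichols algebra, so an operator D
   built from them with D(z^(n+1)) = (n+1) c z^n, c <> 0, forces the powers of z
   to be linearly independent in B(U).

   Let U = V + W, let y be an element of (ad V)^m(W) of degree g, and let
   D = d_h d_(f_m) ... d_(f_1) with h vanishing on V and the f_i on W. On the
   subalgebra generated by (ad V)^m(W) the operator D is itself a skew derivation,
   with values D y in the ground field. If g y = y and D y <> 0, the powers of y
   are independent. If g y = q y with q^2 <> 1 and D y <> 0, and g is conjugate to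
   its inverse by h, then y and h y span a diagonal braiding of affine type A_1,
   and the powers of z = y (h y) - q^(-1) (h y) y are independent. Hence in a group
   of real elements finite dimension forces D (g y) = - D y.

   For m = 0 this says that s acts by -1 on U_s, so that degrees have even order.
   For m = 1 it gives (st)^2 = (ts)^2 for all degrees s of V and t of W. In S_n this
   holds for all pairs of two classes of even order only if one class consists of
   fixed-point free involutions and either n = 4 or the other one is the class of
   transpositions. The transpositions are excluded by m = 2 and the class in S_4 by
   an affine triangle of type A_2 on the Klein four-group. *)
From HB Require Import structures.
Require Import Defs.
From mathcomp Require Import all_boot all_order all_algebra all_fingroup.
From mathcomp Require Import cyclic separable cyclotomic.
From mathcomp Require Import boolp.
From mathcomp Require classical_sets.

Set Implicit Arguments.
Unset Strict Implicit.
Unset Printing Implicit Defensive.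

Import GRing.Theory.

(** * Pairs of permutations *)

Section Permutations.
Context (T : finType).
Implicit Types (s t g h : {perm T}) (x y z : T).

(** Each cycle is reflected about a base point, the root [r x] of its orbit: [f] exchanges the i-th
    and the (-i)-th iterate of that point. This makes all degrees real, as the sign argument
    requires. *)
Lemma perm_conj_inv g : exists h : {perm T}, (h * g * h^-1 = g^-1)%g.
Proof.
pose r x := froot g x.
have sym := fconnect_sym (@perm_inj _ g).
have rg x : r (g x) = r x.
  by apply/eqP; rewrite /r root_connect // sym fconnect1.
have powE i x : (g^-1 ^+ i * g ^+ i)%g x = x by rewrite expgVn mulVg perm1.
(* Exponents relative to the root are defined only up to the cycle length; this makes [f]
   independent of their choice. *)
have swap i j x : (g ^+ i)%g x = (g ^+ j)%g x -> (g^-1 ^+ i)%g x = (g^-1 ^+ j)%g x.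
  move=> e; apply: (@perm_inj _ (g ^+ i * g ^+ j)%g).
  by rewrite -!permM !expgVn mulKg -expgD addnC expgD mulKg e.
pose idx x := findex g (r x) x.
have idxP x : (g ^+ idx x)%g (r x) = x.
  by rewrite permX iter_findex // sym connect_root.
pose f x := (g^-1 ^+ idx x)%g (r x).
have fE x i : (g ^+ i)%g (r x) = x -> f x = (g^-1 ^+ i)%g (r x).
  by rewrite -{2}(idxP x) => /swap ->.
have fg x : f (g x) = g^-1%g (f x).
  rewrite (fE _ (idx x).+1) rg; first by rewrite expgSr permM.
  by rewrite expgSr permM idxP.
have fV x : f (g^-1%g x) = g (f x) by rewrite -{2}[x](permKV g) fg permKV.
have rr x : r (r x) = r x by rewrite /r root_root.
have fr x : f (r x) = r x by rewrite (fE _ 0%N) rr ?expg0 ?perm1.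
have ff : involutive f.
  move=> x; rewrite -[RHS]idxP [X in f X]/f; elim: (idx x) => [|i IHi].
    by rewrite !expg0 !perm1 fr.
  by rewrite !expgSr !permM fV IHi.
pose h := perm (inv_inj ff); have hE x : h x = f x by rewrite permE.
exists h; apply/permP=> x; rewrite !permM; apply: (@perm_inj _ h); rewrite permKV.
by rewrite !hE fV.
Qed.

(** A permutation matching the tails is corrected at the head by a transposition, which misses the
    points already placed. Conjugation by [h] then moves a listed piece of the cycles of [t] to
    prescribed points. *)
Lemma perm_extend (ys xs : seq T) :
  uniq ys -> uniq xs -> size ys = size xs ->
  exists h : {perm T}, [seq h y | y <- ys] = xs.
Proof.
elim: ys xs => [|y ys IHys] [|x xs] //=; first by exists 1%g.
case/andP=> yys Uys /andP[xxs Uxs] [/(IHys _ Uys Uxs)[h hE]].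
exists (h * tperm (h y) x)%g; rewrite permM tpermL; congr (_ :: _).
rewrite -[RHS]hE; apply/eq_in_map=> z zys; rewrite permM tpermD //.
  by rewrite (inj_eq perm_inj); apply: contraNneq yys => ->.
by apply: contraNneq xxs => ->; rewrite -hE map_f.
Qed.

Lemma fresh (l : seq T) : (size l < #|T|)%N -> exists x, x \notin l.
Proof.
move=> lT; apply/existsP; apply: contraTT lT; rewrite negb_exists => /forallP lP.
rewrite -leqNgt; apply: leq_trans (card_size l); apply: subset_leq_card.
by apply/subsetP=> x _; have := lP x; rewrite negbK.
Qed.

(* (st)^2 = (ts)^2; to refute it for all conjugates of [t], prescribe a conjugate
   on a few points so that both sides differ at one of them. *)
Definition quadratic s t : Prop := (s * t * s * t = t * s * t * s)%g.

Definition always_quadratic s t : Prop := forall h, quadratic s (t ^ h).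

Lemma always_quadratic_sym s t : always_quadratic s t -> always_quadratic t s.
Proof.
move=> st h; rewrite -[t](conjgKV h) /quadratic -!conjMg.
by congr (_ ^ h)%g; apply/esym/st.
Qed.

Lemma quadraticE s t x : quadratic s t -> t (s (t (s x))) = s (t (s (t x))).
Proof. by move=> /permP/(_ x); rewrite !permM. Qed.

(** For the conjugate of [t] with x -> y and [s y] fixed, the two sides at [x] are [s y] and
    [s (s y)]. *)
Lemma quad_fixed_fixed s t x y z a : always_quadratic s t ->
  s x = x -> s y != y -> t z = z -> t a != a -> False.
Proof.
move=> st sx sy tz ta.
have U1 : uniq [:: a; t a; z].
  rewrite /= !inE negb_or andbT eq_sym ta /=; apply/andP; split.
    by apply: contraNneq ta => ->; rewrite tz.
  by apply: contraNneq ta => e; apply/eqP/(@perm_inj _ t); rewrite e tz.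
have U2 : uniq [:: x; y; s y].
  rewrite /= !inE negb_or andbT [y == _]eq_sym sy andbT; apply/andP; split.
    by apply: contraNneq sy => <-; rewrite sx.
  by apply: contraNneq sy => e; apply/eqP/(@perm_inj _ s); rewrite -e sx.
have [h [hx hy hz]] := perm_extend U1 U2 erefl.
have tx : (t ^ h)%g x = y by rewrite -hx permJ.
have tz' : (t ^ h)%g (s y) = s y by rewrite -hz permJ tz.
have := quadraticE x (st h); rewrite sx tx tz' => /perm_inj e.
by rewrite -e eqxx in sy.
Qed.

(** For the conjugate of [t] with x -> y and s y -> w, the two sides at [x] are [w] and [s w]. *)
Lemma quad_fixed_free s t x y w : always_quadratic s t -> (4 <= #|T|)%N ->
  s x = x -> s y != y -> s w != w -> w != y -> w != s y ->
  (forall z, t z != z) -> False.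
Proof.
move=> st T4 sx sy sw wy wsy tf.
have [b] := fresh (l := [:: x; t x; t^-1%g x]) T4.
rewrite !inE !negb_or => /and3P[bx btx bt'x].
have U1 : uniq [:: x; t x; b; t b].
  rewrite /= !inE !negb_or !(eq_sym x) tf bx /= [t x == b]eq_sym btx.
  rewrite (inj_eq perm_inj) [x == b]eq_sym bx [b == t b]eq_sym tf !andbT.
  by apply: contraNneq bt'x => <-; rewrite permK.
have xy : x != y by apply: contraNneq sy => <-; rewrite sx.
have U2 : uniq [:: x; y; s y; w].
  rewrite /= !inE !negb_or xy [y == w]eq_sym wy [s y == w]eq_sym wsy !andbT.
  rewrite [y == _]eq_sym sy andbT /= -{1}sx (inj_eq perm_inj) xy /=.
  by apply: contraNneq sw => <-; rewrite sx.
have [h [hx hy hz hw]] := perm_extend U1 U2 erefl.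
have tx : (t ^ h)%g x = y by rewrite -{1}hx permJ.
have ty : (t ^ h)%g (s y) = w by rewrite -hz permJ.
have := quadraticE x (st h); rewrite sx tx ty => e.
by rewrite -e eqxx in sw.
Qed.

(** Equivalently, the cycle of [t] through [a] has length at least four. *)
Definition path4 t a := uniq [:: a; t a; t (t a); t (t (t a))].

(** With y -> z -> p -> q under the conjugate of [t], the two sides at [y] are [q] and [y]. *)
Lemma quad_transp_path4 y z t a : y != z -> always_quadratic (tperm y z) t ->
  path4 t a -> False.
Proof.
move=> yz st U1.
have T4 : (4 <= #|T|)%N.
  by have := card_uniqP U1 => /= <-; apply: max_card.
have [p] := fresh (l := [:: y; z]) (ltnW T4).
rewrite !inE !negb_or => /andP[py pz].
have [q] := fresh (l := [:: y; z; p]) T4.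
rewrite !inE !negb_or => /and3P[qy qz qp].
have U2 : uniq [:: y; z; p; q].
  by rewrite /= !inE !negb_or yz !(eq_sym _ p) !(eq_sym _ q) py pz qy qz qp.
have [h [hy hz hp hq]] := perm_extend U1 U2 erefl.
have ty : (t ^ h)%g y = z by rewrite -hy permJ.
have tz : (t ^ h)%g z = p by rewrite -hz permJ.
have tp : (t ^ h)%g p = q by rewrite -hp permJ.
have := quadraticE y (st h); rewrite tpermL tz tpermD 1?eq_sym // tp ty tpermR ty.
by rewrite tpermR => e; rewrite e eqxx in qy.
Qed.

(** The conjugate of [t] is made to contain the cycles (y p q) and (z r); at [y] the two sides are
    then [z] and [q]. *)
Lemma quad_transp_cycle23 y z t a b : y != z -> always_quadratic (tperm y z) t ->
  t a != a -> t (t (t a)) = a -> t b != b -> t (t b) = b -> False.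
Proof.
move=> yz st ta ta3 tb tb2.
have tta : t (t a) != a by apply: contraNneq ta => e; rewrite -{2}ta3 e.
have sep u v : t (t (t u)) = u -> t (t v) = v -> t v != v -> u != v.
  move=> u3 v2; apply: contraNneq => e; move: v2; rewrite -e => u2.
  by rewrite -[X in _ == X]u3 u2.
have ttb : t (t b) != t b by rewrite tb2 eq_sym.
have U1 : uniq [:: a; t a; t (t a); b; t b].
  have [ta' tta'] : a != t a /\ a != t (t a) by rewrite ![a == _]eq_sym ta tta.
  rewrite /= !inE !negb_or !(inj_eq perm_inj) ta' tta' [b == t b]eq_sym tb.
  have [ab atb] : a != b /\ a != t b by split; apply: sep => //; rewrite ?ta3 ?tb2.
  have [tab ttab] : t a != b /\ t (t a) != b.
    by split; apply: sep => //; rewrite ?ta3 ?tb2.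
  by rewrite ab atb tab ttab.
have T5 : (5 <= #|T|)%N.
  by have := card_uniqP U1 => /= <-; apply: max_card.
have [p] := fresh (l := [:: y; z]) (ltnW (ltnW T5)).
rewrite !inE !negb_or => /andP[py pz].
have [q] := fresh (l := [:: y; z; p]) (ltnW T5).
rewrite !inE !negb_or => /and3P[qy qz qp].
have [r] := fresh (l := [:: y; z; p; q]) T5.
rewrite !inE !negb_or => /and4P[ry rz rp rq].
have U2 : uniq [:: y; p; q; z; r].
  rewrite /= !inE !negb_or yz [y == p]eq_sym py [y == q]eq_sym qy [y == r]eq_sym ry.
  rewrite [p == q]eq_sym qp pz [p == r]eq_sym rp qz [q == r]eq_sym rq.
  by rewrite [z == r]eq_sym rz.
have [h [hy hp hq hz hr]] := perm_extend U1 U2 erefl.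
have ty : (t ^ h)%g y = p by rewrite -hy permJ.
have tp : (t ^ h)%g p = q by rewrite -hp permJ.
have tq : (t ^ h)%g q = y by rewrite -hq permJ ta3.
have tz : (t ^ h)%g z = r by rewrite -hz permJ.
have tr : (t ^ h)%g r = z by rewrite -hr permJ tb2.
have [sp sq sr] : [/\ tperm y z p = p, tperm y z q = q & tperm y z r = r].
  by split; apply: tpermD; rewrite eq_sym.
have := quadraticE y (st h); rewrite tpermL tz sr tr ty sp tp sq => e.
by rewrite e eqxx in qz.
Qed.

(** With y -> x -> p -> m under the conjugate of [t], where [m] and [y] precede and follow [x] in
    its cycle of [s], the relation at [x] forces [s p = p]. *)
Lemma quad_free_path4 s t x a : always_quadratic s t -> (forall z, s z != z) ->
  s (s x) != x -> path4 t a -> False.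
Proof.
move=> st sf sx U1; pose y := s x; pose m := s^-1%g x.
have T4 : (4 <= #|T|)%N.
  by have := card_uniqP U1 => /= <-; apply: max_card.
have [p] := fresh (l := [:: x; y; m]) T4.
rewrite !inE !negb_or => /and3P[px py pm].
have U2 : uniq [:: y; x; p; m].
  rewrite /= !inE !negb_or sf [y == p]eq_sym py [x == p]eq_sym px pm !andbT /=.
  rewrite -(inj_eq (@perm_inj _ s)) permKV sx /=.
  by rewrite -(inj_eq (@perm_inj _ s)) permKV sf.
have [h [hy hx hp hm]] := perm_extend U1 U2 erefl.
have ty : (t ^ h)%g y = x by rewrite -hy permJ.
have tx : (t ^ h)%g x = p by rewrite -hx permJ.
have tp : (t ^ h)%g p = m by rewrite -hp permJ.
have := quadraticE x (st h); rewrite -/y ty -/y ty tx => /(congr1 s^-1%g).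
rewrite permK -/m -tp => /perm_inj/esym/eqP.
by rewrite (negPf (sf p)).
Qed.

(** Here [s x] both precedes and follows [x], so the prescribed path is r -> y -> x -> p. The
    relation at [x] forces [s p = r], and [r] is chosen to avoid that. *)
Lemma quad_inv_path4 s t a : always_quadratic s t ->
  (forall z, s z != z) -> involutive s -> path4 t a -> (5 <= #|T|)%N -> False.
Proof.
move=> st sf ss U1 T5; pose x := a; pose y := s x.
have [p] := fresh (l := [:: x; y]) (ltnW (ltnW T5)).
rewrite !inE !negb_or => /andP[px py].
have [r] := fresh (l := [:: x; y; p; s p]) T5.
rewrite !inE !negb_or => /and4P[rx ry rp rsp].
have U2 : uniq [:: r; y; x; p].
  by rewrite /= !inE !negb_or rx ry rp sf ![_ == p]eq_sym px py.
have [h [hr hy hx hp]] := perm_extend U1 U2 erefl.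
have tr : (t ^ h)%g r = y by rewrite -hr permJ.
have ty : (t ^ h)%g y = x by rewrite -hy permJ.
have tx : (t ^ h)%g x = p by rewrite -{1}hx permJ.
have := quadraticE x (st h); rewrite -/y ty -/y ty tx => /(congr1 s).
rewrite ss -/y -tr => /perm_inj e.
by rewrite e eqxx in rsp.
Qed.

(** A 3-cycle (y x p) of the conjugate of [t] across the 2-cycle (x y) of [s] forces [s p = p]. *)
Lemma quad_cycle2_cycle3 s t x a : always_quadratic s t ->
  (forall z, s z != z) -> s (s x) = x -> t a != a -> t (t (t a)) = a -> False.
Proof.
move=> st sf sx ta ta3; pose y := s x.
have tta : t (t a) != a by apply: contraNneq ta => e; rewrite -{2}ta3 e.
have U1 : uniq [:: a; t a; t (t a)].
  by rewrite /= !inE negb_or ![a == _]eq_sym ta tta (inj_eq perm_inj) eq_sym ta.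
have T3 : (3 <= #|T|)%N.
  by have := card_uniqP U1 => /= <-; apply: max_card.
have [p] := fresh (l := [:: x; y]) T3.
rewrite !inE !negb_or => /andP[px py].
have U2 : uniq [:: y; x; p].
  by rewrite /= !inE !negb_or sf ![_ == p]eq_sym px py.
have [h [hy hx hp]] := perm_extend U1 U2 erefl.
have ty : (t ^ h)%g y = x by rewrite -hy permJ.
have tx : (t ^ h)%g x = p by rewrite -hx permJ.
have tp : (t ^ h)%g p = y by rewrite -hp permJ ta3.
have := quadraticE x (st h); rewrite -/y ty -/y ty tx -{1}sx -/y -{1}tp => /perm_inj.
by move=> /perm_inj/eqP; rewrite eq_sym (negPf (sf p)).
Qed.

Lemma three_transpositions t : (5 <= #|T|)%N ->
  (forall z, t z != z) -> involutive t ->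
  exists a b c, uniq [:: a; t a; b; t b; c; t c].
Proof.
move=> T5 tf tt; have T0 : (0 < #|T|)%N by apply: leq_trans T5.
have [a _] := fresh (l := [::]) T0.
have [b] := fresh (l := [:: a; t a]) (ltnW (ltnW T5)).
rewrite !inE !negb_or => /andP[ba bta].
have [c] := fresh (l := [:: a; t a; b; t b]) T5.
rewrite !inE !negb_or => /and4P[ca cta cb ctb].
have swap u v : (u == t v) = (t u == v) by rewrite -(inj_eq (@perm_inj _ t)) tt.
rewrite [_ == a]eq_sym in ba; rewrite [_ == t a]eq_sym in bta.
rewrite [_ == a]eq_sym in ca; rewrite [_ == t a]eq_sym in cta.
rewrite [_ == b]eq_sym in cb; rewrite [_ == t b]eq_sym in ctb.
have tf' z : z != t z by rewrite eq_sym.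
exists a, b, c; rewrite /= !inE !negb_or !(inj_eq perm_inj) !andbT.
by rewrite !tf' ba bta ca cta cb ctb !swap bta cta ctb.
Qed.

(** Three 2-cycles of [s] and three of the conjugate of [t] become alternate edges of a hexagon.
    There s t has order 3, while for involutions the relation says that (s t)^4 = 1. *)
Lemma quad_inv_inv s t : always_quadratic s t -> (5 <= #|T|)%N ->
  (forall z, s z != z) -> involutive s -> (forall z, t z != z) -> involutive t ->
  False.
Proof.
move=> st T5 sf ss tf tt.
have [x1 [x3 [x5 Us]]] := three_transpositions T5 sf ss.
have [a [b [c Ut]]] := three_transpositions T5 tf tt.
have U2 : uniq [:: s x1; x3; s x3; x5; s x5; x1].
  by rewrite -(rot_uniq 5) /rot /=.
have [h [h2 h3 h4 h5 h6 h1]] := perm_extend Ut U2 erefl.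
have t2 : (t ^ h)%g (s x1) = x3 by rewrite -h2 permJ.
have t4 : (t ^ h)%g (s x3) = x5 by rewrite -h4 permJ.
have t5 : (t ^ h)%g x5 = s x3 by rewrite -h5 permJ tt.
have t1 : (t ^ h)%g x1 = s x5 by rewrite -h1 permJ tt.
have := quadraticE x1 (st h); rewrite t2 t4 t1 ss t5 ss => e.
by move: Us; rewrite e /= !inE eqxx !orbT /= !andbF.
Qed.

Definition free_involution s : Prop := (forall z, s z != z) /\ involutive s.

Lemma cycle3_of_path4 t a : (forall z, t z != z) -> ~~ path4 t a ->
  t (t a) != a -> t (t (t a)) = a.
Proof.
move=> tf + tta; rewrite /path4 /= !inE !negb_or !(inj_eq perm_inj).
by rewrite ![a == _]eq_sym tf tta /= !andbT negbK => /eqP.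
Qed.

Lemma cycle2_of_path4 t a : (forall z, t z != z) -> ~~ path4 t a ->
  t (t (t a)) != a -> t (t a) = a.
Proof.
move=> tf p ttta; apply: contraNeq ttta => tta.
by rewrite (cycle3_of_path4 tf).
Qed.

(** The cycle of [b] has length two or at least four. In the first case a third point lies on
    another cycle, which contributes two more points. *)
Lemma free_card_ge4 t : (3 <= #|T|)%N -> (forall z, t z != z) ->
  (exists x, t (t (t x)) != x) -> (4 <= #|T|)%N.
Proof.
move=> T3 tf [b tb].
suff [z U] : exists z : seq T, uniq z && (size z == 4).
  by have /andP[/card_uniqP Uz /eqP <-] := U; rewrite -Uz max_card.
have [p|/(cycle2_of_path4 tf)/(_ tb) ttb] := boolP (path4 t b).
  by exists [:: b; t b; t (t b); t (t (t b))]; rewrite andbT.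
have [z] := fresh (l := [:: b; t b]) T3; rewrite !inE negb_or => /andP[zb ztb].
exists [:: b; t b; z; t z]; rewrite andbT /= !inE !negb_or !(inj_eq perm_inj).
rewrite ![b == _]eq_sym tf zb [t b == z]eq_sym ztb [z == t z]eq_sym tf !andbT /=.
by rewrite -ttb (inj_eq perm_inj).
Qed.

(** A 3-cycle on four points would leave a fixed point. *)
Lemma four_free_involution t : #|T| = 4 -> (forall z, t z != z) ->
  (forall a, ~~ path4 t a) -> involutive t.
Proof.
move=> T4 tf tp z; apply/eqP/negPn/negP => ttz.
have t3 := cycle3_of_path4 tf (tp z) ttz.
have [w] : exists w, w \notin [:: z; t z; t (t z)] by apply: fresh; rewrite T4.
rewrite !inE !negb_or => /and3P[wz wtz wttz].
have : uniq [:: z; t z; t (t z); w; t w].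
  have ztw : z != t w by rewrite -t3 (inj_eq perm_inj) eq_sym.
  rewrite [_ == z]eq_sym in ttz; rewrite [_ == z]eq_sym in wz.
  rewrite [_ == t z]eq_sym in wtz; rewrite [_ == t (t z)]eq_sym in wttz.
  have tf' u : u != t u by rewrite eq_sym.
  by rewrite /= !inE !negb_or !(inj_eq perm_inj) !tf' ttz wz wtz wttz ztw.
move/card_uniqP => /= U5; have := max_card (mem [:: z; t z; t (t z); w; t w]).
by rewrite U5 T4.
Qed.

(** By [quad_fixed_free], [s] moves only [y] and [s y]. Against this transposition [t] can have
    cycles of length two and three only, and not both; the condition on the cube of [t] leaves
    length two. *)
Lemma quad_half s t x : (3 <= #|T|)%N -> s x = x -> (exists y, s y != y) ->
    (forall z, t z != z) -> (exists y, t (t (t y)) != y) ->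
    always_quadratic s t ->
  (exists y z, y != z /\ s = tperm y z) /\ free_involution t.
Proof.
move=> T3 sx [y sy] tf t3 st; have T4 := free_card_ge4 T3 tf t3.
have sE : s = tperm y (s y).
  have sw w : w != y -> w != s y -> s w = w.
    move=> wy wsy; apply/eqP/negPn/negP => sw.
    exact: (quad_fixed_free st T4 sx sy sw wy wsy tf).
  have ssy : s (s y) = y.
    apply/eqP/negPn/negP => ssy; have := sw _ ssy; rewrite (inj_eq perm_inj) sy.
    by move=> /(_ isT)/perm_inj/perm_inj/eqP; rewrite (negPf sy).
  apply/permP=> w; have [->|wy] := eqVneq w y; first by rewrite tpermL.
  have [->|wsy] := eqVneq w (s y); first by rewrite tpermR.
  by rewrite tpermD 1?eq_sym // sw.
have ysy : y != s y by rewrite eq_sym.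
split; first by exists y, (s y).
split=> // z; rewrite sE in st.
have tp a : ~~ path4 t a by apply/negP => /(quad_transp_path4 ysy st).
apply/eqP/negPn/negP => ttz; have tz3 := cycle3_of_path4 tf (tp z) ttz.
have [b tb3] := t3; have tb2 := cycle2_of_path4 tf (tp b) tb3.
exact: (quad_transp_cycle23 ysy st (tf z) tz3 (tf b) tb2).
Qed.

(** Cycles of length at least four are excluded on both sides ([np]). The conditions on cubes then
    supply a 2-cycle on each side, which rules out 3-cycles on the other; [quad_inv_inv] handles the
    two involutions that remain. *)
Lemma quad_free5 s t : (5 <= #|T|)%N -> (forall z, s z != z) -> (forall z, t z != z) ->
    (exists y, s (s (s y)) != y) -> (exists y, t (t (t y)) != y) ->
  ~ always_quadratic s t.
Proof.
move=> T5 sf tf s3 t3 st.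
have np s' t' : (forall z, s' z != z) -> always_quadratic s' t' ->
    forall a, ~~ path4 t' a.
  move=> sf' st' a; apply/negP => p.
  have [ss|] := boolP [forall z, s' (s' z) == z].
    by apply: (quad_inv_path4 st' sf' _ p T5) => z; apply/eqP/(forallP ss).
  by rewrite negb_forall => /existsP[z ssz]; apply: (quad_free_path4 st' sf' ssz p).
have inv s' t' : (forall z, s' z != z) -> (forall z, t' z != z) ->
    (exists y, s' (s' (s' y)) != y) -> always_quadratic s' t' -> involutive t'.
  move=> sf' tf' [b s3'] st' z; apply/eqP/negPn/negP => ttz.
  have tz3 := cycle3_of_path4 tf' (np _ _ sf' st' z) ttz.
  have sb2 := cycle2_of_path4 sf' (np _ _ tf' (always_quadratic_sym st') b) s3'.
  exact: (quad_cycle2_cycle3 st' sf' sb2 (tf' z) tz3).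
have ts := always_quadratic_sym st.
by apply: (quad_inv_inv st T5 sf _ tf); [apply: inv ts|apply: inv st].
Qed.

Lemma tperm_neq (a b c d : T) : a != b -> a != c -> a != d -> tperm a b != tperm c d.
Proof.
move=> ab ac ad; apply: contraNneq ab => /permP/(_ a).
by rewrite tpermL tpermD 1?eq_sym // => ->.
Qed.

Lemma two_transpositions (a b c d : T) : uniq [:: a; b; c; d] ->
  let q := (tperm a b * tperm c d)%g in [/\ q a = b, q b = a, q c = d & q d = c].
Proof.
rewrite /= !inE !negb_or => /and4P[/and3P[ab ac ad] /andP[bc bd] cd _].
have sym u v : u != v -> v != u by rewrite eq_sym.
split; rewrite permM.
- by rewrite tpermL tpermD //; apply: sym.
- by rewrite tpermR tpermD //; apply: sym.
- by rewrite [tperm a b c]tpermD // tpermL.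
- by rewrite [tperm a b d]tpermD // tpermR.
Qed.

(* The Klein four-group {1, s, t, st} of S_4: [c] permutes its involutions
   cyclically and [e] fixes [s] and exchanges the other two. *)
Lemma klein_four s : #|T| = 4 -> free_involution s ->
  exists t e c : {perm T},
    [/\ [/\ s * s = 1, t * t = 1 & t * s = s * t],
        [/\ s != 1, t != 1 & s != t],
        e * s * e^-1 = s /\ e * t * e^-1 = s * t &
        c * s * c^-1 = t /\ c * t * c^-1 = s * t]%g.
Proof.
move=> T4 [sf ss].
have [x1 _] : exists x1 : T, x1 \notin [::] by apply: fresh; rewrite T4.
pose x2 := s x1.
have [x3] : exists x3, x3 \notin [:: x1; x2] by apply: fresh; rewrite T4.
rewrite !inE !negb_or => /andP[x31 x32]; pose x4 := s x3.
have [n12 n34] : x1 != x2 /\ x3 != x4 by rewrite [x1 == _]eq_sym [x3 == _]eq_sym !sf.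
have [n13 n23] : x1 != x3 /\ x2 != x3 by rewrite ![_ == x3]eq_sym x31 x32.
have n14 : x1 != x4 by rewrite -(inj_eq (@perm_inj _ s)) ss.
have n24 : x2 != x4 by rewrite (inj_eq perm_inj).
have n32 : x3 != x2 by rewrite eq_sym.
have n42 : x4 != x2 by rewrite eq_sym.
have U : uniq [:: x1; x2; x3; x4].
  by rewrite /= !inE !negb_or n12 n13 n14 n23 n24 n34.
have Ut : uniq [:: x1; x3; x2; x4].
  by rewrite /= !inE !negb_or n13 n12 n14 n32 n34 n24.
have U' : uniq [:: x1; x3; x4; x2].
  by rewrite /= !inE !negb_or n13 n14 n12 n34 n32 n42.
have all4 x : x \in [:: x1; x2; x3; x4].
  have : [set: T] \subset [:: x1; x2; x3; x4].
    have /eqP <- : [set x in [:: x1; x2; x3; x4]] == [set: T].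
      by rewrite eqEcard subsetT cardsT T4 cardsE (card_uniqP U).
    by apply/subsetP=> y; rewrite inE.
  by move/subsetP; apply; rewrite inE.
have perm4 (q q' : {perm T}) : q x1 = q' x1 -> q x2 = q' x2 -> q x3 = q' x3 ->
    q x4 = q' x4 -> q = q'.
  by move=> *; apply/permP=> x; move: (all4 x); rewrite !inE => /or4P[]/eqP->.
have [s1 s2 s3 s4] : [/\ s x1 = x2, s x2 = x1, s x3 = x4 & s x4 = x3].
  by split; rewrite // ?ss.
have [t [t1 t3 t2 t4]] : exists t : {perm T},
    [/\ t x1 = x3, t x3 = x1, t x2 = x4 & t x4 = x2].
  by exists (tperm x1 x3 * tperm x2 x4)%g; apply: two_transpositions.
have [d [d1 d2 d3 d4]] : exists d : {perm T},
    [/\ d x1 = x1, d x2 = x3, d x3 = x4 & d x4 = x2].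
  by have [d [? ? ? ?]] := perm_extend U U' erefl; exists d.
have [e [e1 e2 e3 e4]] : exists e : {perm T},
    [/\ e x1 = x2, e x2 = x1, e x3 = x3 & e x4 = x4].
  by exists (tperm x1 x2); rewrite tpermL tpermR !tpermD.
exists t, e, d^-1%g; split; try split; rewrite ?invgK.
- by apply: perm4; rewrite permM perm1; congruence.
- by apply: perm4; rewrite permM perm1; congruence.
- by apply: perm4; rewrite !permM; congruence.
- by apply: contraNneq (sf x1) => ->; rewrite perm1.
- by apply: contraNneq x31 => t11; rewrite -t1 t11 perm1.
- by apply: contraNneq x32 => st; rewrite -t1 -st s1.
- by apply: (mulIg e); rewrite mulgKV; apply: perm4; rewrite !permM; congruence.
- by apply: (mulIg e); rewrite mulgKV; apply: perm4; rewrite !permM; congruence.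
- apply: (mulgI d); rewrite !mulgA mulgV mul1g.
  by apply: perm4; rewrite !permM; congruence.
- apply: (mulgI d); rewrite !mulgA mulgV mul1g.
  by apply: perm4; rewrite !permM; congruence.
Qed.

Lemma tperm_conjV g a b a' b' : g a' = a -> g b' = b ->
  (g * tperm a b * g^-1 = tperm a' b')%g.
Proof.
move=> <- <-; rewrite -[RHS]conjg1 -(mulgV g) conjgM tpermJ conjgE invgK.
by rewrite !mulgA.
Qed.

(* On the hexagon x1 ... x6 with edges x1x2, x3x4, x5x6 in t, s = (x2 x3) and
   r = (x4 x5), the product rst permutes the six points cyclically. *)
Lemma hexagon_degrees t (x1 x3 x5 : T) : involutive t ->
    uniq [:: x1; t x1; x3; t x3; x5; t x5] ->
    let s := tperm (t x1) x3 in let r := tperm (t x3) x5 in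
    let g := (r * s * t)%g in
  [/\ ((s * t) * s * (s * t)^-1 != s)%g,
      [/\ r * s * r^-1 != r, g * r * g^-1 != r & g * s * g^-1 != r]%g &
      [/\ g * (g * r * g^-1) * g^-1 != r, g * (g * s * g^-1) * g^-1 != r &
        g * (r * s * r^-1) * g^-1 != r]%g].
Proof.
move=> tt U; have [x2 t1] : exists x2, t x1 = x2 by exists (t x1).
have [x4 t3] : exists x4, t x3 = x4 by exists (t x3).
have [x6 t5] : exists x6, t x5 = x6 by exists (t x5).
have [t2 t4 t6] : [/\ t x2 = x1, t x4 = x3 & t x6 = x5] by rewrite -t1 -t3 -t5 !tt.
move: U; rewrite t1 t3 t5 => U.
have sym (u v : T) : u != v -> v != u by rewrite eq_sym.
move: U; rewrite /= !inE !negb_or andbT.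
case/and5P=> /and5P[n12 n13 n14 n15 n16] /and4P[n23 n24 n25 n26].
case/and3P=> n34 n35 n36 /andP[n45 n46] n56.
pose s := tperm x2 x3; pose r := tperm x4 x5.
have [s1 s4 s5 s6] : [/\ s x1 = x1, s x4 = x4, s x5 = x5 & s x6 = x6].
  by split; apply: tpermD => //; apply: sym.
have [s2 s3] : s x2 = x3 /\ s x3 = x2 by rewrite /s tpermL tpermR.
have [r1 r2 r3 r6] : [/\ r x1 = x1, r x2 = x2, r x3 = x3 & r x6 = x6].
  by split; apply: tpermD => //; apply: sym.
have [r4 r5] : r x4 = x5 /\ r x5 = x4 by rewrite /r tpermL tpermR.
rewrite /= -/s -/r; have [g gE] : exists g, (r * s * t)%g = g by eexists.
rewrite !gE.
have [g1 g2 g3] : [/\ g x1 = x2, g x2 = x4 & g x3 = x1].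
  by rewrite -gE !permM r1 s1 t1 r2 s2 t3 r3 s3 t2.
have [g4 g5 g6] : [/\ g x4 = x6, g x5 = x3 & g x6 = x5].
  by rewrite -gE !permM r4 s5 t5 r5 s4 t4 r6 s6 t6.
have rs : (r * s * r^-1 = s)%g by apply: tperm_conjV.
rewrite rs.
have -> : (g * r * g^-1 = tperm x2 x6)%g by apply: tperm_conjV.
have -> : (g * s * g^-1 = tperm x1 x5)%g by apply: tperm_conjV.
have -> : (g * tperm x2 x6 * g^-1 = tperm x1 x4)%g by apply: tperm_conjV.
have -> : (g * tperm x1 x5 * g^-1 = tperm x3 x6)%g by apply: tperm_conjV.
have -> : (s * t * s * (s * t)^-1 = tperm x1 x4)%g.
  by apply: tperm_conjV; rewrite permM ?s1 ?s4.
by split; try split; apply: tperm_neq => //; apply: sym.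
Qed.

(** The cases follow the existence of fixed points. On both sides they are impossible, on one side
    they give a transposition and a free involution, and their absence leaves only four points. *)
Lemma quadratic_classes s t : (3 <= #|T|)%N ->
    (exists x, s (s (s x)) != x) -> (exists x, t (t (t x)) != x) ->
    always_quadratic s t ->
  [\/ #|T| = 4 /\ free_involution s, #|T| = 4 /\ free_involution t,
      (exists x y, x != y /\ s = tperm x y) /\ free_involution t |
      (exists x y, x != y /\ t = tperm x y) /\ free_involution s].
Proof.
move=> T3 s3 t3 st; have ts := always_quadratic_sym st.
have moved s' : (exists x, s' (s' (s' x)) != x) -> exists x, s' x != x.
  by move=> [x s3']; exists x; apply: contraNneq s3' => e; rewrite !e.
have [y sy] := moved _ s3; have [a ta] := moved _ t3.
have [/existsP[x /eqP sx]|] := boolP [exists x, s x == x].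
  have [/existsP[z /eqP tz]|] := boolP [exists x, t x == x].
    by have := quad_fixed_fixed st sx sy tz ta.
  rewrite negb_exists => /forallP tf.
  by constructor 3; apply: (quad_half T3 sx _ tf t3 st); exists y.
rewrite negb_exists => /forallP sf.
have [/existsP[z /eqP tz]|] := boolP [exists x, t x == x].
  by constructor 4; apply: (quad_half T3 tz _ sf s3 ts); exists a.
rewrite negb_exists => /forallP tf.
have := free_card_ge4 T3 sf s3; rewrite leq_eqVlt => /orP[/eqP T4|T5]; last first.
  by have := quad_free5 T5 sf tf s3 t3 st.
have [/forallP sp|] := boolP [forall z, ~~ path4 s z].
  by constructor 1; split=> //; split=> //; apply: four_free_involution.
(* A 4-cycle of [s] provides a point with [s (s z) != z], which excludes 4-cycles of [t]. *)
rewrite negb_forall => /existsP[z /negPn p].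
constructor 2; split=> //; split=> //; apply: four_free_involution => // b.
apply/negP => q; apply: (quad_free_path4 st sf _ q (x := z)).
by case/and3P: p; rewrite !inE !negb_or eq_sym => /and3P[_ +]; rewrite eq_sym.
Qed.

End Permutations.

Local Open Scope ring_scope.

(** * Skew derivations of the tensor algebra *)

Section TensorLift.
Context (k : fieldType) (V W Z : lmodType k) (f : V -> W -> Z) (fB : bilin f).

Lemma tens_liftD z w : tens_lift fB (z + w) = tens_lift fB z + tens_lift fB w.
Proof. exact: linearD. Qed.

Lemma tens_liftZ c z : tens_lift fB (c *: z) = c *: tens_lift fB z.
Proof. exact: linearZ. Qed.

Lemma tens_lift_sum I (r : seq I) (F : I -> tensor V W) :
  tens_lift fB (\sum_(i <- r) F i) = \sum_(i <- r) tens_lift fB (F i).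
Proof. exact: linear_sum. Qed.

End TensorLift.

Section SkewDerivation.
Context (k : fieldType) (G : finGroupType) (U : ydModType k G).
Local Notation T := (talg U).
Local Notation form := {linear U -> k^o}.
Implicit Types (f h : form) (u v : U) (x y : T) (g s t : G).

(* [u |-> f u E_01]: the algebra map it induces on [T] has the degree-one
   extension of [f] by zero as its entry (0, 1). *)
Definition form_mx f u : 'M[k]_2 := f u *: delta_mx 0 (1 : 'I_2).
Fact form_mx_linear f : linear (form_mx f).
Proof. by move=> c u v; rewrite /form_mx linearP scalerDl scalerA. Qed.
HB.instance Definition _ f :=
  GRing.isLinear.Build k U 'M[k]_2 *:%R (form_mx f) (form_mx_linear f).

Definition form_ext f x : k^o := talg_lift (form_mx f) x 0 1.
Fact form_ext_linear f : linear (form_ext f).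
Proof. by move=> c x y; rewrite /form_ext linearP !mxE. Qed.
HB.instance Definition _ f :=
  GRing.isLinear.Build k T k^o *:%R (form_ext f) (form_ext_linear f).

Fact delta01_mul (c d : k) :
  (delta_mx 0 1 : 'M[k]_2) * (c%:M + d *: delta_mx 0 1) = c *: delta_mx 0 1.
Proof.
rewrite -mulmxE mulmxDr mul_mx_scalar -scalemxAr mul_delta_mx_0 //.
by rewrite scaler0 addr0.
Qed.

Lemma talg_counit_tinM u x : talg_counit (tin u * x) = 0.
Proof. by rewrite rmorphM /= talg_counit_tin mul0r. Qed.

Lemma talg_counitD x y : talg_counit (x + y) = talg_counit x + talg_counit y.
Proof. exact: linearD. Qed.

Lemma talg_counitZ c x : talg_counit (c *: x) = c *: talg_counit x.
Proof. exact: linearZ. Qed.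

Lemma talg_comulD x y : talg_comul (x + y) = talg_comul x + talg_comul y.
Proof. exact: linearD. Qed.

Lemma talg_comulZ c x : talg_comul (c *: x) = c *: talg_comul x.
Proof. exact: linearZ. Qed.

Lemma talg_comul_tinM u x : talg_comul (tin u * x) =
  (tens (tin u) (1 : T) : bsq U) * talg_comul x
  + (tens (1 : T) (tin u) : bsq U) * talg_comul x.
Proof. by rewrite rmorphM /= talg_comul_tin mulrDl. Qed.

Lemma form_extD f x y : form_ext f (x + y) = form_ext f x + form_ext f y.
Proof. exact: linearD. Qed.

Lemma form_extZ f c x : form_ext f (c *: x) = c *: form_ext f x.
Proof. exact: linearZ. Qed.

Lemma form_mxE f x : talg_lift (form_mx f) x =
  (talg_counit x)%:M + form_ext f x *: delta_mx 0 (1 : 'I_2).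
Proof.
elim/talg_ind: x => [|x y IHx IHy|c x IHx|u x IHx].
- by rewrite /form_ext !rmorph1 !mxE /= scale0r addr0.
- by rewrite !linearD /= {1}IHx {1}IHy raddfD scalerDl addrACA.
- rewrite !linearZ /= {1}IHx scalerDr scalerA; congr (_ + _).
  by apply/matrixP=> i j; rewrite !mxE mulrnAr.
- rewrite /form_ext talg_counit_tinM raddf0 add0r rmorphM /=.
  rewrite talg_liftE /form_mx -scalerAl IHx delta01_mul scalerA.
  by rewrite !mxE !eqxx mulr1.
Qed.

Lemma form_ext1 f : form_ext f 1 = 0.
Proof. by rewrite /form_ext rmorph1 !mxE. Qed.

Lemma form_extM f u x : form_ext f (tin u * x) = f u * talg_counit x.
Proof.
rewrite {1}/form_ext rmorphM /= talg_liftE form_mxE /form_mx -scalerAl.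
rewrite delta01_mul scalerA.
by rewrite !mxE !eqxx mulr1.
Qed.

Lemma talg_counit_act g x : talg_counit (talg_act g x) = talg_counit x.
Proof.
elim/talg_ind: x => [|x y IHx IHy|c x IHx|u x IHx].
- by rewrite talg_act_one.
- by rewrite talg_actD !talg_counitD IHx IHy.
- by rewrite talg_actZ !talg_counitZ IHx.
- by rewrite talg_act_mul talg_act_tin !talg_counit_tinM.
Qed.

Lemma form_ext_act f g x :
  form_ext f (talg_act g x) = form_ext (f \o yd_act g) x.
Proof.
elim/talg_ind: x => [|x y IHx IHy|c x IHx|u x IHx].
- by rewrite talg_act_one !form_ext1.
- by rewrite talg_actD !form_extD IHx IHy.
- by rewrite talg_actZ !form_extZ IHx.
- by rewrite talg_act_mul talg_act_tin !form_extM talg_counit_act.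
Qed.

Lemma form_ext_tpow_ge2 f x : x \in @tpow_ge2 k G U -> form_ext f x = 0.
Proof.
case/spanE=> r [rP ->]; rewrite linear_sum big_seq big1 //= => p /rP[n n2].
case/spanE=> r' [r'P ->]; rewrite linearZ linear_sum big_seq big1 /= ?scaler0 //.
move=> q /r'P[u ->]; rewrite linearZ /=; case: n n2 u {r'P} => [|[|n]] // _ u.
case: u => -[|u1 [|u2 us]] //= _.
by rewrite !big_cons form_extM talg_counit_tinM mulr0 scaler0.
Qed.

Lemma bsq_tensM x y x' y' : (tens x y : bsq U) * (tens x' y' : bsq U) =
  \sum_s (tens (x * talg_act s x') (talg_cpt s y * y') : bsq U).
Proof. exact: bmulE. Qed.

Lemma talg_act0 g : talg_act g (0 : T) = 0.
Proof. exact: linear0. Qed.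

Lemma talg_cpt0 g : talg_cpt g (0 : T) = 0.
Proof. exact: linear0. Qed.

Lemma talg_act_sum g I (r : seq I) (F : I -> T) :
  talg_act g (\sum_(i <- r) F i) = \sum_(i <- r) talg_act g (F i).
Proof. exact: linear_sum. Qed.

Lemma talg_cpt_big g I (r : seq I) (F : I -> T) :
  talg_cpt g (\sum_(i <- r) F i) = \sum_(i <- r) talg_cpt g (F i).
Proof. exact: linear_sum. Qed.

Lemma talg_actVK g x : talg_act g (talg_act g^-1 x) = x.
Proof. by rewrite -talg_actM mulgV talg_act1. Qed.

Lemma talg_actKV g x : talg_act g^-1 (talg_act g x) = x.
Proof. by rewrite -talg_actM mulVg talg_act1. Qed.

Fact skew_bilin f : bilin (fun x y : T => (form_ext f x : k) *: y).
Proof.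
split=> [y c a b|x c a b] /=.
  by rewrite form_extD form_extZ scalerDl scalerA.
by rewrite scalerDr !scalerA mulrC.
Qed.

Definition skew_der f x : T := tens_lift (skew_bilin f) (talg_comul x).
Fact skew_der_linear f : linear (skew_der f).
Proof.
by move=> c x y; rewrite /skew_der talg_comulD talg_comulZ tens_liftD tens_liftZ.
Qed.
HB.instance Definition _ f :=
  GRing.isLinear.Build k T T *:%R (skew_der f) (skew_der_linear f).

Fact counit_bilin : bilin (fun x y : T => (talg_counit x : k) *: y).
Proof.
split=> [y c a b|x c a b] /=.
  by rewrite talg_counitD talg_counitZ scalerDl scalerA.
by rewrite scalerDr !scalerA mulrC.
Qed.

Lemma counit_comul x : tens_lift counit_bilin (talg_comul x) = x.
Proof.
elim/talg_ind: x => [|x y IHx IHy|c x IHx|u x IHx].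
- by rewrite rmorph1 tens_liftE rmorph1 scale1r.
- by rewrite talg_comulD tens_liftD IHx IHy.
- by rewrite talg_comulZ tens_liftZ IHx.
rewrite talg_comul_tinM tens_liftD -[in RHS]IHx.
have [r ->] := bsq_span (talg_comul x).
rewrite ![_ * (\sum_(p <- r) _ : bsq U)]mulr_sumr !tens_lift_sum -big_split mulr_sumr.
apply: eq_bigr => -[a b] _ /=.
rewrite !bsq_tensM !tens_lift_sum tens_liftE -scalerAr big1 ?add0r => [|s _].
  rewrite -[tin u in RHS](@talg_cpt_sum _ _ U) mulr_suml scaler_sumr.
  apply: eq_bigr => s _.
  by rewrite tens_liftE mul1r talg_counit_act.
by rewrite tens_liftE talg_counit_tinM scale0r.
Qed.

Lemma skew_derD f x y : skew_der f (x + y) = skew_der f x + skew_der f y.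
Proof. exact: linearD. Qed.

Lemma skew_derZ f c x : skew_der f (c *: x) = c *: skew_der f x.
Proof. exact: linearZ. Qed.

Lemma skew_der0 f : skew_der f 0 = 0.
Proof. exact: linear0. Qed.

Lemma skew_der_sum f I (r : seq I) (F : I -> T) :
  skew_der f (\sum_(i <- r) F i) = \sum_(i <- r) skew_der f (F i).
Proof. exact: linear_sum. Qed.

Lemma skew_der1 f : skew_der f 1 = 0.
Proof.
by rewrite /skew_der rmorph1 tens_liftE form_ext1 scale0r.
Qed.

Lemma skew_der_tinM f u x : skew_der f (tin u * x) =
  (f u : k) *: x + \sum_s tin (yd_cpt s u) * skew_der (f \o yd_act s) x.
Proof.
rewrite /skew_der talg_comul_tinM tens_liftD.
rewrite -[X in _ *: X + _]counit_comul.
have [r ->] := bsq_span (talg_comul x).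
rewrite ![_ * (\sum_(p <- r) _ : bsq U)]mulr_sumr !tens_lift_sum scaler_sumr.
congr (_ + _).
  apply: eq_bigr => -[a b] _ /=.
  rewrite bsq_tensM tens_lift_sum tens_liftE.
  rewrite (bigD1 1%g) //= big1 => [|s s1].
    rewrite addr0 tens_liftE talg_act1 form_extM talg_cpt1 eqxx.
    by rewrite mul1r scalerA.
  by rewrite tens_liftE talg_cpt1 (negPf s1) mul0r scaler0.
under [RHS]eq_bigr do rewrite tens_lift_sum mulr_sumr.
rewrite exchange_big; apply: eq_bigr => -[a b] _ /=.
rewrite bsq_tensM tens_lift_sum; apply: eq_bigr => s _.
rewrite !tens_liftE mul1r form_ext_act talg_cpt_tin.
by rewrite scalerAr.
Qed.

Lemma skew_der_tin f u : skew_der f (tin u) = (f u : k)%:A.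
Proof.
rewrite -[tin u]mulr1 skew_der_tinM big1 ?addr0 // => s _.
by rewrite skew_der1 mulr0.
Qed.

Lemma eq_skew_der f h : f =1 h -> skew_der f =1 skew_der h.
Proof.
move=> fh x; elim/talg_ind: x f h fh => [|x y IHx IHy|c x IHx|u x IHx] f h fh.
- by rewrite !skew_der1.
- by rewrite !skew_derD (IHx _ _ fh) (IHy _ _ fh).
- by rewrite !skew_derZ (IHx _ _ fh).
- rewrite !skew_der_tinM fh; congr (_ + _); apply: eq_bigr => s _.
  by congr (_ * _); apply: IHx => v /=.
Qed.

(** Passing the component of [x] of degree [s] through the braiding turns [f] into
    [f \o yd_act s]. *)
Lemma skew_derM f x y : skew_der f (x * y) =
  skew_der f x * y + \sum_s talg_cpt s x * skew_der (f \o yd_act s) y.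
Proof.
elim/talg_ind: x f y => [|x x' IHx IHx'|c x IHx|u x IHx] f y.
- rewrite mul1r skew_der1 mul0r add0r (bigD1 1%g) //= big1 => [|s s1].
    rewrite talg_cpt1 eqxx addr0 mul1r.
    by apply: eq_skew_der => v /=; rewrite yd_act1.
  by rewrite talg_cpt1 (negPf s1) mul0r.
- rewrite mulrDl !skew_derD IHx IHx' mulrDl addrACA -big_split; congr (_ + _).
  by apply: eq_bigr => s _; rewrite talg_cptD mulrDl.
- rewrite -scalerAl !skew_derZ IHx scalerDr scalerAl scaler_sumr.
  by congr (_ + _); apply: eq_bigr => s _; rewrite talg_cptZ -scalerAl.
- rewrite -mulrA !skew_der_tinM mulrDl -scalerAl -addrA; congr (_ + _).
  under eq_bigr do rewrite IHx mulrDr.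
  rewrite big_split /= mulr_suml; congr (_ + _).
    by apply: eq_bigr => s _; rewrite mulrA.
  under [RHS]eq_bigr do rewrite talg_cptM mulr_suml.
  rewrite [RHS]exchange_big; apply: eq_bigr => s _ /=.
  rewrite mulr_sumr [RHS](reindex_inj (mulgI s)); apply: eq_bigr => t _ /=.
  rewrite mulKg talg_cpt_tin mulrA; congr (_ * _).
  by apply: eq_skew_der => v /=; rewrite yd_actM.
Qed.

Lemma skew_der_act f g x :
  skew_der f (talg_act g x) = talg_act g (skew_der (f \o yd_act g) x).
Proof.
elim/talg_ind: x f => [|x x' IHx IHx'|c x IHx|u x IHx] f.
- by rewrite talg_act_one !skew_der1 talg_act0.
- by rewrite talg_actD !skew_derD IHx IHx' talg_actD.
- by rewrite talg_actZ !skew_derZ IHx talg_actZ.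
- rewrite talg_act_mul talg_act_tin !skew_der_tinM talg_actD talg_actZ.
  congr (_ + _).
  rewrite talg_act_sum (reindex_inj (conjg_inj g^-1%g)); apply: eq_bigr => s _ /=.
  rewrite talg_act_mul talg_act_tin IHx conjgE invgK mulgA yd_cpt_act.
  congr (_ * talg_act g _); apply: eq_skew_der => v /=.
  by rewrite -!yd_actM mulgKV.
Qed.

(** The ideal is a coideal. A first tensor factor in it has degree at least two and is killed by the
    form; a second factor in it is kept. *)
Lemma skew_der_nichols f x :
  x \in @nichols_ideal k G U -> skew_der f x \in @nichols_ideal k G U.
Proof.
have [[I0 IP] _ Ico] := nichols_ideal_coideal U.
move=> /Ico/spanE[r [rP e]]; rewrite /skew_der e tens_lift_sum.
rewrite big_seq; elim/big_ind: _ => [//|a b Ia Ib|p /rP[a [b [ab ->]]]].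
  by rewrite -[a]scale1r IP.
rewrite tens_liftZ tens_liftE; case: ab => [/nichols_ideal_ge2 a2|Ib].
  by rewrite form_ext_tpow_ge2 // scale0r scaler0.
by rewrite scalerA -[_ *: b]addr0 IP.
Qed.

Lemma skew_der_cptr f g x : skew_der f (talg_cpt g x) =
  \sum_t talg_cpt (t^-1 * g)%g (skew_der (f \o yd_cpt t) x).
Proof.
elim/talg_ind: x f g => [|x x' IHx IHx'|c x IHx|u x IHx] f g.
- rewrite big1 => [|t _]; last by rewrite skew_der1 talg_cpt0.
  by rewrite talg_cpt1; case: eqP; rewrite ?skew_der1 ?skew_der0.
- rewrite talg_cptD !skew_derD IHx IHx' -big_split; apply: eq_bigr => t _.
  by rewrite skew_derD talg_cptD.
- rewrite talg_cptZ !skew_derZ IHx scaler_sumr; apply: eq_bigr => t _.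
  by rewrite skew_derZ talg_cptZ.
rewrite talg_cptM skew_der_sum.
under eq_bigr do rewrite talg_cpt_tin skew_der_tinM.
under [RHS]eq_bigr => t _.
  rewrite skew_der_tinM talg_cptD talg_cptZ talg_cpt_big.
  under eq_bigr => s _.
    rewrite talg_cptM (bigD1 s) //= big1 ?addr0 => [|r rs]; last first.
      by rewrite talg_cpt_tin yd_cpt_cpt (negPf rs) linear0 mul0r.
    rewrite talg_cpt_tin yd_cpt_cpt eqxx.
  over.
over.
rewrite !big_split; congr (_ + _); rewrite exchange_big [RHS]exchange_big /=.
apply: eq_bigr => s _; rewrite (bigD1 s) //= big1 ?addr0 => [|r rs]; last first.
  by rewrite yd_cpt_cpt eq_sym (negPf rs) linear0 mul0r.
rewrite yd_cpt_cpt eqxx IHx mulr_sumr.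
rewrite (reindex_inj (conjg_inj s)); apply: eq_bigr => t _ /=.
congr (_ * _); rewrite conjgE !invMg invgK !mulgA mulgK.
congr (talg_cpt _ _); apply: eq_skew_der => v /=.
by rewrite -yd_cpt_act !mulgA mulgV mul1g mulgK.
Qed.

Lemma skew_der_scale f h (c : k) x :
  (forall u, h u = c * f u) -> skew_der h x = c *: skew_der f x.
Proof.
elim/talg_ind: x f h => [|x y IHx IHy|a x IHx|u x IHx] f h hf.
- by rewrite !skew_der1 scaler0.
- by rewrite !skew_derD (IHx _ _ hf) (IHy _ _ hf) scalerDr.
- by rewrite !skew_derZ (IHx _ _ hf) !scalerA mulrC.
- rewrite !skew_der_tinM hf scalerDr scaler_sumr scalerA; congr (_ + _).
  apply: eq_bigr => s _; have hfs v : (h \o yd_act s) v = c * (f \o yd_act s) v := hf _.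
  by rewrite (IHx _ _ hfs) -scalerAr.
Qed.

Lemma talg_cptM_homog s t x y : talg_cpt s x = x -> talg_cpt t y = y ->
  talg_cpt (s * t)%g (x * y) = x * y.
Proof.
move=> xs yt; rewrite talg_cptM (bigD1 s) //= mulKg xs yt big1 ?addr0 // => r rs.
by rewrite -xs talg_cpt_cpt (negPf rs) mul0r.
Qed.

Lemma skew_derM_homog f s x y : talg_cpt s x = x ->
  skew_der f (x * y) = skew_der f x * y + x * skew_der (f \o yd_act s) y.
Proof.
move=> xs; rewrite skew_derM (bigD1 s) //= xs big1 ?addr0 // => t ts.
by rewrite -xs talg_cpt_cpt (negPf ts) mul0r.
Qed.

(* The elements killed by every counit of an iterated skew derivation; this is
   the form in which the relations of the Nichols algebra are used. *)
Definition derker x : Prop :=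
  forall fs : seq form, talg_counit (foldl (fun z f => skew_der f z) x fs) = 0.

Lemma nichols_derker x : x \in @nichols_ideal k G U -> derker x.
Proof.
have [_ I0 _] := nichols_ideal_coideal U.
move=> xI fs; elim: fs x xI => [|f fs IHfs] x xI /=; first exact: I0.
exact/IHfs/skew_der_nichols.
Qed.

Lemma derker_linear c x y : derker x -> derker y -> derker (c *: x + y).
Proof.
move=> xI yI fs; have {xI yI}[] := (xI fs, yI fs).
elim: fs x y => [|f fs IHfs] x y /=; last by rewrite skew_derD skew_derZ; apply: IHfs.
by rewrite talg_counitD talg_counitZ => -> ->; rewrite scaler0 addr0.
Qed.

Lemma derker_der f x : derker x -> derker (skew_der f x).
Proof. by move=> xI fs; have := xI (f :: fs). Qed.

Lemma derker_act g x : derker x -> derker (talg_act g x).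
Proof.
move=> xI fs; have {xI} := xI [seq (f \o yd_act g : form) | f <- fs].
elim: fs x => [|f fs IHfs] x /=; first by rewrite talg_counit_act.
by move=> /IHfs; rewrite skew_der_act.
Qed.

End SkewDerivation.

(** * A criterion for infinite dimension *)

Lemma findim_dependent (k : fieldType) (V : lmodType k) (z : nat -> V) :
  findim V -> exists n (a : 'I_n -> k),
    (exists i, a i != 0) /\ \sum_(i < n) a i *: z i = 0.
Proof.
case=> n [b bP]; exists n.+1.
have [c cP] := boolp.choice (fun i : 'I_n.+1 => bP (z i)).
(* The matrix has more rows than columns, hence a nonzero left kernel. *)
pose A := \matrix_(i < n.+1, j < n) c i j.
have /rowV0Pn[v /sub_kermxP vA v0] : kermx A != 0.
  by rewrite kermx_eq0 /row_free neq_ltn ltnS rank_leq_col.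
exists (v 0); split; first by apply/rV0Pn.
under eq_bigr do rewrite cP scaler_sumr.
rewrite exchange_big big1 //= => j _.
under eq_bigr do rewrite scalerA.
rewrite -scaler_suml; have /matrixP/(_ 0 j) := vA; rewrite !mxE => e.
rewrite (_ : \sum_i _ = 0) ?scale0r // -[RHS]e.
by apply: eq_bigr => i _; rewrite mxE.
Qed.

Section Criterion.
Context (k : fieldType) (char0 : [pchar k] =i pred0).
Context (G : finGroupType) (U : ydModType k G).
Local Notation T := (talg U).
Local Notation I := (@nichols_ideal k G U).

(** A linear relation among the powers of [z] modulo the ideal lies in [derker]. Applying [D] as
    often as its top exponent [j] leaves the scalar a_j j! c^j, which is nonzero in characteristic
    zero. *)
Lemma nichols_infinite (D : {linear T -> T}) (z : T) (c : k) :
    (forall x, derker x -> derker (D x)) -> c != 0 -> D 1 = 0 ->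
    (forall n, D (z ^+ n.+1) = (n.+1%:R * c) *: z ^+ n) ->
  ~ findim (nichols U).
Proof.
move=> DI c0 D1 Dz.
move/(findim_dependent (fun i => qproj (@nichols_gen k G U) (z ^+ i))).
case=> n [a [[i0 ai0] sum0]].
have zI : \sum_(i < n) a i *: z ^+ i \in I.
  rewrite -[X in X \in _]subr0; apply/qproj_eq; rewrite raddf0 linear_sum -[RHS]sum0.
  by apply: eq_bigr => i _; rewrite linearZ.
have iterD m p : iter m D (z ^+ p) = ((p ^_ m)%:R * c ^+ m) *: z ^+ (p - m).
  elim: m => [|m IHm]; first by rewrite mulr1 scale1r subn0.
  rewrite /= IHm linearZ /= subnS ffactnSr natrM.
  case: (p - m)%N => [|q]; first by rewrite D1 mulr0 mul0r scale0r scaler0.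
  by rewrite Dz scalerA exprSr mulrACA.
pose j := [arg max_(i > i0 | a i != 0) (i : nat)].
have [aj0 jmax] : a j != 0 /\ forall i, a i != 0 -> (i <= j)%N.
  by rewrite /j; case: arg_maxnP => // i ai imax; split=> [|i1 /imax].
have iterI m x : derker x -> derker (iter m D x).
  by move=> xI; elim: m => //= m; apply: DI.
have iter_sum m : iter m D (\sum_(i < n) a i *: z ^+ i) =
    \sum_(i < n) a i *: iter m D (z ^+ i).
  elim: m => //= m ->; rewrite linear_sum; apply: eq_bigr => i _.
  by rewrite linearZ.
have /(_ [::]) /= := iterI j _ (nichols_derker zI).
rewrite iter_sum (bigD1 j) //= big1 ?addr0 => [|i ij].
  rewrite iterD subnn linearZ linearZ /= rmorph1 ffactnn => /eqP.
  rewrite !mulf_eq0 (negPf aj0) oner_eq0 orbF expf_eq0 (negPf c0) andbF.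
  by have /pcharf0P-> := char0; rewrite eqn0Ngt fact_gt0.
rewrite iterD; have [->|ai] := eqVneq (a i) 0; first by rewrite scale0r.
rewrite ffact_small ?mul0r ?scale0r ?scaler0 // ltn_neqAle jmax //.
by rewrite andbT.
Qed.

End Criterion.

(** * Strata of the tensor algebra *)

Section Strata.
Context (k : fieldType) (G : finGroupType) (U : ydModType k G) (H : {group G}).
Local Notation T := (talg U).
Local Notation form := {linear U -> k^o}.
Implicit Types (f h : form) (u v w : U) (x y : T) (g s t : G) (m : nat).

(** For elements supported on [H], the skew Leibniz rule twists forms by elements of [H] alone. This
    allows sets of forms stable under a subgroup, such as the four-group of the triangle
    argument. *)
Definition supported x : Prop := forall s, s \notin H -> talg_cpt s x = 0.

Definition stable_forms (F : form -> Prop) : Prop :=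
  (forall g f, g \in H -> F f -> F (f \o yd_act g)) /\
  (forall s f, F f -> F (f \o yd_cpt s)).

Context (FV FW : form -> Prop) (FVst : stable_forms FV) (FWst : stable_forms FW).

(* [FV] and [FW] are forms vanishing on one summand of U = V + W each. An element
   of [Nstr m] is killed by d_h d_(f_i) ... d_(f_1) for all i < m, f_j in [FV] and
   h in [FW]; on [Mstr m] these operators take scalar values for i = m. *)
Fixpoint stratum (B : T -> Prop) m x : Prop :=
  supported x /\
  if m is m'.+1 then
    (forall h, FW h -> skew_der h x = 0) /\
    (forall f, FV f -> stratum B m' (skew_der f x))
  else B x.

Lemma supported_linear c x y : supported x -> supported y ->
  supported (c *: x + y).
Proof. by move=> xH yH s sH; rewrite talg_cptD talg_cptZ xH // yH // scaler0 addr0. Qed.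

Lemma supported_cpt s x : supported x -> supported (talg_cpt s x).
Proof. by move=> xH t tH; rewrite talg_cpt_cpt; case: eqP => // <-; apply: xH. Qed.

Lemma supported_act g x : g \in H -> supported x -> supported (talg_act g x).
Proof.
move=> gH xH s sH.
have -> : s = (g * (s ^ g) * g^-1)%g by rewrite conjgE !mulgA mulgV mul1g mulgK.
by rewrite talg_cpt_act xH ?talg_act0 // groupJr.
Qed.

Lemma supported1 : supported 1.
Proof. by move=> s sH; rewrite talg_cpt1; case: eqP sH => // ->; rewrite group1. Qed.

Lemma supportedM x y : supported x -> supported y -> supported (x * y).
Proof.
move=> xH yH s sH; rewrite talg_cptM big1 // => t _.
have [tH|/xH->] := boolP (t \in H); last by rewrite mul0r.
by rewrite yH ?mulr0 // groupMl ?groupV.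
Qed.

Section Closure.
Context (B : T -> Prop).
Hypothesis Blin : forall c x y, B x -> B y -> B (c *: x + y).
Hypothesis Bcpt : forall s x, B x -> B (talg_cpt s x).
Hypothesis Bact : forall g x, g \in H -> B x -> B (talg_act g x).

Lemma stratum_supported m x : stratum B m x -> supported x.
Proof. by case: m => [|m] []. Qed.

Lemma stratum_linear m c x y :
  stratum B m x -> stratum B m y -> stratum B m (c *: x + y).
Proof.
elim: m x y => [|m IHm] x y [xH Px] [yH Py]; split.
- exact: supported_linear.
- exact: Blin.
- exact: supported_linear.
case: Px Py => xW xV [yW yV]; split=> [h Fh|f Ff].
  by rewrite skew_derD skew_derZ xW // yW // scaler0 addr0.
by rewrite skew_derD skew_derZ; apply: IHm; [apply: xV|apply: yV].
Qed.

Lemma stratum_act m g x :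
  g \in H -> stratum B m x -> stratum B m (talg_act g x).
Proof.
move=> gH; elim: m x => [|m IHm] x [xH Px]; split.
- exact: supported_act.
- exact: Bact.
- exact: supported_act.
case: FVst FWst Px => Va _ [Wa _] [xW xV]; split=> [h Fh|f Ff].
  by rewrite skew_der_act xW ?talg_act0 //; apply: Wa.
by rewrite skew_der_act; apply: IHm; apply: xV; apply: Va.
Qed.

Hypothesis B0 : B 0.

Lemma stratum0 m : stratum B m 0.
Proof.
elim: m => [|m IHm]; split=> //; try by move=> s _; rewrite talg_cpt0.
by split=> [h|f] _; rewrite skew_der0.
Qed.

Lemma stratum_sum m I (r : seq I) (P : pred I) (F : I -> T) :
  (forall i, P i -> stratum B m (F i)) -> stratum B m (\sum_(i <- r | P i) F i).
Proof.
move=> FB; elim/big_ind: _ => //; first exact: stratum0.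
by move=> x y Bx By; rewrite -[x]scale1r; apply: stratum_linear.
Qed.

Lemma stratumZ m c x : stratum B m x -> stratum B m (c *: x).
Proof.
by move=> Bx; rewrite -[_ *: _]addr0; apply: stratum_linear => //; apply: stratum0.
Qed.

Lemma stratum_cpt m s x : stratum B m x -> stratum B m (talg_cpt s x).
Proof.
elim: m s x => [|m IHm] s x [xH Px]; split.
- exact: supported_cpt.
- exact: Bcpt.
- exact: supported_cpt.
case: FVst FWst Px => _ Vc [_ Wc] [xW xV]; split=> [h Fh|f Ff].
  rewrite skew_der_cptr big1 // => t _.
  by rewrite xW ?talg_cpt0 //; apply: Wc.
rewrite skew_der_cptr; apply: stratum_sum => t _.
by apply: IHm; apply: xV; apply: Vc.
Qed.

End Closure.

Definition Nstr := stratum (fun=> True).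
Definition scalar_der x : Prop :=
  (forall h, FW h -> exists c, skew_der h x = c%:A) /\
  (forall f, FV f -> skew_der f x = 0).
Definition Mstr := stratum scalar_der.

Fact scalar_der_linear c x y : scalar_der x -> scalar_der y ->
  scalar_der (c *: x + y).
Proof.
move=> [xW xV] [yW yV]; split=> [h Fh|f Ff]; last first.
  by rewrite skew_derD skew_derZ xV // yV // scaler0 addr0.
have [[a ea] [b eb]] := (xW h Fh, yW h Fh).
by exists (c * a + b); rewrite skew_derD skew_derZ ea eb scalerDl scalerA.
Qed.

Fact scalar_der_act g x : g \in H -> scalar_der x -> scalar_der (talg_act g x).
Proof.
case: FVst FWst => Va _ [Wa _] gH [xW xV]; split=> [h Fh|f Ff]; last first.
  by rewrite skew_der_act xV ?talg_act0 //; apply: Va.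
have [c ec] := xW _ (Wa _ _ gH Fh).
by exists c; rewrite skew_der_act ec talg_actZ talg_act_one.
Qed.

Fact scalar_der_cpt s x : scalar_der x -> scalar_der (talg_cpt s x).
Proof.
case: FVst FWst => _ Vc [_ Wc] [xW xV]; split=> [h Fh|f Ff]; last first.
  rewrite skew_der_cptr big1 // => t _.
  by rewrite xV ?talg_cpt0 //; apply: Vc.
have [c cP] := boolp.choice (fun t => xW _ (Wc t _ Fh)).
exists (c s); rewrite skew_der_cptr (bigD1 s) //= big1 ?addr0 => [|t ts].
  by rewrite cP talg_cptZ mulVg talg_cpt1 eqxx.
by rewrite cP talg_cptZ talg_cpt1 -eq_mulVg1 (negPf ts) scaler0.
Qed.

Fact scalar_der0 : scalar_der 0.
Proof. by split=> [h|f] _; rewrite skew_der0 //; exists 0; rewrite scale0r. Qed.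

Lemma Mstr_Nstr m x : Mstr m x -> Nstr m x.
Proof.
elim: m x => [|m IHm] x [xH Px]; split=> //.
by case: Px => xW xV; split=> // f /xV/IHm.
Qed.

Lemma Mstr_linear m c x y : Mstr m x -> Mstr m y -> Mstr m (c *: x + y).
Proof. exact/stratum_linear/scalar_der_linear. Qed.
Lemma Mstr_sum m I (r : seq I) (P : pred I) (F : I -> T) :
  (forall i, P i -> Mstr m (F i)) -> Mstr m (\sum_(i <- r | P i) F i).
Proof. exact/stratum_sum/scalar_der0/scalar_der_linear. Qed.
Lemma MstrZ m c x : Mstr m x -> Mstr m (c *: x).
Proof. exact/stratumZ/scalar_der0/scalar_der_linear. Qed.
Lemma Mstr_act m g x : g \in H -> Mstr m x -> Mstr m (talg_act g x).
Proof. exact/stratum_act/scalar_der_act. Qed.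
Lemma Mstr_cpt m s x : Mstr m x -> Mstr m (talg_cpt s x).
Proof.
exact/stratum_cpt/scalar_der0/scalar_der_cpt/scalar_der_linear.
Qed.

Lemma Nstr_linear m c x y : Nstr m x -> Nstr m y -> Nstr m (c *: x + y).
Proof. exact: stratum_linear. Qed.
Lemma Nstr_sum m I (r : seq I) (P : pred I) (F : I -> T) :
  (forall i, P i -> Nstr m (F i)) -> Nstr m (\sum_(i <- r | P i) F i).
Proof. exact: stratum_sum. Qed.
Lemma Nstr_act m g x : g \in H -> Nstr m x -> Nstr m (talg_act g x).
Proof. exact: stratum_act. Qed.
Lemma Nstr_cpt m s x : Nstr m x -> Nstr m (talg_cpt s x).
Proof. exact: stratum_cpt. Qed.
Lemma Nstr_supported m x : Nstr m x -> supported x.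
Proof. exact: stratum_supported. Qed.

Lemma Nstr1 m : Nstr m 1.
Proof.
case: m => [|m]; split=> //; try exact: supported1.
by split=> [h _|f _]; rewrite skew_der1 //; apply: stratum0.
Qed.

Lemma NstrS m x : Nstr m.+1 x -> Nstr m x.
Proof.
elim: m x => [|m IHm] x [xH [xW xV]]; split=> //.
by split=> // f /xV/IHm.
Qed.

Lemma NstrD m x y : Nstr m x -> Nstr m y -> Nstr m (x + y).
Proof. by move=> Nx; rewrite -[x]scale1r; apply: Nstr_linear. Qed.

(** In the Leibniz rule a form of [FV] lowers the level of one factor, and [NstrS] lowers that of
    the other to match. *)
Lemma NstrM m x y : Nstr m x -> Nstr m y -> Nstr m (x * y).
Proof.
elim: m x y => [|m IHm] x y Nx Ny.
  by split=> //; apply: supportedM; apply: Nstr_supported; eassumption.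
have [[Va _] [Wa _]] := (FVst, FWst).
have := (Nstr_supported Nx, Nstr_supported Ny) => -[xH yH].
split; first exact: supportedM.
case: (Nx) (Ny) => _ [xW xV] [_ [yW yV]]; split=> [h Fh|f Ff].
  rewrite skew_derM xW // mul0r add0r big1 // => s _.
  have [sH|/xH->] := boolP (s \in H); last by rewrite mul0r.
  by rewrite yW ?mulr0 //; apply: Wa.
rewrite skew_derM; apply: NstrD.
  by apply: IHm; [apply: xV|apply: NstrS].
apply: Nstr_sum => s _.
have [sH|/xH->] := boolP (s \in H); last by rewrite mul0r; apply: stratum0.
by apply: IHm; [apply/Nstr_cpt/NstrS|apply/yV/Va].
Qed.

Definition multi_der (fs : seq form) h x : T :=
  skew_der h (foldl (fun z f => skew_der f z) x fs).

Fact multi_der_linear fs h : linear (multi_der fs h).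
Proof.
rewrite /multi_der; elim: fs => [|f fs IHfs] c x y /=; first by rewrite linearP.
by rewrite linearP IHfs.
Qed.
HB.instance Definition _ fs h :=
  GRing.isLinear.Build k T T *:%R (multi_der fs h) (multi_der_linear fs h).

Lemma derker_multi_der fs h x : derker x -> derker (multi_der fs h x).
Proof.
rewrite /multi_der; elim: fs x => [|f fs IHfs] x xK; first exact: derker_der.
exact/IHfs/derker_der.
Qed.

Lemma multi_der1 fs h : multi_der fs h 1 = 0.
Proof.
case: fs => [|f fs]; first exact: skew_der1.
by rewrite -[LHS]/(multi_der fs h (skew_der f 1)) skew_der1 [LHS]linear0.
Qed.

Definition all_FV (fs : seq form) : Prop := foldr (fun f P => FV f /\ P) True fs.

Section MultiDer.
Context (h : form) (Fh : FW h).
Implicit Types (fs : seq form).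

Lemma multi_der_cons f fs x :
  multi_der (f :: fs) h x = multi_der fs h (skew_der f x).
Proof. by []. Qed.

Lemma multi_der_Nstr0 fs x :
  all_FV fs -> Nstr (size fs).+1 x -> multi_der fs h x = 0.
Proof.
elim: fs x => [|f fs IHfs] x /=; first by move=> _ [_ [xW _]]; apply: xW.
by move=> [Ff fsV] [_ [_ xV]]; apply: IHfs => //; apply: xV.
Qed.

(** Each term in which a form hits [y] is a product from a stratum that the rest of the operator
    annihilates. *)
Lemma multi_derMl fs x y : all_FV fs -> Nstr (size fs) x ->
  Nstr (size fs).+1 y -> multi_der fs h (x * y) = multi_der fs h x * y.
Proof.
have [Va _] := FVst; have [Wa _] := FWst.
elim: fs x y => [|f fs IHfs] x y /=.
  move=> _ [xH _] [_ [yW _]]; rewrite /multi_der /= skew_derM big1 ?addr0 // => s _.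
  have [sH|/xH->] := boolP (s \in H); last by rewrite mul0r.
  by rewrite yW ?mulr0 //; apply: Wa.
move=> [Ff fsV] Nx Ny; rewrite !multi_der_cons skew_derM linearD /=.
rewrite IHfs //; [|by case: Nx => _ [_]; apply|exact: NstrS].
rewrite [X in _ + X]multi_der_Nstr0 ?addr0 //; apply: Nstr_sum => s _.
have [sH|sH] := boolP (s \in H); last first.
  by rewrite (Nstr_supported Nx) // mul0r; apply: stratum0.
apply: NstrM; first exact: Nstr_cpt.
by case: Ny => _ [_]; apply; apply: Va.
Qed.

Lemma multi_derMr fs g x y : all_FV fs -> g \in H -> talg_cpt g x = x ->
  Nstr (size fs).+1 x -> Nstr (size fs) y ->
  multi_der fs h (x * y) = x * talg_act g^-1 (multi_der fs h (talg_act g y)).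
Proof.
move=> + gH xg; have skewMg f z := skew_derM_homog f z xg.
elim: fs y => [|f fs IHfs] y /=.
  move=> _ [_ [xW _]] _; rewrite /multi_der /= skewMg xW // mul0r add0r.
  by rewrite skew_der_act -talg_actM mulVg talg_act1.
move=> [Ff fsV] Nx Ny; rewrite !multi_der_cons skewMg linearD /=.
rewrite multi_der_Nstr0 // ?add0r; last first.
  by apply: NstrM => //; case: Nx => _ [_]; apply.
rewrite IHfs //; [|exact: NstrS|].
  by rewrite skew_der_act.
by case: Ny => _ [_]; apply; case: FVst => Va _; apply: Va.
Qed.

(* All mixed terms vanish: they still apply [h] to a product of elements which
   have not yet been hit by enough forms of [FV]. *)
Lemma multi_derM fs g x y : all_FV fs -> g \in H -> talg_cpt g x = x ->
  Nstr (size fs) x -> Nstr (size fs) y ->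
  multi_der fs h (x * y) =
  multi_der fs h x * y + x * talg_act g^-1 (multi_der fs h (talg_act g y)).
Proof.
move=> + gH xg; have skewMg f z := skew_derM_homog f z xg.
case: fs => [|f fs] /=.
  move=> _ Nx Ny; rewrite /multi_der /= skewMg skew_der_act.
  by rewrite -talg_actM mulVg talg_act1.
move=> [Ff fsV] Nx Ny; rewrite !multi_der_cons skewMg linearD /=.
rewrite multi_derMl //; last by case: Nx => _ [_]; apply.
congr (_ + _); rewrite (multi_derMr (g := g)) //.
  by rewrite skew_der_act.
by case: Ny => _ [_]; apply; case: FVst => Va _; apply: Va.
Qed.

Lemma multi_der_scalar fs x : all_FV fs -> Mstr (size fs) x ->
  exists c, multi_der fs h x = c%:A.
Proof.
elim: fs x => [|f fs IHfs] x /=; first by move=> _ [_ [xW _]]; apply: xW.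
by move=> [Ff fsV] [_ [_ xV]]; apply: IHfs => //; apply: xV.
Qed.

End MultiDer.

(* The braided adjoint action of [u], provided that [u] has degree [s]. *)
Definition talg_ad s u x : T := tin u * x - talg_act s x * tin u.
Fact talg_ad_linear s u : linear (talg_ad s u).
Proof.
move=> c x y; rewrite /talg_ad linearP mulrDr mulrDl -scalerAr -scalerAl.
by rewrite scalerBr opprD addrACA.
Qed.
HB.instance Definition _ s u :=
  GRing.isLinear.Build k T T *:%R (talg_ad s u) (talg_ad_linear s u).

(** The first two terms contract [f] with the left factor of (id - c^2)(u \otimes x), where c is the
    braiding. *)
Lemma skew_der_ad f s u x : yd_cpt s u = u -> skew_der f (talg_ad s u x) =
  (f u : k) *: x - \sum_t (f (yd_act t u) : k) *: talg_cpt t (talg_act s x)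
  + talg_ad s u (skew_der (f \o yd_act s) x).
Proof.
move=> us; rewrite /talg_ad linearB /= skew_der_tinM skew_derM skew_der_act.
rewrite (bigD1 s) //= us big1 ?addr0 => [|t ts]; last first.
  by rewrite -us yd_cpt_cpt (negPf ts) linear0 mul0r.
rewrite [X in _ - X]addrC opprD addrACA; congr (_ - _ + _).
by apply: eq_bigr => t _; rewrite skew_der_tin -scalerAr mulr1.
Qed.

Lemma skew_der_ad_homog f s g u x :
    yd_cpt s u = u -> talg_cpt g x = x -> skew_der f (talg_ad s u x) =
  (f u : k) *: x - (f (yd_act (s * g * s^-1)%g u) : k) *: talg_act s x
  + talg_ad s u (skew_der (f \o yd_act s) x).
Proof.
move=> us xg; rewrite skew_der_ad //; congr (_ - _ + _).
have sx : talg_cpt (s * g * s^-1)%g (talg_act s x) = talg_act s x.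
  by rewrite talg_cpt_act xg.
rewrite (bigD1 (s * g * s^-1)%g) //= sx big1 ?addr0 // => t tg.
by rewrite -sx talg_cpt_cpt (negPf tg) scaler0.
Qed.

Lemma talg_ad_homog s g u x : yd_cpt s u = u -> talg_cpt g x = x ->
  talg_cpt (s * g)%g (talg_ad s u x) = talg_ad s u x.
Proof.
move=> us xg; have us' : talg_cpt s (tin u) = tin u by rewrite talg_cpt_tin us.
rewrite /talg_ad linearB /= (talg_cptM_homog us') //; congr (_ - _).
have -> : (s * g = s * g * s^-1 * s)%g by rewrite mulgKV.
by apply: talg_cptM_homog => //; rewrite talg_cpt_act xg.
Qed.

Lemma talg_ad_act a s u x :
  talg_act a (talg_ad s u x) =
  talg_ad (a * s * a^-1)%g (yd_act a u) (talg_act a x).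
Proof.
rewrite /talg_ad linearB /= !talg_act_mul !talg_act_tin -!talg_actM.
by rewrite mulgKV.
Qed.

Lemma Mstr_tin t w : t \in H -> yd_cpt t w = w -> (forall f, FV f -> f w = 0) ->
  Mstr 0 (tin w).
Proof.
move=> tH wt wV; split.
  move=> s sH; rewrite talg_cpt_tin -wt yd_cpt_cpt.
  by case: eqP sH => [->|]; rewrite ?tH ?linear0.
split=> [h _|f /wV e]; first by exists (h w); rewrite skew_der_tin.
by rewrite skew_der_tin e scale0r.
Qed.

(** A form of [FW] kills [u] and its translates under [H], so it passes to [x], where it gives zero
    or a scalar; and the adjoint action kills scalars. A form of [FV] that hits [u] leaves an
    element of level [m]. *)
Lemma Mstr_ad m s u x : s \in H -> yd_cpt s u = u ->
  (forall h, FW h -> h u = 0) -> Mstr m x -> Mstr m.+1 (talg_ad s u x).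
Proof.
move=> sH us uW; have [Va _] := FVst; have [Wa _] := FWst.
have uH : supported (tin u).
  move=> t tH; rewrite talg_cpt_tin -us yd_cpt_cpt.
  by case: eqP tH => [->|]; rewrite ?sH ?linear0.
have adW h x0 : FW h -> supported x0 ->
    skew_der h (talg_ad s u x0) = talg_ad s u (skew_der (h \o yd_act s) x0).
  move=> Fh x0H; rewrite skew_der_ad // uW // scale0r sub0r big1 ?oppr0 ?add0r //.
  move=> t _; have [tH|tH] := boolP (t \in H).
    by rewrite -[h _]/((h \o yd_act t : form) u) uW ?scale0r //; apply: Wa.
  by rewrite (supported_act sH x0H) // scaler0.
have adH x0 : supported x0 -> supported (talg_ad s u x0).
  move=> x0H; rewrite /talg_ad addrC -scaleN1r; apply: supported_linear.
    by apply: supportedM => //; apply: supported_act.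
  exact: supportedM.
have MVx m0 x0 : Mstr m0 x0 -> forall f, FV f ->
    Mstr m0 ((f u : k) *: x0
             - \sum_t (f (yd_act t u) : k) *: talg_cpt t (talg_act s x0)).
  move=> Mx0 f Ff; rewrite addrC -scaleN1r; apply: Mstr_linear; last exact: MstrZ.
  by apply: Mstr_sum => t _; apply/MstrZ/Mstr_cpt/Mstr_act.
have MD m0 x0 y0 : Mstr m0 x0 -> Mstr m0 y0 -> Mstr m0 (x0 + y0).
  by move=> Mx0 My0; rewrite -[x0]scale1r; apply: Mstr_linear.
elim: m x => [|m IHm] x Mx; have [xH Px] := Mx; split; try exact: adH.
  case: Px => xW xV; split=> [h Fh|f Ff].
    rewrite adW //; have [c ->] := xW _ (Wa _ _ sH Fh).
    by rewrite linearZ /= /talg_ad talg_act_one mulr1 mul1r subrr scaler0.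
  rewrite skew_der_ad // xV ?linear0 ?addr0; last exact: Va.
  exact: (MVx 0).
case: Px => xW xV; split=> [h Fh|f Ff].
  by rewrite adW // xW ?linear0 //; apply: Wa.
rewrite skew_der_ad //; apply: (MD m.+1); first exact: MVx.
by apply: IHm; apply: xV; apply: Va.
Qed.

End Strata.

(** * Eigenvectors of their own degree *)

Lemma closed_prim_root (k : closedFieldType) (n : nat) :
  [pchar k] =i pred0 -> (0 < n)%N -> exists z : k, n.-primitive_root z.
Proof.
move=> char0 n0; have [r rE] := closed_field_poly_normal ('X^n - 1 : {poly k}).
have nk : n%:R != 0 :> k by have /pcharf0P-> := char0; rewrite -lt0n.
have l1 : lead_coef ('X^n - 1 : {poly k}) = 1.
  by rewrite -(prednK n0); apply/eqP; rewrite -monicE monicXnsubC.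
rewrite l1 scale1r in rE.
(* In characteristic zero X^n - 1 is separable, so its n roots are distinct. *)
have rU : uniq r by rewrite -separable_prod_XsubC -rE separable_Xn_sub_1.
have rn : all n.-unity_root r.
  by apply/allP=> z zr; rewrite /root_of_unity rE root_prod_XsubC.
have sr : (n <= size r)%N.
  have := congr1 (fun p : {poly k} => size p) rE.
  by rewrite size_XnsubC // size_prod_XsubC => -[->].
by have /hasP[z _ zP] := has_prim_root n0 rn rU sr; exists z.
Qed.

Section Commutators.
Context (k : fieldType) (char0 : [pchar k] =i pred0).
Context (G : finGroupType) (U : ydModType k G).
Local Notation T := (talg U).

Lemma talg_actX a (x : T) n : talg_act a (x ^+ n) = talg_act a x ^+ n.
Proof.
by elim: n => [|n IHn]; rewrite ?expr0 ?talg_act_one // !exprS talg_act_mul IHn.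
Qed.

Section QCommutator.
Context (N : T -> Prop) (D : {linear T -> T}).
Hypothesis N1 : N 1.
Hypothesis NL : forall c x y, N x -> N y -> N (c *: x + y).
Hypothesis NM : forall x y, N x -> N y -> N (x * y).
Hypothesis NA : forall a x, N x -> N (talg_act a x).
Hypothesis D1 : D 1 = 0.
Hypothesis DM : forall g x y, talg_cpt g x = x -> N x -> N y ->
  D (x * y) = D x * y + x * talg_act g^-1 (D (talg_act g y)).
Hypothesis DK : forall x, derker x -> derker (D x).

(* A braided vector space k y1 + k y2 with diagonal braiding of affine Cartan
   type A_1: the q-commutator of y1 and y2 is a root vector for the imaginary
   root, which has self-braiding 1, so that its powers are independent. *)
Lemma nichols_infinite_pair (g h : G) (y : T) (q c : k) :
    (h * g * h^-1 = g^-1)%g -> N y -> talg_cpt g y = y ->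
    talg_act g y = q *: y -> q != 0 -> q ^+ 2 != 1 ->
    D y = c%:A -> c != 0 ->
    D (talg_act h y) = 0 -> D (talg_act h^-1 y) = 0 ->
  ~ findim (nichols U).
Proof.
move=> hg Ny yg gy q0 q21 Dy c0 Dhy Dh'y.
have hg' : (g * h = h * g^-1)%g.
  have gE : g = (h * g^-1 * h^-1)%g.
    by have /(congr1 (fun a => a^-1)%g) := hg; rewrite !invMg !invgK mulgA.
  by rewrite {1}gE mulgKV.
have gV a (x : T) : talg_act g x = a *: x -> a != 0 -> talg_act g^-1 x = a^-1 *: x.
  move=> e a0; rewrite -[x in LHS]scale1r -(mulVf a0) -scalerA -e talg_actZ.
  by rewrite talg_actKV.
set y2 := talg_act h y.
have Ny2 : N y2 by apply: NA.
have y2g : talg_cpt g^-1 y2 = y2 by rewrite -hg talg_cpt_act yg.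
have gy2 : talg_act g y2 = q^-1 *: y2.
  by rewrite -talg_actM hg' talg_actM (gV q) // talg_actZ.
have g'y : talg_act g^-1 y = q^-1 *: y by apply: gV.
(* The conjugate of [D] by [h] detects [y2] as [D] detects [y]. *)
pose D2 : {linear T -> T} :=
  (@talg_act k G U h \o (D \o @talg_act k G U h^-1) : {linear T -> T}).
have D2E (x : T) : D2 x = talg_act h (D (talg_act h^-1 x)) by [].
have D2M a (x x' : T) : talg_cpt a x = x -> N x -> N x' ->
    D2 (x * x') = D2 x * x' + x * talg_act a^-1 (D2 (talg_act a x')).
  move=> xa Nx Nx'; rewrite !D2E talg_act_mul (DM (g := (h^-1 * a * h)%g)) //.
  - rewrite talg_actD !talg_act_mul !talg_actVK -!talg_actM; congr (_ + _ * _).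
    by rewrite !invMg invgK !mulgA mulgV mul1g mulgK.
  - by have := talg_cpt_act h^-1 a x; rewrite invgK xa.
  - exact: NA.
  - exact: NA.
have D21 : D2 1 = 0 by rewrite D2E talg_act_one D1 talg_act0.
have D2y : D2 y = 0 by rewrite D2E Dh'y talg_act0.
have D2y2 : D2 y2 = c%:A by rewrite D2E talg_actKV Dy talg_actZ talg_act_one.
(* The coefficient q^-1 is the one for which [D2] kills [z], while [D z] keeps the factor 1 -
   q^-2. *)
pose z : T := y * y2 - q^-1 *: (y2 * y).
have Nz : N z by rewrite /z addrC -scaleNr; apply: NL; apply: NM.
have z1 : talg_cpt 1%g z = z.
  rewrite /z linearB linearZ /= -{1}(mulgV g) (talg_cptM_homog yg y2g).
  by rewrite -(mulVg g) (talg_cptM_homog y2g yg).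
have gz : talg_act g z = z.
  rewrite /z linearB linearZ /= !talg_act_mul gy gy2.
  rewrite -!scalerAl -!scalerAr !scalerA -mulrA divff // mulVf //.
  by rewrite mulr1 scale1r.
have g'z n : talg_act g^-1 (z ^+ n) = z ^+ n.
  rewrite talg_actX; congr (_ ^+ _).
  by rewrite -{1}gz talg_actKV.
have DZ a (x : T) : D (a *: x) = a *: D x by exact: linearZ.
have D2Z a (x : T) : D2 (a *: x) = a *: D2 x by exact: linearZ.
have D0 : D 0 = 0 by exact: linear0.
have D20 : D2 0 = 0 by exact: linear0.
have D1z : D z = (c * (1 - q^-1 ^+ 2)) *: y2.
  have -> : D z = D (y * y2) - q^-1 *: D (y2 * y) by rewrite -DZ -linearB.
  rewrite (DM yg) // (DM y2g) // invgK Dy g'y gy2 !DZ Dhy Dy scaler0 mul0r.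
  rewrite talg_act0 mulr0 addr0 add0r !talg_actZ talg_act_one -!scalerAr mulr1.
  rewrite -scalerAl mul1r !scalerA -scalerBl mulrBr mulr1 mulrA.
  by congr ((_ - _) *: _); rewrite mulrC expr2.
have D2z : D2 z = 0.
  have -> : D2 z = D2 (y * y2) - q^-1 *: D2 (y2 * y) by rewrite -D2Z -linearB.
  rewrite (D2M _ _ _ yg) // (D2M _ _ _ y2g) // D2y D2y2 g'y gy2 !D2Z D2y D2y2.
  rewrite scaler0 !talg_act0 mulr0 mul0r add0r addr0 !talg_actZ talg_act_one.
  by rewrite -!scalerAr -!scalerAl mul1r mulr1 subrr.
have Nzn n : N (z ^+ n) by elim: n => [|n IHn]; rewrite ?expr0 // exprS; apply: NM.
have zM (x : T) : N x -> D (z * x) = D z * x + z * D x.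
  by move=> Nx; rewrite (DM z1) // invg1 !talg_act1.
have zM2 (x : T) : N x -> D2 (z * x) = z * D2 x.
  by move=> Nx; rewrite (D2M _ _ _ z1) // D2z mul0r add0r invg1 !talg_act1.
have DzS n : D (z ^+ n.+1) =
    (c * (1 - q^-1 ^+ 2)) *: (y2 * z ^+ n) + z * D (z ^+ n).
  by rewrite exprS zM // D1z scalerAl.
have ND1 n : N (D (z ^+ n)).
  elim: n => [|n IHn]; last by rewrite DzS; apply: NL; apply: NM.
  by rewrite D1 -(subrr y) addrC -scaleN1r; apply: NL.
have D2zn n : D2 (z ^+ n) = 0.
  by elim: n => [|n IHn]; rewrite ?D21 // exprS zM2 // IHn mulr0.
have D2y2z n : D2 (y2 * z ^+ n) = c *: z ^+ n.
  rewrite (D2M _ _ _ y2g) // g'z D2zn talg_act0 mulr0 addr0 D2y2.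
  by rewrite -scalerAl mul1r.
set d := c * (1 - q^-1 ^+ 2) in DzS *.
(* [D] replaces one factor [z] by a multiple of [y2], and [D2] then removes that [y2]. *)
apply: (@nichols_infinite _ char0 _ U (D2 \o D : {linear T -> T}) z (d * c)).
- by move=> x xK; apply/derker_act/DK/derker_act/DK.
- rewrite !mulf_neq0 // subr_eq0 eq_sym exprVn invr_eq1 //.
- by rewrite -[LHS]/(D2 (D 1)) D1 D20.
have D2D x y' : D2 (x + y') = D2 x + D2 y' by exact: linearD.
elim=> [|n IHn]; rewrite -[LHS]/(D2 (D _)) DzS D2D D2Z D2y2z scalerA.
  by rewrite D1 mulr0 D20 addr0 mul1r.
move: IHn; rewrite -[LHS]/(D2 (D _)) => IHn.
rewrite zM2 // IHn -scalerAr -exprS -scalerDl.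
by congr (_ *: _); rewrite -[n.+2]add1n natrD mulrDl mul1r.
Qed.

End QCommutator.
End Commutators.

Section SelfBraidingOne.
Context (k : fieldType) (char0 : [pchar k] =i pred0).
Context (G : finGroupType) (U : ydModType k G) (H : {group G}).
Local Notation T := (talg U).
Local Notation form := {linear U -> k^o}.
Context (FV FW : form -> Prop).
Hypotheses (FVst : stable_forms H FV) (FWst : stable_forms H FW).

(** Self-braiding one turns the skew Leibniz rule on powers of [y] into the ordinary one, with [D y]
    a scalar. *)
Lemma nichols_infinite_fixed (fs : seq form) (h : form) (g : G) (y : T) :
    all_FV FV fs -> FW h -> g \in H -> Mstr H FV FW (size fs) y ->
    talg_cpt g y = y -> talg_act g y = y -> multi_der fs h y != 0 ->
  ~ findim (nichols U).
Proof.
move=> fsV Fh gH My yg gy; have Ny := Mstr_Nstr My.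
have [c Dy] := multi_der_scalar Fh fsV My; rewrite Dy => c0.
have {}c0 : c != 0 by apply: contra_neq c0 => ->; rewrite scale0r.
have Nyn n : Nstr H FV FW (size fs) (y ^+ n).
  by elim: n => [|n IHn]; rewrite ?exprS; [apply: Nstr1|apply: (NstrM FVst FWst)].
have gyn n : talg_act g (y ^+ n) = y ^+ n by rewrite talg_actX gy.
have gVyn n : talg_act g^-1 (y ^+ n) = y ^+ n by rewrite -{1}(gyn n) talg_actKV.
have Dyn n : multi_der fs h (y ^+ n.+1) = (n.+1%:R * c) *: y ^+ n.
  elim: n => [|n IHn]; rewrite exprS (multi_derM FVst FWst Fh fsV gH yg Ny) // gyn Dy.
    by rewrite multi_der1 talg_act0 mulr0 addr0 expr0 mulr1 mul1r.
  rewrite IHn talg_actZ gVyn -scalerAl mul1r -scalerAr -exprS.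
  by rewrite -scalerDl -[n.+2]add1n natrD mulrDl mul1r.
apply: (@nichols_infinite _ char0 _ U (multi_der fs h) y c) => //.
- exact: derker_multi_der.
- exact: multi_der1.
Qed.

End SelfBraidingOne.

Section RealDegree.
Context (k : fieldType) (char0 : [pchar k] =i pred0).
Context (G : finGroupType) (U : ydModType k G).
Local Notation T := (talg U).
Local Notation form := {linear U -> k^o}.
Context (FV FW : form -> Prop).
Hypotheses (FVst : stable_forms [set: G] FV) (FWst : stable_forms [set: G] FW).
Local Notation Mstr := (Mstr [set: G] FV FW).
Local Notation Nstr := (Nstr [set: G] FV FW).

(* Averaging D over the conjugates by the powers of g makes it vanish on the
   eigenvectors of g for eigenvalues other than q. *)
Definition eigen_avg (D : T -> T) (g : G) (q : k) (x : T) : T :=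
  \sum_(i < #[g]%g) q ^- i *: talg_act (g ^- i)%g (D (talg_act (g ^+ i)%g x)).
Fact eigen_avg_linear (D : {linear T -> T}) g q : linear (eigen_avg D g q).
Proof.
move=> c x y; rewrite /eigen_avg scaler_sumr -big_split; apply: eq_bigr => i _ /=.
rewrite talg_actD talg_actZ linearP talg_actD talg_actZ scalerDr !scalerA.
by rewrite mulrC.
Qed.
HB.instance Definition _ (D : {linear T -> T}) g q :=
  GRing.isLinear.Build k T T *:%R (eigen_avg D g q) (eigen_avg_linear D g q).

(** The translates of [y] by [a] and [a^-1] are eigenvectors of [g] for q^-1, which differs from q.
    The averaged operator kills them, as [nichols_infinite_pair] demands. *)
Lemma nichols_infinite_real (fs : seq form) (h : form) (g a : G) (y : T) (q : k) :
    all_FV FV fs -> FW h -> (a * g * a^-1 = g^-1)%g -> Mstr (size fs) y ->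
    talg_cpt g y = y -> talg_act g y = q *: y -> q ^+ 2 != 1 ->
    multi_der fs h y != 0 ->
  ~ findim (nichols U).
Proof.
move=> fsV Fh ag My yg gy q21; have Ny := Mstr_Nstr My.
have [c Dy] := multi_der_scalar Fh fsV My; rewrite Dy => c0.
have {}c0 : c != 0 by apply: contra_neq c0 => ->; rewrite scale0r.
have y0 : y != 0.
  apply: contra_neq c0 => y0; move: Dy; rewrite y0 linear0 => /esym/eqP.
  by rewrite scaler_eq0 oner_eq0 orbF => /eqP.
have gX (r : k) (x : T) n : talg_act g x = r *: x -> talg_act (g ^+ n)%g x = r ^+ n *: x.
  move=> gx; elim: n => [|n IHn]; first by rewrite talg_act1 scale1r.
  by rewrite expgS talg_actM IHn talg_actZ gx scalerA exprSr.
have qn : q ^+ #[g]%g = 1.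
  have := gX _ _ #[g]%g gy; rewrite expg_order talg_act1 => /esym/eqP.
  rewrite -subr_eq0 -{2}[y]scale1r -scalerBl scaler_eq0 (negPf y0) orbF.
  by rewrite subr_eq0 => /eqP.
have q0 : q != 0.
  apply: contra_eqN qn => /eqP->.
  by rewrite expr0n gtn_eqF ?order_gt0 // eq_sym oner_neq0.
pose D : {linear T -> T} := eigen_avg (multi_der fs h) g q.
have DE (x : T) : D x = eigen_avg (multi_der fs h) g q x by [].
have gen : g \in [set: G] by rewrite inE.
have DZ b (x : T) : multi_der fs h (b *: x) = b *: multi_der fs h x by exact: linearZ.
have Dq (x : T) : Mstr (size fs) x -> talg_act g x = q^-1 *: x -> D x = 0.
  move=> Mx gx; have [d Dx] := multi_der_scalar Fh fsV Mx.
  rewrite DE /eigen_avg.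
  (* A full geometric sum: q^-2 is a root of unity of order dividing that of [g], and is not 1. *)
  have q2n : \sum_(i < #[g]%g) (q ^- 2) ^+ i = 0.
    have /eqP := subrX1 (q ^- 2) #[g]%g.
    have -> : (q ^- 2) ^+ #[g]%g = 1.
      by rewrite exprVn -exprM mulnC exprM qn expr1n invr1.
    rewrite subrr eq_sym mulf_eq0 subr_eq0 invr_eq1 (negPf q21) => /eqP; exact.
  transitivity ((\sum_(i < #[g]%g) (q ^- 2) ^+ i) *: (d *: (1 : T))).
    rewrite scaler_suml; apply: eq_bigr => i _.
    rewrite (gX _ _ _ gx) DZ Dx !talg_actZ talg_act_one !scalerA !mulrA.
    congr ((_ * _) *: _).
    by rewrite !exprVn -exprM mulnC exprM expr2 invfM.
  by rewrite q2n scale0r.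
have aE : (a * g^-1 * a^-1 = g)%g.
  by have /(congr1 (fun b => b^-1)%g) := ag; rewrite !invMg !invgK mulgA.
have gV (x : T) r : talg_act g x = r *: x -> r != 0 -> talg_act g^-1 x = r^-1 *: x.
  move=> e r0; rewrite -[x in LHS]scale1r -(mulVf r0) -scalerA -e talg_actZ.
  by rewrite talg_actKV.
have aT b : b \in [set: G] by rewrite inE.
apply: (@nichols_infinite_pair k char0 G U (Nstr (size fs)) D _ _ _ _ _ _ _
  g a y q (#[g]%g%:R * c)) => //.
- exact: Nstr1.
- by move=> *; apply: Nstr_linear.
- by move=> *; apply: (NstrM FVst FWst).
- by move=> *; apply: (Nstr_act FVst FWst).
- rewrite DE /eigen_avg big1 // => i _.
  by rewrite talg_act_one multi_der1 talg_act0 scaler0.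
- move=> b x z xb Nx Nz; rewrite !DE /eigen_avg mulr_suml linear_sum mulr_sumr.
  rewrite -big_split; apply: eq_bigr => i _ /=; set gi := (g ^+ i)%g.
  rewrite talg_act_mul (multi_derM FVst FWst Fh fsV (aT (gi * b * gi^-1)%g)) //.
  + rewrite talg_actD !talg_act_mul talg_actKV scalerDr -scalerAl talg_actZ.
    rewrite -!talg_actM mulVg talg_act1 mulgKV.
    rewrite -[in RHS](scalerAr _ x) scalerAl; congr (_ + _ *: (_ * talg_act _ _)).
    by rewrite !invMg invgK !mulgA mulVg mul1g.
  + by rewrite talg_cpt_act xb.
  + exact: (Nstr_act FVst FWst).
  + exact: (Nstr_act FVst FWst).
- move=> x xK; rewrite DE /eigen_avg; elim/big_ind: _ => [|u v uK vK|i _].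
  + by move=> l; elim: l => [|f l IHl] /=; rewrite ?linear0 ?skew_der0.
  + by rewrite -[u]scale1r; apply: derker_linear.
  rewrite -[_ *: _]addr0; apply: derker_linear.
    exact/derker_act/derker_multi_der/derker_act.
  by move=> l; elim: l => [|f l IHl] /=; rewrite ?linear0 ?skew_der0.
- rewrite DE /eigen_avg (eq_bigr (fun=> c%:A)) => [|i _].
    by rewrite sumr_const card_ord -scaler_nat scalerA.
  rewrite (gX _ _ _ gy) DZ Dy !talg_actZ talg_act_one !scalerA.
  by rewrite mulrA mulVf ?mul1r // expf_neq0.
- rewrite mulf_neq0 //; have /pcharf0P-> := char0.
  by rewrite -lt0n order_gt0.
- apply: Dq; first exact: (Mstr_act FVst FWst).
  by rewrite -talg_actM -{1}aE mulgKV talg_actM (gV _ q) // talg_actZ.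
- apply: Dq; first exact: (Mstr_act FVst FWst).
  have -> : talg_act g (talg_act a^-1 y) = talg_act a^-1 (talg_act g^-1 y).
    by rewrite -!talg_actM -ag !mulgA mulVg mul1g.
  by rewrite (gV _ q) // talg_actZ.
Qed.

End RealDegree.

Section ClosedField.
Context (k : closedFieldType) (char0 : [pchar k] =i pred0).
Context (G : finGroupType) (U : ydModType k G).
Local Notation T := (talg U).
Local Notation form := {linear U -> k^o}.
Context (FV FW : form -> Prop).
Hypotheses (FVst : stable_forms [set: G] FV) (FWst : stable_forms [set: G] FW).
Local Notation Mstr := (Mstr [set: G] FV FW).

(* Only the eigenvalue -1 of g can be seen by the derivations. *)
Lemma nichols_real_sign (fs : seq form) (h : form) (g a : G) (y : T) :
    findim (nichols U) -> all_FV FV fs -> FW h ->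
    (a * g * a^-1 = g^-1)%g -> Mstr (size fs) y -> talg_cpt g y = y ->
  multi_der fs h (talg_act g y) = - multi_der fs h y.
Proof.
move=> fin fsV Fh ag My yg.
have [z zP] := closed_prim_root char0 (order_gt0 g).
have aT b : b \in [set: G] by rewrite inE.
have nk : #[g]%g%:R != 0 :> k by have /pcharf0P-> := char0; rewrite -lt0n order_gt0.
have DZ b (x : T) : multi_der fs h (b *: x) = b *: multi_der fs h x by exact: linearZ.
(* Up to the factor [#[g]], the component of [y] in the eigenspace of [g] for z^j. *)
pose comp j : T := \sum_(i < #[g]%g) z ^- (i * j) *: talg_act (g ^+ i)%g y.
have z0 : z != 0.
  apply: contra_eqN (prim_expr_order zP) => /eqP->.
  by rewrite expr0n gtn_eqF ?order_gt0 // eq_sym oner_neq0.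
have Mcomp j : Mstr (size fs) (comp j).
  by apply: Mstr_sum => // i _; apply: MstrZ => //; apply: (Mstr_act FVst FWst).
have zX i : z ^- (i %% #[g]%g) = z ^- i by rewrite (prim_expr_mod zP).
have gcomp j : talg_act g (comp j) = z ^+ j *: comp j.
  have gi i : talg_act g (z ^- (i * j) *: talg_act (g ^+ i)%g y) =
      z ^+ j *: (z ^- (i.+1 * j) *: talg_act (g ^+ i.+1)%g y).
    rewrite talg_actZ -talg_actM -expgS scalerA mulSn exprD invfM mulrA divff ?mul1r //.
    exact: expf_neq0.
  rewrite /comp raddf_sum scaler_sumr /=; under eq_bigr do rewrite gi.
  pose F i := z ^+ j *: (z ^- (i * j) *: talg_act (g ^+ i)%g y).
  have F0 : F #[g]%g = F 0%N.
    by rewrite /F expg_order expg0 mul0n exprM (prim_expr_order zP) expr1n.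
  apply: (addrI (F 0%N)); have := @big_ord_recl T 0 +%R #[g]%g (fun i => F i).
  by rewrite big_ord_recr /= F0 addrC => <-.
have compg j : talg_cpt g (comp j) = comp j.
  rewrite /comp raddf_sum; apply: eq_bigr => i _ /=.
  rewrite talg_cptZ; congr (_ *: _).
  have {1}-> : g = (g ^+ i * g * (g ^+ i)^-1)%g by rewrite -expgSr expgS mulgK.
  by rewrite talg_cpt_act yg.
have ysum : y = #[g]%g%:R^-1 *: \sum_(j < #[g]%g) comp j.
  rewrite exchange_big (bigD1 (Ordinal (order_gt0 g))) //= [X in _ + X]big1 => [|i i0].
    under eq_bigr do rewrite /= mul0n expr0 invr1 scale1r expg0 talg_act1.
    by rewrite sumr_const card_ord -scaler_nat addr0 scalerA mulVf // scale1r.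
  rewrite -scaler_suml; suff -> : \sum_(j < #[g]%g) z ^- (i * j) = 0 by rewrite scale0r.
  under eq_bigr do rewrite exprM -exprVn.
  have zi : (z ^+ i)^-1 != 1.
    by rewrite invr_eq1 -(prim_order_dvd zP) gtnNdvd // lt0n.
  have /eqP := subrX1 (z ^+ i)^-1 #[g]%g.
  rewrite exprVn -exprM mulnC exprM (prim_expr_order zP) expr1n invr1 subrr eq_sym.
  by rewrite mulf_eq0 subr_eq0 (negPf zi) => /eqP.
(* A component seen by the derivations has eigenvalue of square 1, by [nichols_infinite_real], and
   not 1 itself, by [nichols_infinite_fixed]. *)
have Dcomp j : multi_der fs h (talg_act g (comp j)) = - multi_der fs h (comp j).
  have [D0|Dj] := eqVneq (multi_der fs h (comp j)) 0.
    by rewrite gcomp DZ D0 scaler0 oppr0.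
  have [zj|zj] := eqVneq ((z ^+ j) ^+ 2) 1; last first.
    have := nichols_infinite_real char0 FVst FWst fsV Fh ag (Mcomp j) (compg j) (gcomp j) zj Dj.
    by case.
  have /eqP := zj; rewrite sqrf_eq1 => /orP[]/eqP zj1.
    case: (nichols_infinite_fixed char0 FVst FWst fsV Fh (aT g) (Mcomp j) _ _ Dj) => //.
    by rewrite gcomp zj1 scale1r.
  by rewrite gcomp zj1 scaleN1r raddfN.
rewrite ysum talg_actZ !DZ -scalerN; congr (_ *: _).
by rewrite !raddf_sum; apply: eq_bigr => j _; apply: Dcomp.
Qed.

End ClosedField.

(** * Complements of Yetter-Drinfeld submodules *)

(** Zorn's lemma gives a maximal subspace [A] meeting [W] trivially; the projection is taken along
    [A]. *)
Lemma subspace_projection (k : fieldType) (V : lmodType k) (W : {pred V}) :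
    submod_closed W ->
  exists p : {linear V -> V}, (forall x, p x \in W) /\ {in W, p =1 id}.
Proof.
case=> W0 WP.
have WZ c x : x \in W -> c *: x \in W by move=> xW; rewrite -[_ *: _]addr0 WP.
have WD x y : x \in W -> y \in W -> x + y \in W.
  by move=> xW yW; rewrite -[x]scale1r WP.
pose closed (C : V -> Prop) := forall c x y, C x -> C y -> C (c *: x + y).
pose P (C : V -> Prop) := closed C /\ forall x, C x -> x \in W -> x = 0.
have [A [[Acl A0] Amax]] : exists A, P A /\
    forall B, classical_sets.proper A B -> ~ P B.
  apply: classical_sets.Zorn_bigcup => F FP Ftot; split=> [c x y|x [C FC Cx] xW].
    move=> [C FC Cx] [C' FC' Cy].
    have [CC|CC] := Ftot _ _ FC FC'.
      by exists C' => //; apply: (proj1 (FP _ FC')) => //; apply: CC.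
    by exists C => //; apply: (proj1 (FP _ FC)) => //; apply: CC.
  exact: (proj2 (FP _ FC)).
have max_incl (B : V -> Prop) : P B -> (forall x, A x -> B x) -> forall x, B x -> A x.
  move=> PB AB x Bx; have [//|nA] := pselect (A x).
  by case: (Amax B) => //; split=> // BA; apply/nA/BA.
(* The empty set also satisfies [P], so that 0 lies in [A] only by maximality. *)
have A00 : A 0.
  apply: (max_incl (fun x => A x \/ x = 0)); [|by left|by right].
  split=> [c x y|x [Ax|->//]]; last exact: A0.
  move=> [Ax|->] [Ay|->]; rewrite ?addr0 ?scaler0 ?add0r; try by left; auto.
    left; have := Acl (c - 1) x x Ax Ax; rewrite scalerBl scale1r subrK; exact.
  by right.
have AZ c x : A x -> A (c *: x) by move=> Ax; rewrite -[_ *: _]addr0; apply: Acl.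
(* If [v] were outside [W] + [A], then [A] + k v would still meet [W] trivially, so [v] would lie in
   [A]. *)
have dec v : exists w, w \in W /\ A (v - w).
  pose B x := exists a c, A a /\ x = a + c *: v.
  have [//|nex] := pselect (exists w, w \in W /\ A (v - w)).
  have PB : P B.
    split=> [c _ _ [a [d [Aa ->]]] [b [e [Ab ->]]]|_ [a [c [Aa ->]]] xW].
      exists (c *: a + b), (c * d + e); split; first exact: Acl.
      by rewrite scalerDr scalerA scalerDl addrACA.
    have [c0|c0] := eqVneq c 0.
      by move: xW; rewrite c0 scale0r addr0; apply: A0.
    case: nex; exists (c^-1 *: (a + c *: v)); split; first exact: WZ.
    rewrite scalerDr scalerA mulVf // scale1r opprD addrCA subrr addr0 -scalerN.
    by apply/AZ; rewrite -scaleN1r; apply/AZ.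
  have Av : A v.
    apply: (max_incl B PB) => [x Ax|].
      by exists x, 0; rewrite scale0r addr0.
    by exists 0, 1; rewrite add0r scale1r.
  by exists 0; rewrite subr0.
have [p pP] := boolp.choice dec.
have uniq v w : w \in W -> A (v - w) -> p v = w.
  move=> wW Aw; have [pW Ap] := pP v; apply/eqP; rewrite -subr_eq0; apply/eqP/A0.
    have -> : p v - w = (-1) *: (v - p v) + (v - w).
      by rewrite scaleN1r opprB addrA subrK.
    exact: Acl.
  by rewrite -scaleN1r addrC; apply: WP.
have plin : linear p.
  move=> c x y; have [[xW Ax] [yW Ay]] := (pP x, pP y).
  apply: uniq; first exact: WP.
  rewrite (_ : _ - _ = c *: (x - p x) + (y - p y)); first exact: Acl.
  by rewrite scalerBr opprD addrACA.
pose pL := GRing.isLinear.Build k V V *:%R p plin.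
exists (HB.pack p pL : {linear V -> V}); split=> [x|x xW] /=; first by case: (pP x).
by apply: uniq => //; rewrite subrr.
Qed.

Lemma separating_form (k : fieldType) (V : lmodType k) (v : V) :
  v != 0 -> exists f : {linear V -> k^o}, f v != 0.
Proof.
move=> v0; pose W : {pred V} := fun x => `[< exists c : k, x = c *: v >].
have WP x : x \in W <-> exists c : k, x = c *: v by split=> /asboolP.
have Wcl : submod_closed W.
  split=> [|c x y /WP[a ->] /WP[b ->]]; apply/WP; first by exists 0; rewrite scale0r.
  by exists (c * a + b); rewrite scalerDl scalerA.
have [p [pW pid]] := subspace_projection Wcl.
have [c cP] := boolp.choice (fun x => (proj1 (WP _)) (pW x)).
have inj a b : a *: v = b *: v -> a = b.
  move/eqP; rewrite -subr_eq0 -scalerBl scaler_eq0 (negPf v0) orbF subr_eq0.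
  by move/eqP.
have clin : linear (c : V -> k^o).
  by move=> a x y; apply: inj; rewrite -cP linearP scalerDl -scalerA -!cP.
pose cL := GRing.isLinear.Build k V k^o *:%R c clin.
exists (HB.pack c cL : {linear V -> k^o}) => /=.
suff -> : c v = 1 by rewrite oner_neq0.
by apply: inj; rewrite -cP scale1r pid //; apply/WP; exists 1; rewrite scale1r.
Qed.

Section Averaging.
Context (k : fieldType) (char0 : [pchar k] =i pred0).
Context (G : finGroupType) (U : ydModType k G).

(** Maschke's average, adapted to the grading: the sum over [s] keeps the diagonal blocks of [p],
    the sum over [g] makes the result equivariant. *)
Definition yd_avg (p : U -> U) (u : U) : U :=
  #|G|%:R^-1 *: \sum_(g : G) \sum_(s : G)
    yd_act g (yd_cpt s (p (yd_cpt s (yd_act g^-1 u)))).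

Fact yd_avg_linear (p : {linear U -> U}) : linear (yd_avg p).
Proof.
move=> c u v; rewrite /yd_avg scalerA mulrC -scalerA -scalerDr; congr (_ *: _).
rewrite scaler_sumr -big_split; apply: eq_bigr => g _ /=.
by rewrite scaler_sumr -big_split; apply: eq_bigr => s _ /=; rewrite !linearP.
Qed.
HB.instance Definition _ (p : {linear U -> U}) :=
  GRing.isLinear.Build k U U *:%R (yd_avg p) (yd_avg_linear p).

Lemma yd_avg_act (p : {linear U -> U}) h u :
  yd_avg p (yd_act h u) = yd_act h (yd_avg p u).
Proof.
rewrite /yd_avg [RHS]linearZ; congr (_ *: _); rewrite [RHS]linear_sum.
rewrite (reindex_inj (mulgI h)); apply: eq_bigr => g _ /=.
rewrite linear_sum; apply: eq_bigr => s _ /=.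
have -> : yd_act (h * g)^-1 (yd_act h u) = yd_act g^-1 u.
  by rewrite -yd_actM invMg mulgKV.
by rewrite yd_actM.
Qed.

Lemma yd_avg_cpt (p : {linear U -> U}) t u :
  yd_avg p (yd_cpt t u) = yd_cpt t (yd_avg p u).
Proof.
rewrite /yd_avg [RHS]linearZ; congr (_ *: _); rewrite [RHS]linear_sum.
apply: eq_bigr => g _; rewrite linear_sum; apply: eq_bigr => s _ /=.
have cE v : yd_cpt t (yd_act g v) = yd_act g (yd_cpt (t ^ g)%g v).
  by rewrite -yd_cpt_act conjgE !mulgA mulgV mul1g mulgK.
have cV v : yd_act g^-1 (yd_cpt t v) = yd_cpt (t ^ g)%g (yd_act g^-1 v).
  by rewrite -yd_cpt_act invgK conjgE mulgA.
rewrite cE cV !yd_cpt_cpt eq_sym; case: eqP => [->//|_].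
by rewrite !linear0.
Qed.

Lemma yd_complement (W : {pred U}) : yd_submod W ->
  exists p : {linear U -> U},
    [/\ forall u, p u \in W, {in W, p =1 id},
        forall h u, p (yd_act h u) = yd_act h (p u) &
        forall t u, p (yd_cpt t u) = yd_cpt t (p u)].
Proof.
case=> Wcl WA WC; have [p [pW pid]] := subspace_projection Wcl.
have [W0 WP] := Wcl.
have Wsum I (F : I -> U) (r : seq I) :
    (forall i, F i \in W) -> \sum_(i <- r) F i \in W.
  move=> FW; elim/big_ind: _ => // x y xW yW; by rewrite -[x]scale1r WP.
have nG : #|G|%:R != 0 :> k.
  by have /pcharf0P-> := char0; rewrite -lt0n; apply/card_gt0P; exists 1%g.
exists (yd_avg p); split.
- move=> u; rewrite /= /yd_avg -[X in X \in W]addr0; apply: WP => //.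
  by apply/Wsum => g; apply/Wsum => s; apply/WA/WC.
- move=> u uW; rewrite /= /yd_avg (eq_bigr (fun=> u)) => [|g _].
    by rewrite sumr_const -scaler_nat scalerA mulVf ?scale1r.
  rewrite -linear_sum /= (eq_bigr (fun s => yd_cpt s (yd_act g^-1 u))) => [|s _].
    by rewrite yd_cpt_sum -yd_actM mulgV yd_act1.
  by rewrite pid ?yd_cpt_cpt ?eqxx //; apply/WC/WA.
- exact: yd_avg_act.
- exact: yd_avg_cpt.
Qed.

End Averaging.

(** * Obstructions *)

Section DegreeOne.
Context (k : closedFieldType) (char0 : [pchar k] =i pred0).
Context (G : finGroupType) (U : ydModType k G).
Hypothesis real : forall g : G, exists a, (a * g * a^-1 = g^-1)%g.
Hypothesis fin : findim (nichols U).
Local Notation T := (talg U).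
Local Notation form := {linear U -> k^o}.
Implicit Types (f h : form) (s t g : G) (u v w : U).

Lemma stable_formsT (F : form -> Prop) :
    (forall g f, F f -> F (f \o yd_act g)) ->
    (forall s f, F f -> F (f \o yd_cpt s)) ->
  stable_forms [set: G] F.
Proof. by move=> Fa Fc; split=> [g f _|]; [apply: Fa|]. Qed.

Lemma yd_act_homog_conj g s u :
  yd_cpt s u = u -> yd_cpt (g * s * g^-1)%g (yd_act g u) = yd_act g u.
Proof. by move=> us; rewrite yd_cpt_act us. Qed.

Fact conj_twice g s :
  (g * (g * s * g^-1) * g^-1 = s)%g -> (g * g * s = s * g * g)%g.
Proof. by move/(congr1 (fun x => x * g * g)%g); rewrite /= !mulgA !mulgKV. Qed.

Lemma char0_addrr (V : lmodType k) (x : V) : x + x = 0 -> x = 0.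
Proof.
rewrite -mulr2n -scaler_nat => /eqP; rewrite scaler_eq0.
by have /pcharf0P-> := char0; move=> /eqP.
Qed.

(** The sign rule with V = 0 and no form in [fs], for a form [h] that separates s u + u from
    zero. *)
Lemma yd_self_action s u : yd_cpt s u = u -> yd_act s u = - u.
Proof.
move=> us; have [a ga] := real s; apply/eqP; rewrite -subr_eq0 opprK.
apply/negPn/negP => /separating_form[h]; rewrite linearD /=.
have FVst : stable_forms [set: G] (fun _ : form => False) by apply: stable_formsT.
have FWst : stable_forms [set: G] (fun _ : form => True) by apply: stable_formsT.
have My : Mstr [set: G] (fun _ => False) (fun _ => True) 0 (tin u).
  by apply: (Mstr_tin _ _ us) => //; rewrite inE.
have := nichols_real_sign char0 FVst FWst (fs := [::]) (h := h) fin I I ga My.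
rewrite talg_cpt_tin us /multi_der /= talg_act_tin !skew_der_tin => /(_ erefl) e.
move/eqP; case; move/eqP: e; rewrite -addr_eq0 -scalerDl scaler_eq0 oner_eq0 orbF.
by move/eqP.
Qed.

Lemma skew_der_ad_tin f s t v w : yd_cpt s v = v -> yd_cpt t w = w ->
    f (yd_act s w) = 0 ->
  skew_der f (talg_ad s v (tin w)) =
  (f v : k) *: tin w - (f (yd_act (s * t * s^-1)%g v) : k) *: tin (yd_act s w).
Proof.
move=> vs wt fw; rewrite (skew_der_ad_homog f vs (g := t)); last first.
  by rewrite talg_cpt_tin wt.
by rewrite skew_der_tin /= fw scale0r linear0 addr0 talg_act_tin.
Qed.

Section Decomposition.
Context (p : {linear U -> U}).
Hypothesis pK : forall u, p (p u) = p u.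
Hypothesis pact : forall g u, p (yd_act g u) = yd_act g (p u).
Hypothesis pcpt : forall s u, p (yd_cpt s u) = yd_cpt s (p u).

(** With V the kernel and W the image of the projection [p], these are the forms living on V, hence
    vanishing on W; [img_form] exchanges the two. *)
Definition ker_form f : Prop := forall u, f (p u) = 0.
Definition img_form f : Prop := forall u, f u = f (p u).

Fact ker_form_stable : stable_forms [set: G] ker_form.
Proof.
by apply: stable_formsT => g f fp u /=; rewrite -(pact, pcpt) fp.
Qed.

Fact img_form_stable : stable_forms [set: G] img_form.
Proof.
by apply: stable_formsT => g f fp u /=; rewrite fp pact || rewrite fp pcpt.
Qed.

(** The restriction of [f] to the component of degree [s] of the kernel of [p], extended by zero. *)
Definition form_ker f s : form := (f \o yd_cpt s) \- (f \o (yd_cpt s \o p)).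
Definition form_img f s : form := f \o (yd_cpt s \o p).

Lemma form_kerP f s : ker_form (form_ker f s).
Proof. by move=> u; rewrite /form_ker /= pK subrr. Qed.

Lemma form_imgP f s : img_form (form_img f s).
Proof. by move=> u; rewrite /form_img /= pK. Qed.

Lemma form_ker_homog f s v : p v = 0 -> yd_cpt s v = v -> form_ker f s v = f v.
Proof. by move=> pv vs; rewrite /form_ker /= pv vs !linear0 addr0. Qed.

Lemma form_ker_eq0 f s r v : yd_cpt r v = v -> r != s -> form_ker f s v = 0.
Proof.
move=> vr rs; rewrite /form_ker /= -pcpt -vr yd_cpt_cpt eq_sym (negPf rs).
by rewrite !linear0 addr0.
Qed.

Lemma form_img_homog f s w : p w = w -> yd_cpt s w = w -> form_img f s w = f w.
Proof. by move=> pw ws; rewrite /form_img /= pw ws. Qed.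

Lemma Mstr_ad_tin s t v w : p v = 0 -> yd_cpt s v = v -> p w = w ->
  yd_cpt t w = w -> Mstr [set: G] ker_form img_form 1 (talg_ad s v (tin w)).
Proof.
move=> pv vs pw wt; apply: Mstr_ad => //.
- exact: ker_form_stable.
- exact: img_form_stable.
- by rewrite inE.
- by move=> h ->; rewrite pv linear0.
by apply: (Mstr_tin _ _ wt) => [|f fp]; rewrite ?inE // -pw fp.
Qed.

(* For y = ad v (w) of degree g = st and a double derivation D of degree
   (s, t), D y is nonzero, while D (g y) = 0 unless g^2 commutes with s. *)
Lemma supports_quadratic s t v w : p v = 0 -> yd_cpt s v = v -> v != 0 ->
    p w = w -> yd_cpt t w = w -> w != 0 ->
  (s * t * s * t = t * s * t * s)%g.
Proof.
move=> pv vs v0 pw wt w0; apply/eqP/negPn/negP => nq; pose g := (s * t)%g.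
have [f0 f0v] := separating_form v0; have [h0 h0w] := separating_form w0.
pose f := form_ker f0 s; pose h := form_img h0 t.
have fW w' : p w' = w' -> f w' = 0 by move=> <-; apply: form_kerP.
(* Equality would make [s] and [t] commute, and then the relation holds. *)
have gs : (g * s * g^-1 != s)%g.
  apply: contraNneq nq => e; have {}e : (g * s = s * g)%g by rewrite -{2}e mulgKV.
  have ts : (t * s = s * t)%g by apply: (mulgI s); rewrite mulgA.
  by rewrite -[(t * s * t * s)%g]mulgA ts mulgA.
have ggs : (g * (g * s * g^-1) * g^-1 != s)%g.
  apply: contraNneq nq => e.
  have {}e := conj_twice e.
  by apply/eqP/(mulgI s); move: e; rewrite /g !mulgA.
pose y := talg_ad s v (tin w).
have My : Mstr [set: G] ker_form img_form 1 y by apply: (Mstr_ad_tin pv vs pw wt).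
have yg : talg_cpt g y = y by apply: talg_ad_homog; rewrite ?talg_cpt_tin ?wt.
have [a ga] := real g.
have := nichols_real_sign char0 ker_form_stable img_form_stable (fs := [:: f]) (h := h)
  fin (conj (form_kerP _ _) I) (form_imgP _ _) ga My yg.
rewrite /y talg_ad_act talg_act_tin /multi_der /=.
rewrite (skew_der_ad_tin (t := (g * t * g^-1)%g)) //;
  try exact: yd_act_homog_conj; last first.
  by apply: fW; rewrite !pact pw.
rewrite (form_ker_eq0 _ (yd_act_homog_conj g vs) gs).
(* The two coefficients in the derivative of g y are values of [f] in the degrees of [gs] and [ggs],
   so both vanish. *)
have d2 : yd_cpt (g * (g * s * g^-1) * g^-1)%g
   (yd_act (g * s * g^-1 * (g * t * g^-1) * (g * s * g^-1)^-1)%g (yd_act g v)) =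
   (yd_act (g * s * g^-1 * (g * t * g^-1) * (g * s * g^-1)^-1)%g (yd_act g v)).
  have -> : (g * (g * s * g^-1) * g^-1 =
      (g * s * g^-1 * (g * t * g^-1) * (g * s * g^-1)^-1) * (g * s * g^-1) *
      (g * s * g^-1 * (g * t * g^-1) * (g * s * g^-1)^-1)^-1)%g.
    by rewrite /g !invMg !invgK !mulgA !mulgKV.
  by apply/yd_act_homog_conj/yd_act_homog_conj.
rewrite (form_ker_eq0 _ d2 ggs) !scale0r subrr skew_der0.
(* On [y] itself only the first term survives, so D y is the product of [f v] and [h w]. *)
rewrite (skew_der_ad_tin (t := t)) //; last by apply: fW; rewrite pact pw.
have d1 := yd_act_homog_conj (s * t * s^-1)%g vs.
rewrite (form_ker_eq0 _ d1) ?scale0r ?subr0; last first.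
  by move: gs; rewrite /g !invMg !invgK !mulgA !mulgKV.
rewrite (form_ker_homog _ pv vs) skew_derZ skew_der_tin (form_img_homog _ pw wt).
move/eqP; rewrite eq_sym oppr_eq0 !scaler_eq0 (negPf f0v) oner_eq0 orbF.
by rewrite (negPf h0w).
Qed.

End Decomposition.
End DegreeOne.

Section DegreeTwo.
Context (k : closedFieldType) (char0 : [pchar k] =i pred0).
Context (G : finGroupType) (U : ydModType k G).
Hypothesis real : forall g : G, exists a, (a * g * a^-1 = g^-1)%g.
Hypothesis fin : findim (nichols U).
Local Notation T := (talg U).
Local Notation form := {linear U -> k^o}.
Implicit Types (f h : form) (s t g : G) (u v w : U).

Fact conj_mul3 g r s t :
  (g * r * g^-1 * (g * s * g^-1) * (g * t * g^-1) = g * (r * s * t) * g^-1)%g.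
Proof. by rewrite !mulgA !mulgKV. Qed.

Fact conj_conj g r s :
  (g * r * g^-1 * (g * s * g^-1) * (g * r * g^-1)^-1 = g * (r * s * r^-1) * g^-1)%g.
Proof. by rewrite !invMg !invgK !mulgA !mulgKV. Qed.

Section Decomposition.
Context (p : {linear U -> U}).
Hypothesis pK : forall u, p (p u) = p u.
Hypothesis pact : forall g u, p (yd_act g u) = yd_act g (p u).
Hypothesis pcpt : forall s u, p (yd_cpt s u) = yd_cpt s (p u).

(** Every other term carries a value of [f] on W or in one of the three excluded degrees. *)
Lemma skew_der_ad2 f r s t (v' v w : U) :
    ker_form p f -> yd_cpt r v' = v' -> yd_cpt s v = v -> yd_cpt t w = w -> p w = w ->
    let g := (r * s * t)%g in
    (forall u, yd_cpt (g * r * g^-1)%g u = u -> f u = 0) ->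
    (forall u, yd_cpt (g * s * g^-1)%g u = u -> f u = 0) ->
    (forall u, yd_cpt (r * s * r^-1)%g u = u -> f u = 0) ->
  skew_der f (talg_ad r v' (talg_ad s v (tin w))) =
  (f v' : k) *: talg_ad s v (tin w).
Proof.
move=> fp v'r vs wt pw g fr fs frs.
have fW w' : p w' = w' -> f w' = 0 by move=> <-; apply: fp.
have x_st : talg_cpt (s * t)%g (talg_ad s v (tin w)) = talg_ad s v (tin w).
  by apply: talg_ad_homog; rewrite ?talg_cpt_tin ?wt.
rewrite (skew_der_ad_homog f v'r x_st).
rewrite [f (yd_act (r * (s * t) * r^-1)%g _)]fr; last first.
  have -> : (g * r * g^-1 = (r * (s * t) * r^-1) * r * (r * (s * t) * r^-1)^-1)%g.
    by rewrite /g !invMg !invgK !mulgA !mulgKV.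
  exact: yd_act_homog_conj.
rewrite (skew_der_ad_tin (t := t)) //=; last first.
  by apply: fW; rewrite !pact pw.
rewrite [f (yd_act r v)]frs; last exact: yd_act_homog_conj.
rewrite -yd_actM [f (yd_act _ v)]fs; last first.
  have -> : (g * s * g^-1 = (r * (s * t * s^-1)) * s * (r * (s * t * s^-1))^-1)%g.
    by rewrite /g !invMg !invgK !mulgA !mulgKV.
  exact: yd_act_homog_conj.
by rewrite !scale0r !subr0 linear0 addr0.
Qed.

(* The same argument as for [supports_quadratic], with y = ad v' (ad v (w)). *)
Lemma degree_two_obstruction r s t (v' v w : U) :
    p v' = 0 -> yd_cpt r v' = v' -> v' != 0 ->
    p v = 0 -> yd_cpt s v = v -> v != 0 ->
    p w = w -> yd_cpt t w = w -> w != 0 ->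
    let g := (r * s * t)%g in
    ((s * t) * s * (s * t)^-1 != s)%g ->
    [/\ r * s * r^-1 != r, g * r * g^-1 != r & g * s * g^-1 != r]%g ->
    [/\ g * (g * r * g^-1) * g^-1 != r, g * (g * s * g^-1) * g^-1 != r &
        g * (r * s * r^-1) * g^-1 != r]%g ->
  False.
Proof.
move=> pv' v'r v'0 pv vs v0 pw wt w0 g st [rs gr gs] [ggr ggs grs].
have [f1' f1v] := separating_form v'0; have [f2' f2v] := separating_form v0.
have [h' hw] := separating_form w0.
pose f1 := form_ker p f1' r; pose f2 := form_ker p f2' s; pose h := form_img p h' t.
have FVst := ker_form_stable pact pcpt; have FWst := img_form_stable pact pcpt.
pose y := talg_ad r v' (talg_ad s v (tin w)).
have My : Mstr [set: G] (ker_form p) (img_form p) 2 y.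
  apply: Mstr_ad => //; [by rewrite inE|by move=> h1 ->; rewrite pv' linear0|].
  exact: (Mstr_ad_tin pact pcpt pv vs pw wt).
have yg : talg_cpt g y = y.
  rewrite /g -mulgA; apply: talg_ad_homog => //.
  by apply: talg_ad_homog; rewrite ?talg_cpt_tin ?wt.
have [a ga] := real g.
have f1V : ker_form p f1 by apply: form_kerP.
have := nichols_real_sign char0 FVst FWst (fs := [:: f1; f2]) (h := h)
  fin (conj f1V (conj (form_kerP pK _ _) I)) (form_imgP pK _ _) ga My yg.
have f10 b u : b != r -> yd_cpt b u = u -> f1 u = 0.
  by move=> br ub; apply: (form_ker_eq0 pcpt _ ub br).
rewrite /y !talg_ad_act talg_act_tin /multi_der /=.
have gE : (g * r * g^-1 * (g * s * g^-1) * (g * t * g^-1) = g)%g.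
  by rewrite conj_mul3 -/g mulgK.
rewrite (skew_der_ad2 f1V (yd_act_homog_conj g v'r) (yd_act_homog_conj g vs)
  (yd_act_homog_conj g wt)) ?gE ?pact ?pw //; first last.
- by move=> u; apply: f10; rewrite conj_conj.
- by move=> u; apply: f10.
- by move=> u; apply: f10.
(* This makes D(g y) zero; the remaining steps compute D y as the product of [f1 v'], [f2 v] and
   [h w]. *)
rewrite (f10 _ _ gr (yd_act_homog_conj g v'r)) scale0r !skew_der0.
rewrite (skew_der_ad2 f1V v'r vs wt pw) //; try by move=> u; apply: f10.
rewrite (skew_derZ f2) (skew_der_ad_tin (t := t)) //; last first.
  by rewrite /f2 -pw -pact form_kerP.
rewrite (form_ker_eq0 pcpt _ (yd_act_homog_conj (s * t * s^-1)%g vs)); last first.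
  by move: st; rewrite !invMg !invgK !mulgA !mulgKV.
rewrite scale0r subr0 !skew_derZ skew_der_tin (form_img_homog _ pw wt).
rewrite (form_ker_homog _ pv' v'r) (form_ker_homog _ pv vs).
move/eqP; rewrite eq_sym oppr_eq0 !scaler_eq0 oner_eq0 orbF.
by rewrite (negPf f1v) (negPf f2v) (negPf hw).
Qed.

End Decomposition.

(** A line spanned by a simultaneous eigenform of [H] concentrated in one degree is stable, which
    gives small sets [FV] and [FW]. *)
Definition line_form f h : Prop := exists x : k, forall u, h u = x * f u.
Definition form_degree f s : Prop :=
  forall b u, f (yd_cpt b u) = if b == s then f u else 0.
Definition form_eigen f g (x : k) : Prop := forall u, f (yd_act g u) = x * f u.

Lemma line_form_stable (H : {group G}) f s : form_degree f s ->
  (forall g, g \in H -> exists x, form_eigen f g x) -> stable_forms H (line_form f).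
Proof.
move=> fs fH; split=> [g h gH [x hx]|b h [x hx]].
  have [y fy] := fH g gH; exists (x * y) => u.
  by rewrite /= hx fy mulrA.
exists (if b == s then x else 0) => u /=; rewrite hx fs.
by case: eqP; rewrite ?mulr0 ?mul0r.
Qed.

Lemma stable_forms_or (H : {group G}) (F F' : form -> Prop) :
  stable_forms H F -> stable_forms H F' -> stable_forms H (fun f => F f \/ F' f).
Proof.
by move=> [a b] [a' b']; split=> [g f gH|s f] [Ff|Ff]; [left|right|left|right]; auto.
Qed.

Lemma form_degree_conj f s c : form_degree f s ->
  form_degree (f \o yd_act c^-1) (c * s * c^-1)%g.
Proof.
move=> fs b u /=; have -> : b = (c * (c^-1 * b * c) * c^-1)%g.
  by rewrite !mulgA mulgV mul1g mulgK.
have {1}-> : u = yd_act c (yd_act c^-1 u) by rewrite -yd_actM mulgV yd_act1.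
rewrite yd_cpt_act -yd_actM mulVg yd_act1 fs.
by rewrite (inj_eq (mulIg _)) (inj_eq (mulgI _)).
Qed.

Lemma form_eigen_conj f g x c : form_eigen f g x ->
  form_eigen (f \o yd_act c^-1) (c * g * c^-1)%g x.
Proof. by move=> fg u /=; rewrite -fg -!yd_actM !mulgA mulVg mul1g. Qed.

(* Three vectors of pairwise commuting degrees s, t, st span a braided subspace
   of diagonal type with Dynkin diagram a triangle, all labels being -1: this is
   affine type A_2 and its imaginary root vector has degree 1. *)
Section Triangle.
Context (s t e c : G) (u0 : U).
Local Notation r := (s * t)%g.
Hypotheses (ss : (s * s = 1)%g) (tt : (t * t = 1)%g) (ts : (t * s = s * t)%g).
Hypotheses (s1 : s != 1%g) (t1 : t != 1%g) (st : s != t).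
Hypotheses (es : (e * s * e^-1 = s)%g) (et : (e * t * e^-1 = s * t)%g).
Hypotheses (cs : (c * s * c^-1 = t)%g) (ct : (c * t * c^-1 = s * t)%g).
Hypotheses (u00 : u0 != 0) (u0s : yd_cpt s u0 = u0).

Lemma triangle_obstruction : False.
Proof.
have sact u : yd_cpt s u = u -> yd_act s u = - u by apply: yd_self_action.
(* A vector of degree [s] fixed by [t]: the symmetrization of [u0] or, if that vanishes, e u0, on
   which [t] acts as [s * t] does on [u0], by (-1)(-1). *)
have [v [v0 [vs vt]]] : exists v, v != 0 /\ yd_cpt s v = v /\ yd_act t v = v.
  have [tu|tu] := eqVneq (u0 + yd_act t u0) 0; last first.
    exists (u0 + yd_act t u0); split=> //; split.
      have tst : (t * s * t^-1 = s)%g by rewrite ts mulgK.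
      by rewrite linearD /= u0s -{1}tst yd_cpt_act u0s.
    by rewrite linearD /= -yd_actM tt yd_act1 addrC.
  have {}tu : yd_act t u0 = - u0 by apply/eqP; rewrite -addr_eq0 addrC tu.
  have hs : yd_cpt s (yd_act e u0) = yd_act e u0 by rewrite -{1}es yd_cpt_act u0s.
  exists (yd_act e u0); split.
    by apply: contra_neq u00 => e0; rewrite -[u0]yd_act1 -(mulVg e) yd_actM e0 linear0.
  split=> //; have eV : (e * (s * t) = t * e)%g.
    have : (e * (s * t) * e^-1 = t)%g.
      have -> : (e * (s * t) * e^-1 = (e * s * e^-1) * (e * t * e^-1))%g.
        by rewrite !mulgA mulgKV.
      by rewrite es et mulgA ss mul1g.
    by move=> e1; rewrite -{2}e1 mulgKV.
  by rewrite -yd_actM -eV !yd_actM tu [yd_act s _]linearN /= (sact _ u0s) opprK.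
have vr : yd_act r v = - v by rewrite yd_actM vt sact.
have vs' := sact _ vs.
have rr : (r * r = 1)%g by rewrite mulgA -[(s * t * s)%g]mulgA ts mulgA ss mul1g tt.
have sr : (s * r = t)%g by rewrite mulgA ss mul1g.
have rs : (r * s = t)%g by rewrite -mulgA ts mulgA ss mul1g.
have tr : (t * r = s)%g by rewrite mulgA ts -mulgA tt mulg1.
have rt : (r * t = s)%g by rewrite -mulgA tt mulg1.
have r1 : r != 1%g.
  by apply: contraNneq st => e1; rewrite -[s]mulg1 -tt mulgA e1 mul1g.
have [rs' rt'] : r != s /\ r != t.
  by split; [apply: contraNneq t1|apply: contraNneq s1] => e1; apply/eqP;
     [apply: (mulgI s)|apply: (mulIg t)]; rewrite e1 ?mulg1 ?mul1g.
have cr : (c * r * c^-1 = s)%g.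
  have -> : (c * r * c^-1 = (c * s * c^-1) * (c * t * c^-1))%g by rewrite !mulgA mulgKV.
  by rewrite cs ct tr.
have actc g g' u : (c * g * c^-1 = g')%g ->
    yd_act g' (yd_act c u) = yd_act c (yd_act g u).
  by move=> <-; rewrite -!yd_actM mulgKV.
(* The element [c] carries [v] into the degrees [t] and [s * t]. By the signs below, each product of
   two opposite braiding coefficients is -1. *)
pose v2 := yd_act c v; pose v3 := yd_act c v2.
have v2t : yd_cpt t v2 = v2 by rewrite -cs yd_cpt_act vs.
have v3r : yd_cpt r v3 = v3 by rewrite -ct yd_cpt_act v2t.
have v2s : yd_act s v2 = - v2 by rewrite (actc _ _ _ cr) vr linearN.
have v2r : yd_act r v2 = v2 by rewrite (actc _ _ _ ct) vt.
have v2t' : yd_act t v2 = - v2 by rewrite (actc _ _ _ cs) vs' linearN.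
have v3s : yd_act s v3 = v3 by rewrite (actc _ _ _ cr) v2r.
have v3t : yd_act t v3 = - v3 by rewrite (actc _ _ _ cs) v2s linearN.
have v3r' : yd_act r v3 = - v3 by rewrite (actc _ _ _ ct) v2t' linearN.
have [f0 f0v] := separating_form v0.
(* Symmetrizing under [t] gives an eigenform of the four-group, with twice the value of [f0] at
   [v]. *)
pose f1 : form := (f0 \o yd_cpt s) \+ (f0 \o (yd_cpt s \o yd_act t)).
have f1E u : f1 u = f0 (yd_cpt s u) + f0 (yd_cpt s (yd_act t u)) by [].
have cpt_t u : yd_cpt s (yd_act t u) = yd_act t (yd_cpt s u).
  by rewrite -yd_cpt_act ts mulgK.
have f1c a u : f1 (yd_cpt a u) = if a == s then f1 u else 0.
  rewrite !f1E !cpt_t yd_cpt_cpt eq_sym; case: eqP => [->|_] //.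
  by rewrite !linear0 addr0.
have f1t u : f1 (yd_act t u) = f1 u.
  by rewrite !f1E -yd_actM tt yd_act1 addrC.
have f1s u : f1 (yd_act s u) = - f1 u.
  have cpt_s w : yd_cpt s (yd_act s w) = - yd_cpt s w.
    have sE : (s * s * s^-1 = s)%g by rewrite mulgK.
    by rewrite -{1}sE yd_cpt_act sact // yd_cpt_cpt eqxx.
  rewrite !f1E cpt_s -yd_actM ts yd_actM cpt_s !linearN /=.
  by rewrite opprD.
have f1v : f1 v != 0.
  rewrite f1E vt vs; apply: contra_neq f0v => e1; exact: char0_addrr e1.
pose f2 : form := f1 \o yd_act c^-1; pose f3 : form := f2 \o yd_act c^-1.
have d1 : form_degree f1 s by [].
have d2 : form_degree f2 t by rewrite -cs; apply: form_degree_conj.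
have d3 : form_degree f3 r by rewrite -ct; apply: form_degree_conj.
have e1s : form_eigen f1 s (-1) by move=> u; rewrite f1s mulN1r.
have e1t : form_eigen f1 t 1 by move=> u; rewrite f1t mul1r.
have e1r : form_eigen f1 r (-1) by move=> u; rewrite yd_actM f1s f1t mulN1r.
have e2t : form_eigen f2 t (-1) by rewrite -cs; apply: form_eigen_conj.
have e2r : form_eigen f2 r 1 by rewrite -ct; apply: form_eigen_conj.
have e2s : form_eigen f2 s (-1) by rewrite -cr; apply: form_eigen_conj.
have e3r : form_eigen f3 r (-1) by rewrite -ct; apply: form_eigen_conj.
have e3s : form_eigen f3 s 1 by rewrite -cr; apply: form_eigen_conj.
have e3t : form_eigen f3 t (-1) by rewrite -cs; apply: form_eigen_conj.
have HP : group_set [set 1%g; s; t; r].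
  apply/group_setP; split=> [|x y]; first by rewrite !inE eqxx.
  rewrite !inE -!orbA => /or4P[]/eqP-> /or4P[]/eqP->;
  by rewrite ?(mul1g, mulg1, ss, tt, ts, sr, rs, tr, rt, rr) eqxx ?orbT.
pose H := Group HP.
have [sH tH rH] : [/\ s \in H, t \in H & r \in H] by rewrite !inE !eqxx ?orbT.
have HE (f : form) (x y z : k) :
    form_eigen f s x -> form_eigen f t y -> form_eigen f r z ->
    forall g, g \in H -> exists x0, form_eigen f g x0.
  move=> fs ft fr g; rewrite !inE -!orbA => /or4P[]/eqP->; last by exists z.
  - by exists 1 => u; rewrite yd_act1 mul1r.
  - by exists x.
  - by exists y.
have st1 := line_form_stable d1 (HE _ _ _ _ e1s e1t e1r).
have st2 := line_form_stable d2 (HE _ _ _ _ e2s e2t e2r).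
have FWst := line_form_stable d3 (HE _ _ _ _ e3s e3t e3r).
have FVst := stable_forms_or st1 st2.
have deg0 (f : form) a b u : form_degree f a -> yd_cpt b u = u -> b != a -> f u = 0.
  by move=> fa ub ba; rewrite -ub fa (negPf ba).
have in_line (f : form) : line_form f f by exists 1 => u; rewrite mul1r.
(* [y] is the imaginary root vector: its degree s t (s t) is 1, so its self-braiding is 1. *)
pose x := talg_ad t v2 (tin v3); pose y := talg_ad s v x.
have My : Mstr H (fun f => line_form f1 f \/ line_form f2 f) (line_form f3) 2 y.
  apply: Mstr_ad => // [h [z ->]|].
    by rewrite (deg0 _ _ _ _ d3 vs) ?mulr0 // eq_sym.
  apply: Mstr_ad => // [h [z ->]|].
    by rewrite (deg0 _ _ _ _ d3 v2t) ?mulr0 // eq_sym.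
  apply: (Mstr_tin _ rH v3r) => f [|] [z ->].
    by rewrite (deg0 _ _ _ _ d1 v3r) ?mulr0.
  by rewrite (deg0 _ _ _ _ d2 v3r) ?mulr0.
have x_s : talg_cpt s x = x.
  by rewrite -{1}tr; apply: talg_ad_homog; rewrite ?talg_cpt_tin ?v3r.
have y1 : talg_cpt 1%g y = y by rewrite -ss; apply: talg_ad_homog.
apply: (nichols_infinite_fixed char0 FVst FWst (fs := [:: f2; f1]) (h := f3) (g := 1%g)
  _ _ _ My y1) => //=.
- by split; [right; apply: in_line|split; [left; apply: in_line|]].
- by rewrite !inE eqxx.
- exact: talg_act1.
have sts : (s * s * s^-1 = s)%g by rewrite mulgK.
have trt : (t * r * t^-1 = r)%g by rewrite tr; apply: (mulIg t); rewrite mulgKV rt.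
have srs : (s * r * s^-1 = r)%g by rewrite sr; apply: (mulIg s); rewrite mulgKV rs.
(* The factor 2 is 1 - (-1), with -1 the label of the edge between [v2] and [v3]. *)
have Dx : skew_der f2 x = (f2 v2 *+ 2 : k) *: tin v3.
  rewrite /x (skew_der_ad_tin (t := r)) // ?trt ?v2r ?v3t; last first.
    by rewrite -v3t e2t (deg0 _ _ _ _ d2 v3r) ?mulr0.
  by rewrite raddfN scalerN opprK -scalerDl.
have Dy : skew_der f2 y = - (f2 v2 *+ 2 : k) *: talg_ad s v (tin v3).
  rewrite /y (skew_der_ad_homog f2 vs x_s) sts e2s.
  rewrite (deg0 _ _ _ _ d2 vs) // mulr0 !scale0r subr0 add0r.
  rewrite (@skew_der_scale _ _ _ f2 (f2 \o yd_act s) (-1) x e2s) Dx.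
  by rewrite scaleN1r linearN linearZ /= scaleNr.
rewrite /multi_der /= Dy !skew_derZ (skew_der_ad_tin (t := r)) ?srs ?v3s //; last first.
  by rewrite (deg0 _ _ _ _ d1 v3r).
rewrite e1r mulN1r -scalerBl opprK skew_derZ skew_der_tin.
have cK u : yd_act c^-1 (yd_act c u) = u by rewrite -yd_actM mulVg yd_act1.
have v2E : f2 v2 = f1 v by rewrite -[LHS]/(f1 (yd_act c^-1 (yd_act c v))) cK.
have v3E : f3 v3 = f1 v by rewrite -[LHS]/(f2 (yd_act c^-1 (yd_act c v2))) cK v2E.
have n2 : f1 v + f1 v != 0 by apply: contra_neq f1v => /char0_addrr ->.
by rewrite v2E v3E mulr2n !scaler_eq0 oppr_eq0 oner_eq0 !negb_or n2 f1v.
Qed.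

End Triangle.
End DegreeTwo.

(** * The symmetric group *)

Section SymmetricGroup.
Context (k : closedFieldType) (char0 : [pchar k] =i pred0).
Context (n : nat) (n_ge3 : (3 <= n)%N) (U : ydModType k 'S_n).
Hypothesis fin : findim (nichols U).
Implicit Types (s t g : 'S_n) (u v w : U).

Let real (g : 'S_n) : exists a : 'S_n, (a * g * a^-1 = g^-1)%g := perm_conj_inv g.

(** An element acting by -1 on [u] has a cube acting by -1, so the cube is not the identity. *)
Lemma support_order s u : u != 0 -> yd_cpt s u = u -> exists x, s (s (s x)) != x.
Proof.
move=> u0 us; apply/existsP; apply: contraNT u0; rewrite negb_exists => /forallP s3.
have sss : (s * s * s = 1)%g.
  by apply/permP=> x; rewrite !permM perm1; apply/eqP/negPn/s3.
have su := yd_self_action char0 real fin us.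
have : yd_act (s * s * s)%g u = - u.
  have suN : yd_act s (- u) = u by rewrite linearN /= su opprK.
  by rewrite !yd_actM su suN su.
rewrite sss yd_act1 => e; apply/eqP/(char0_addrr char0).
by rewrite {1}e addNr.
Qed.

Lemma no_free_involution_S4 s u : u != 0 -> yd_cpt s u = u -> n = 4%N ->
  ~ free_involution s.
Proof.
move=> u0 us n4 fs; have T4 : #|'I_n| = 4%N by rewrite card_ord.
have [t [e [c [[ss tt ts] [s1 t1 st] [es et] [cs ct]]]]] := klein_four T4 fs.
exact: (triangle_obstruction char0 real fin ss tt ts s1 t1 st es et cs ct u0 us).
Qed.

(** Four points are excluded by the triangle. On more points [t] has three 2-cycles, and two
    transpositions joining them into a path give the degrees of [hexagon_degrees]. *)
Lemma no_transposition_involution (p : {linear U -> U}) s t v w :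
    (forall u, p (p u) = p u) -> (forall g u, p (yd_act g u) = yd_act g (p u)) ->
    (forall s u, p (yd_cpt s u) = yd_cpt s (p u)) ->
    p v = 0 -> v != 0 -> yd_cpt s v = v -> p w = w -> w != 0 -> yd_cpt t w = w ->
  (exists x y, x != y /\ s = tperm x y) -> ~ free_involution t.
Proof.
move=> pK pact pcpt pv v0 vs pw w0 wt [y [z [yz sE]]] [tf tt].
have n4 : (4 <= #|'I_n|)%N.
  by apply: (free_card_ge4 _ tf (support_order w0 wt)); rewrite card_ord.
have [n5|] := ltnP 4 #|'I_n|; last first.
  rewrite card_ord in n4 *; move=> n5.
  by apply: (no_free_involution_S4 w0 wt) => //; apply/eqP; rewrite eqn_leq n4 n5.
have [x1 [x3 [x5 Ux]]] := three_transpositions n5 tf tt.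
(* All transpositions are conjugate, so translates of [v] reach each of these degrees within the
   kernel of [p]. *)
have move_to a b : a != b ->
    exists v', [/\ p v' = 0, yd_cpt (tperm a b) v' = v' & v' != 0].
  move=> ab; have [h [hy hz]] : exists h : 'S_n, h y = a /\ h z = b.
    have [||h [hy hz]] := @perm_extend _ [:: y; z] [:: a; b] _ _ erefl.
    - by rewrite /= inE yz.
    - by rewrite /= inE ab.
    by exists h.
  exists (yd_act h^-1%g v); split.
  - by rewrite pact pv linear0.
  - rewrite -hy -hz -tpermJ -sE conjgE -{2}[h]invgK mulgA.
    exact: yd_act_homog_conj.
  - by apply: contra_neq v0 => e; rewrite -[v]yd_act1 -(mulgV h) yd_actM e linear0.
have [/move_to[v2 [pv2 v2s v20]] /move_to[v1 [pv1 v1r v10]]] :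
    t x1 != x3 /\ t x3 != x5.
  move: Ux; rewrite /= !inE !negb_or.
  by case/and5P=> _ /and4P[-> _ _ _] _ /andP[-> _] _.
have [d1 d2 d3] := hexagon_degrees tt Ux.
exact: (degree_two_obstruction char0 real fin pK pact pcpt pv1 v1r v10
  pv2 v2s v20 pw wt w0 d1 d2 d3).
Qed.

Lemma no_two_summands (p : {linear U -> U}) v0 w0 :
    (forall u, p (p u) = p u) -> (forall g u, p (yd_act g u) = yd_act g (p u)) ->
    (forall s u, p (yd_cpt s u) = yd_cpt s (p u)) ->
    p v0 = 0 -> v0 != 0 -> p w0 = w0 -> w0 != 0 ->
  False.
Proof.
move=> pK pact pcpt pv v0n pw w0n.
have homog u : u != 0 -> exists s, yd_cpt s u != 0.
  move=> u0; apply/existsP; apply: contraNT u0; rewrite negb_exists => /forallP u0.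
  by rewrite -[u]yd_cpt_sum big1 // => s _; apply/eqP/negPn/u0.
have [[s vs] [t wt]] := (homog _ v0n, homog _ w0n).
pose v := yd_cpt s v0; pose w := yd_cpt t w0.
have vs' : yd_cpt s v = v by rewrite /v yd_cpt_cpt eqxx.
have wt' : yd_cpt t w = w by rewrite /w yd_cpt_cpt eqxx.
have pv' : p v = 0 by rewrite /v pcpt pv linear0.
have pw' : p w = w by rewrite /w pcpt pw.
have quad : always_quadratic s t.
  move=> h; have -> : (t ^ h = h^-1 * t * (h^-1)^-1)%g by rewrite conjgE invgK mulgA.
  (* Conjugates of [t] are again degrees of the image of [p], reached by translates of [w]. *)
  apply: (supports_quadratic char0 real fin pK pact pcpt pv' vs' vs
    (w := yd_act h^-1%g w)).
  - by rewrite pact pw'.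
  - exact: yd_act_homog_conj.
  - by apply: contra_neq wt => e; rewrite -/w -[w]yd_act1 -(mulgV h) yd_actM e linear0.
have T3 : (3 <= #|'I_n|)%N by rewrite card_ord.
case: (quadratic_classes T3 (support_order vs vs') (support_order wt wt') quad).
- by rewrite card_ord => -[n4]; apply: (no_free_involution_S4 vs vs').
- by rewrite card_ord => -[n4]; apply: (no_free_involution_S4 wt wt').
- by case; apply: (no_transposition_involution pK pact pcpt pv' vs vs' pw' wt wt').
(* The complementary projection exchanges the two summands. *)
case; pose p' : {linear U -> U} := idfun \- p.
have p'E u : p' u = u - p u by [].
apply: (@no_transposition_involution p' t s w v) => //.
- by move=> u; rewrite !p'E linearB /= pK subrr subr0.
- by move=> g u; rewrite !p'E linearB /= pact.
- by move=> g u; rewrite !p'E linearB /= pcpt.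
- by rewrite p'E pw' subrr.
- by rewrite p'E pv' subr0.
Qed.

End SymmetricGroup.

Theorem corollary8p4 (k : closedFieldType) (char0 : [pchar k] =i pred0)
    (n : nat) (n_ge3 : (3 <= n)%N)
    (U : ydModType k 'S_n) (U_neq0 : exists u : U, u != 0) :
  findim (nichols U) -> yd_irreducible U.
Proof.
move=> fin; split=> // W Wyd; apply: contrapT.
move=> /not_orP[/existsNP[w] nw /existsNP[u uW]].
have [wW w0] : w \in W /\ w != 0.
  by have /not_implyP[wW /eqP w0] := nw.
(* The image of [p] is [W], which contains [w]; its kernel contains [u - p u], nonzero because [u]
   lies outside [W]. *)
have [p [pW pid pact pcpt]] := yd_complement char0 Wyd.
have pK x : p (p x) = p x by apply: pid.
apply: (@no_two_summands _ char0 _ n_ge3 _ fin p (u - p u) w) => //.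
- by rewrite linearB /= pK subrr.
- by apply: contra_notN uW; rewrite subr_eq0 => /eqP->.
- exact: pid.
Qed.
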